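(* Let $S \in L^\infty((1,2);\mathbb{C})$ satisfy $\operatorname{Re} S \ge \nu$ almost everywhere for some number $\nu > 0$. Consider the operator $A_S: \operatorname{dom}(A_S) \subseteq L^2(0,1)^2 \times L^2(1,2) \to L^2(0,1)^2 \times L^2(1,2)$ given by $$A_S \begin{pmatrix} v_1 \\ v_2 \\ w_1 \end{pmatrix} = \begin{pmatrix} \frac{d}{d\zeta} v_2 \\ \frac{d}{d\zeta} v_1 \\ \frac{d}{d\zeta}\big( S \frac{d}{d\zeta} w_1\big) \end{pmatrix}$$ with domain consisting of all $(v_1,v_2,w_1)$ such that $v_1, v_2 \in H^1(0,1)$, $w_1 \in H^1(1,2)$, $S\frac{d}{d\zeta} w_1 \in H^1(1,2)$, and $v_1(0) = w_1(2) = 0$, $v_1(1) = w_1(1)$, $v_2(1) = \big(S \frac{d}{d\zeta} w_1\big)(1)$. Then $A_S$ generates a strongly stable $C_0$-semigroup.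
   Context: All function spaces consist of complex-valued functions. A $C_0$-semigroup $(e^{tA})_{t\ge0}$ on a Hilbert space $H$ is strongly stable if $e^{tA}h \to 0$ as $t \to \infty$ for each $h \in H$. *)

(* Defs.v *)
From HB Require Import structures.
From mathcomp Require Import all_boot all_order all_algebra.
From mathcomp Require Import complex.
From mathcomp Require Import all_classical all_reals all_analysis.
From mathcomp Require Import measurable_realfun.

Set Implicit Arguments.
Unset Strict Implicit.
Unset Printing Implicit Defensive.
Import Order.TTheory GRing.Theory Num.Theory.
Import numFieldNormedType.Exports.

Local Open Scope classical_set_scope.
Local Open Scope ring_scope.
Local Open Scope complex_scope.
Local Open Scope quotient_scope.

Section ComplexLp.
Context d (T : measurableType d) (R : realType).
Variable mu : {measure set T -> \bar R}.
Implicit Types f g : T -> R[i].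

Definition cmeasurable f :=
  measurable_fun setT (fun x => complex.Re (f x)) /\
  measurable_fun setT (fun x => complex.Im (f x)).

Lemma normc_ge0 (c : R[i]) : 0 <= Normc.normc c.
Proof. by case: c => a b; exact: sqrtr_ge0. Qed.

Definition cabs f : T -> R := fun x => Normc.normc (f x).

(* Complex-valued L^p(mu), before identification of a.e. equal functions. *)
Definition cLfun (p : \bar R) : {pred T -> R[i]} :=
  mem [set f | cmeasurable f /\ finite_norm mu p (cabs f)].

Lemma cLfunP p f :
  reflect (cmeasurable f /\ finite_norm mu p (cabs f)) (f \in cLfun p).
Proof. by apply: (iffP idP); rewrite inE. Qed.

Lemma cabsE f : cabs f =
  (fun x => Num.sqrt (complex.Re (f x) ^+ 2 + complex.Im (f x) ^+ 2)).
Proof. by apply/funext => x; rewrite /cabs; case: (f x). Qed.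

Lemma cabs_ge0 f x : 0 <= cabs f x.
Proof. exact: normc_ge0. Qed.

Lemma measurable_cabs f : cmeasurable f -> measurable_fun setT (cabs f).
Proof.
move=> [mr mi]; rewrite cabsE.
apply: (measurableT_comp (f := @Num.sqrt R)).
  by apply: continuous_measurable_fun; exact: sqrt_continuous.
by apply: measurable_funD; apply: measurable_funX.
Qed.

Lemma cabs_Lfun f p : f \in cLfun p -> cabs f \in Lfun mu p.
Proof.
move=> /cLfunP[mf ff]; apply/andP; split; rewrite inE//=.
exact: measurable_cabs.
Qed.

Lemma le_Lnorm2 (f g : T -> R) : measurable_fun setT f -> measurable_fun setT g ->
  (forall x, `|f x| <= `|g x|) ->
  ('N[mu]_2%:E[EFin \o f] <= 'N[mu]_2%:E[EFin \o g])%E.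
Proof.
move=> mf mg fg; rewrite unlock /Lnorm.
have mP (h : T -> R) : measurable_fun setT h ->
    measurable_fun setT (fun x : T => (`|(EFin \o h) x| `^ 2)%E).
  move=> mh; rewrite [X in measurable_fun _ X](_ : _ =
    EFin \o (fun x => `|h x| `^ 2)); last by apply/funext.
  apply/measurable_EFinP; apply: (measurableT_comp (measurable_powR _)).
  exact: measurableT_comp.
apply: gt0_ler_poweR.
- by rewrite invr_ge0.
- by rewrite in_itv/= leey integral_ge0// => x _; exact: poweR_ge0.
- by rewrite in_itv/= leey integral_ge0// => x _; exact: poweR_ge0.
apply: ge0_le_integral => //.
- by move=> x _; exact: poweR_ge0.
- exact: mP.
- exact: mP.
move=> x _; rewrite /= lee_fin; apply: ge0_ler_powR => //=;
  by rewrite nnegrE.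
Qed.

Lemma cmeasurableD f g : cmeasurable f -> cmeasurable g -> cmeasurable (f + g).
Proof.
move=> [fr fi] [gr gi]; split.
  rewrite [X in measurable_fun _ X](_ : _ =
    (fun x => complex.Re (f x) + complex.Re (g x))).
    exact: measurable_funD.
  by apply/funext => x; rewrite fctE; case: (f x) (g x) => [? ?] [? ?].
rewrite [X in measurable_fun _ X](_ : _ =
  (fun x => complex.Im (f x) + complex.Im (g x))).
  exact: measurable_funD.
by apply/funext => x; rewrite fctE; case: (f x) (g x) => [? ?] [? ?].
Qed.

Lemma cmeasurableM f g : cmeasurable f -> cmeasurable g ->
  cmeasurable (fun x => f x * g x).
Proof.
move=> [fr fi] [gr gi]; split.
  rewrite [X in measurable_fun _ X](_ : _ =
    (fun x => complex.Re (f x) * complex.Re (g x)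
            - complex.Im (f x) * complex.Im (g x))).
    by apply: measurable_funB; exact: measurable_funM.
  by apply/funext => x; case: (f x) (g x) => [? ?] [? ?].
rewrite [X in measurable_fun _ X](_ : _ =
  (fun x => complex.Re (f x) * complex.Im (g x)
          + complex.Im (f x) * complex.Re (g x))).
  by apply: measurable_funD; exact: measurable_funM.
by apply/funext => x; case: (f x) (g x) => [? ?] [? ?].
Qed.

Lemma cmeasurable_cst (c : R[i]) : cmeasurable (fun=> c).
Proof. by split. Qed.

Lemma cmeasurableZ (c : R[i]) f : cmeasurable f -> cmeasurable (c *: f).
Proof. exact: (cmeasurableM (cmeasurable_cst c)). Qed.

Lemma cabsZ (c : R[i]) f : cabs (c *: f) = Normc.normc c *: cabs f.
Proof. by apply/funext => x; rewrite /cabs fctE Normc.normcM. Qed.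

Lemma cabsD_le f g x : cabs (f + g) x <= cabs f x + cabs g x.
Proof. exact: le_normcD. Qed.

#[local] Notation two1 := (lee1n 2).

Lemma Lnorm_cabsD f g : f \in cLfun 2%:E -> g \in cLfun 2%:E ->
  ('N[mu]_2%:E[EFin \o cabs (f + g)%R] <=
   'N[mu]_2%:E[EFin \o cabs f] + 'N[mu]_2%:E[EFin \o cabs g])%E.
Proof.
move=> /cLfunP[mf ff] /cLfunP[mg fg].
apply: (@le_trans _ _ 'N[mu]_2%:E[EFin \o (cabs f \+ cabs g)%R]%E).
  apply: le_Lnorm2.
  - exact/measurable_cabs/cmeasurableD.
  - by apply: measurable_funD; exact: measurable_cabs.
  - move=> x; rewrite ger0_norm ?cabs_ge0// ger0_norm ?addr_ge0 ?cabs_ge0//.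
    exact: cabsD_le.
by apply: eminkowski; do ?[exact: two1|exact: measurable_cabs].
Qed.

Lemma Lnorm_cabsZ (c : R[i]) f : f \in cLfun 2%:E ->
  ('N[mu]_2%:E[EFin \o cabs (c *: f)] =
   (Normc.normc c)%:E * 'N[mu]_2%:E[EFin \o cabs f])%E.
Proof.
move=> /cabs_Lfun lf; rewrite cabsZ.
have := @LnormZ _ _ _ mu 2%:E two1 (Lfun_Sub two1 lf) (Normc.normc c).
by rewrite ger0_norm ?normc_ge0.
Qed.

Lemma cLfun2_submod_closed : submod_closed (cLfun 2%:E).
Proof.
split.
  apply/cLfunP; split; first exact: cmeasurable_cst.
  rewrite (_ : cabs 0 = cst 0); first exact: (@finite_norm_cst0 _ _ _ mu _ two1).
  by apply/funext => x; rewrite /cabs; exact: Normc.normc0.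
move=> a f g lf lg.
have /cLfunP[mf ff] := lf; have /cLfunP[mg fg] := lg.
have laf : a *: f \in cLfun 2%:E.
  apply/cLfunP; split; first exact: cmeasurableZ.
  rewrite /finite_norm Lnorm_cabsZ// lte_mul_pinfty// lee_fin.
  exact: normc_ge0.
apply/cLfunP; split; first by apply: cmeasurableD => //; exact: cmeasurableZ.
by rewrite /finite_norm (le_lt_trans (Lnorm_cabsD laf lg))// lte_add_pinfty//;
  have /cLfunP[] := laf.
Qed.

HB.instance Definition _ :=
  GRing.isSubmodClosed.Build _ _ (cLfun 2%:E) cLfun2_submod_closed.

Record L2fun := MkL2fun { L2val :> T -> R[i]; _ : L2val \in cLfun 2%:E }.
HB.instance Definition _ := [isSub for L2val].
HB.instance Definition _ := [Choice of L2fun by <:].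
HB.instance Definition _ := [SubChoice_isSubLmodule of L2fun by <:].

Lemma L2funP (f : L2fun) : L2val f \in cLfun 2%:E. Proof. exact: valP. Qed.

Definition L2null : {pred L2fun} := mem [set f : L2fun | L2val f = cst 0 %[ae mu]].

Lemma L2null_submod_closed : submod_closed L2null.
Proof.
split; first by rewrite inE; apply: ae_eq_refl.
move=> a f g; rewrite !inE; apply: filterS2 => x /(_ I) /= f0 /(_ I) /= g0 _.
by change (a *: L2val f x + L2val g x = 0); rewrite f0 g0 scaler0 addr0.
Qed.

HB.instance Definition _ :=
  GRing.isSubmodClosed.Build _ _ L2null L2null_submod_closed.

Definition L2 : Type := {ideal_quot L2null}.
HB.instance Definition _ := GRing.Zmodule.on L2.
HB.instance Definition _ := EqQuotient.on L2.

Definition L2rep (u : L2) : T -> R[i] := L2val (repr u).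

Lemma L2eqP (f g : L2fun) :
  \pi_L2 f = \pi_L2 g <-> L2val f = L2val g %[ae mu].
Proof.
rewrite /L2; split.
  move=> /eqP; rewrite -Quotient.idealrBE inE.
  by apply: filterS => x /(_ I) /= h _; apply/eqP; rewrite -subr_eq0; exact/eqP.
move=> fg; apply/eqP; rewrite -Quotient.idealrBE inE.
by apply: filterS fg => x /(_ I) /= h _; rewrite fctE h subrr.
Qed.

Lemma L2repP (f : L2fun) : L2rep (\pi_L2 f) = f %[ae mu].
Proof. by apply/L2eqP; rewrite reprK. Qed.

(* The class of f when f is square integrable, and 0 otherwise. *)
Definition toL2 (f : T -> R[i]) : L2 := \pi_L2 (insubd (0 : L2fun) f).

Lemma toL2P (f : T -> R[i]) : f \in cLfun 2%:E -> L2rep (toL2 f) = f %[ae mu].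
Proof.
move=> lf; rewrite -[X in _ = X %[ae mu]](@insubdK _ _ L2fun 0 f lf).
exact: L2repP.
Qed.

Definition L2scale (a : R[i]) (u : L2) : L2 := \pi_L2 (a *: repr u).

Lemma pi_L2D (f g : L2fun) : \pi_L2 (f + g) = \pi_L2 f + \pi_L2 g.
Proof. exact: raddfD. Qed.

Lemma pi_L2scale a (f : L2fun) : L2scale a (\pi_L2 f) = \pi_L2 (a *: f).
Proof.
apply/L2eqP; have := L2repP f.
by apply: filterS => x /(_ I) h _; exact: (congr1 (fun z => a * z) h).
Qed.

Lemma L2scaleA a b u : L2scale a (L2scale b u) = L2scale (a * b) u.
Proof. by rewrite [RHS]/L2scale -scalerA -(pi_L2scale a (b *: repr u)). Qed.

Lemma L2scale1 : left_id 1 L2scale.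
Proof. by move=> u; rewrite /L2scale scale1r reprK. Qed.

Lemma L2scaleDr : right_distributive L2scale +%R.
Proof.
move=> a u v; rewrite -{1}[u]reprK -{1}[v]reprK -pi_L2D pi_L2scale.
by rewrite scalerDr pi_L2D.
Qed.

Lemma L2scaleDl u : {morph L2scale^~ u : a b / a + b}.
Proof. by move=> a b; rewrite /L2scale scalerDl pi_L2D. Qed.

HB.instance Definition _ := GRing.Zmodule_isLmodule.Build R[i] L2
  L2scaleA L2scale1 L2scaleDr L2scaleDl.

Definition L2norm (u : L2) : R := fine ('N[mu]_2%:E[EFin \o cabs (L2rep u)]).

Lemma L2normE u : (L2norm u)%:E = 'N[mu]_2%:E[EFin \o cabs (L2rep u)]%E.
Proof.
rewrite /L2norm fineK// fin_numElt (lt_le_trans ltNy0) ?Lnorm_ge0//=.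
by have /cLfunP[] := L2funP (repr u).
Qed.

Lemma Lnorm2_ae (f g : T -> R) : measurable_fun setT f -> measurable_fun setT g ->
  f = g %[ae mu] -> 'N[mu]_2%:E[EFin \o f]%E = 'N[mu]_2%:E[EFin \o g]%E.
Proof.
move=> mf mg fg; rewrite unlock /Lnorm; congr (_ `^ _)%E.
have mP (h : T -> R) : measurable_fun setT h ->
    measurable_fun setT (fun x : T => (`|(EFin \o h) x| `^ 2)%E).
  move=> mh; rewrite [X in measurable_fun _ X](_ : _ =
    EFin \o (fun x => `|h x| `^ 2)); last by apply/funext.
  apply/measurable_EFinP; apply: (measurableT_comp (measurable_powR _)).
  exact: measurableT_comp.
apply: ae_eq_integral => //.
- exact: mP.
- exact: mP.
by apply: filterS fg => x /(_ I) h _; rewrite /= h.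
Qed.

Lemma L2norm_pi (f : L2fun) :
  (L2norm (\pi_L2 f))%:E = 'N[mu]_2%:E[EFin \o cabs f]%E.
Proof.
rewrite L2normE; apply: Lnorm2_ae.
- by apply: measurable_cabs; have /cLfunP[] := L2funP (repr (\pi_L2 f)).
- by apply: measurable_cabs; have /cLfunP[] := L2funP f.
by have := L2repP f; apply: filterS => x /(_ I) h _; rewrite /cabs h.
Qed.

Lemma L2norm_triangle u v : L2norm (u + v) <= L2norm u + L2norm v.
Proof.
rewrite -[u]reprK -[v]reprK -pi_L2D -lee_fin EFinD !L2norm_pi.
by apply: Lnorm_cabsD; exact: L2funP.
Qed.

Lemma L2normZ a u : L2norm (a *: u) = Normc.normc a * L2norm u.
Proof.
apply: EFin_inj; rewrite EFinM -[u]reprK.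
rewrite [a *: _]pi_L2scale !L2norm_pi.
by rewrite Lnorm_cabsZ//; exact: L2funP.
Qed.

Lemma L2norm_eq0 u : L2norm u = 0 -> u = 0.
Proof.
move=> u0; rewrite -[u]reprK; rewrite (_ : 0 = \pi_L2 0); last by rewrite raddf0.
apply/L2eqP.
have n0 : 'N[mu]_2%:E[EFin \o cabs (L2rep u)]%E = 0%E by rewrite -L2normE u0.
have /cLfunP[/measurable_cabs/measurable_EFinP mu_ _] := L2funP (repr u).
have p0 : (0 < 2%:E :> \bar R)%E by rewrite lte_fin.
have := Lnorm_eq0_eq0 mu_ p0 n0.
apply: filterS => x /(_ I) /= [h] _.
exact: Normc.eq0_normc.
Qed.

Let normC (u : L2) : R[i] := (L2norm u)%:C.

Let normC_triangle u v : normC (u + v) <= normC u + normC v.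
Proof. by rewrite /normC -rmorphD/= lecR L2norm_triangle. Qed.

Let normCZ a u : normC (a *: u) = `|a| * normC u.
Proof. by rewrite /normC L2normZ rmorphM. Qed.

Let normC_eq0 u : normC u = 0 -> u = 0.
Proof. by move=> [] /L2norm_eq0. Qed.

HB.instance Definition _ := Lmodule_isNormed.Build R[i] L2
  normC_triangle normCZ normC_eq0.

Lemma L2_normE (u : L2) : `|u| = (L2norm u)%:C.
Proof. by []. Qed.

End ComplexLp.

Section Sobolev.
Variable R : realType.
Implicit Types a b : R.

(* Lebesgue measure concentrated on ]a, b[: functions on the interval are
   represented by functions on R whose values outside ]a, b[ are irrelevant. *)
Definition leb a b : {measure set (measurableTypeR R) -> \bar R} :=
  mrestr (@lebesgue_measure R) (measurable_itv `]a, b[).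

Definition L2itv a b := L2 (leb a b).

Definition cRintegral a b (f : R -> R[i]) : R[i] :=
  (\int[leb a b]_x complex.Re (f x)) +i* (\int[leb a b]_x complex.Im (f x)).

(* Real test functions are enough, since both sides of the identity defining
   weak derivatives are complex linear in the test function. *)
Definition test_function a b (phi : R -> R) :=
  [/\ forall n x, derivable (derive1n n phi) x 1,
      compact (closure [set x | phi x != 0]) &
      closure [set x | phi x != 0] `<=` `]a, b[%classic].

Definition weak_derivative a b (f g : L2itv a b) :=
  forall phi, test_function a b phi ->
    cRintegral a b (fun x => L2rep f x * (derive1 phi x)%:C) =
    - cRintegral a b (fun x => L2rep g x * (phi x)%:C).

Definition H1 a b : set (L2itv a b) := [set f | exists g, weak_derivative f g].

(* The derivative of f when f is in H1, and 0 otherwise. *)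
Definition ddz a b (f : L2itv a b) : L2itv a b :=
  xget 0 [set g | weak_derivative f g].

(* The representative of f that is continuous on [a, b], for f in H1: boundary
   values of f are the values of crep f at a and b. The value of crep f outside
   [a, b], and on classes without continuous representative, is irrelevant. *)
Definition crep a b (f : L2itv a b) : R -> R[i]^o :=
  xget (fun=> 0) [set F : R -> R[i]^o |
    {within `[a, b], continuous F} /\ F = L2rep f %[ae leb a b]].

(* For S in L^oo the product is square integrable, so that the default value of
   toL2 is not used. *)
Definition mulS a b (S : R -> R[i]) (f : L2itv a b) : L2itv a b :=
  toL2 (leb a b) (fun x => S x * L2rep f x).

End Sobolev.

Section Semigroup.
Variables (R : realType) (V : normedModType R[i]).
Implicit Types (T : R -> V -> V) (D : set V) (A : V -> V).

(* Only the operators T t with 0 <= t matter. *)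
Definition C0_semigroup T :=
  [/\ forall t, 0 <= t -> linear (T t) /\ continuous (T t),
      forall x, T 0 x = x,
      forall s t x, 0 <= s -> 0 <= t -> T (s + t) x = T s (T t x) &
      forall x, T t x @[t --> 0^'+] --> x].

(* The operator A with domain D is the infinitesimal generator of T; the values
   of A outside D do not matter. *)
Definition is_generator D A T :=
  forall x y, (t^-1)%:C *: (T t x - x) @[t --> 0^'+] --> y <-> D x /\ y = A x.

Definition strongly_stable T := forall x, T t x @[t --> +oo] --> 0.

End Semigroup.

Section WaveHeat.
Variable R : realType.

(* The norm of this product is the maximum of the three L^2 norms; it is
   equivalent to the Hilbert norm of the direct sum. *)
Definition state := (L2itv (0 : R) 1 * L2itv (0 : R) 1 * L2itv (1 : R) 2)%type.

Definition opA (S : R -> R[i]) (x : state) : state :=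
  let: (v1, v2, w1) := x in (ddz v2, ddz v1, ddz (mulS S (ddz w1))).

Definition domA (S : R -> R[i]) : set state := [set x : state |
  let: (v1, v2, w1) := x in
  [/\ [/\ H1 v1, H1 v2, H1 w1 & H1 (mulS S (ddz w1))],
      crep v1 0 = 0 /\ crep w1 2 = 0,
      crep v1 1 = crep w1 1 &
      crep v2 1 = crep (mulS S (ddz w1)) 1]].

End WaveHeat.

(* Main.v *)
Require Import Defs.
From HB Require Import structures.
From mathcomp Require Import all_boot all_order all_algebra.
From mathcomp Require Import complex.
From mathcomp Require Import all_classical all_reals all_analysis.
From mathcomp Require Import measurable_realfun ess_sup_inf.
From mathcomp Require Import ring lra.
Set Implicit Arguments.
Unset Strict Implicit.
Unset Printing Implicit Defensive.
Import Order.TTheory GRing.Theory Num.Theory.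
Import numFieldNormedType.Exports.
Local Open Scope classical_set_scope.
Local Open Scope ring_scope.
Local Open Scope complex_scope.

(** The operator [A_S] is invertible with a bounded inverse [K], and everything is done
    with [K].

    Generation. Integration by parts on both intervals gives
    [Re <A_S x, x> = - \int Re S |w'|^2 <= 0]: the boundary terms cancel by the
    transmission conditions ([solves_dissipative]). Together with solvability of
    [A_S x = y] for every [y] ([graph_onto]) and the a priori bound [graph_bounded], this
    puts the inverse of [A_S] in the setting of the first part: a bounded injective
    dissipative operator [K] on a Hilbert space is the inverse of the generator of a
    contraction semigroup, obtained as the limit of implicit Euler schemes with dyadic
    step sizes ([dissipative_inverse_stable_semigroup]).

    Strong stability is a multiplier estimate. The multiplier [x] bounds the wave energy
    of a solution [u] by the time derivative of the weighted product
    [- 2 Re <x v1, v2>] plus the boundary values at the interface. One of these is the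
    trace of the temperature, which the dissipation of [u] controls. The other is the
    trace of the heat flux, controlled by the dissipation of [u] and the temperature of
    the time derivative [z = A_S u], that is, by the dissipations of [u] and of [z]
    ([graph_observable]). For [u] in the domain of the square of [A_S] all these
    quantities are integrable over time, hence so is [|u|^2], which is nonincreasing
    and thus decays like [1 / t]. Such [u] are dense and the semigroup is contractive,
    so every orbit tends to zero.

    Elements of L2 and H1 are classes of functions; the middle parts provide inner
    products, completeness, and absolutely continuous representatives of classes with
    a weak derivative, so that the integrations by parts can be carried out. *)

(** * Semigroups generated by the inverse of a dissipative operator *)

(** The real part of a complex inner product, which is what energies and dissipativity
    involve; [ip_normZ] keeps the compatibility of its norm with complex scalars. *)
Record inner_product (R : realType) (V : lmodType R[i]) (ip : V -> V -> R) :
    Prop := InnerProduct {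
  ipC : forall x y, ip x y = ip y x;
  ipDl : forall x y z, ip (x + y) z = ip x z + ip y z;
  ipZl : forall (r : R) x y, ip (r%:C *: x) y = r * ip x y;
  ip_normZ : forall (a : R[i]) x,
    ip (a *: x) (a *: x) = Normc.normc a ^+ 2 * ip x x;
  ip_ge0 : forall x, 0 <= ip x x;
  ip_eq0 : forall x, ip x x = 0 -> x = 0 }.

Definition inorm (R : realType) (V : lmodType R[i]) (ip : V -> V -> R) (x : V) :=
  Num.sqrt (ip x x).

Section InnerProduct.
Context (R : realType) (V : lmodType R[i]) (ip : V -> V -> R).
Hypothesis H : inner_product ip.
Local Notation nrm := (inorm ip).
Implicit Types (x y z : V) (r : R).

Lemma ipDr x y z : ip x (y + z) = ip x y + ip x z.
Proof. by rewrite (ipC H) (ipDl H) !(ipC H _ x). Qed.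

Lemma ipZr r x y : ip x (r%:C *: y) = r * ip x y.
Proof. by rewrite (ipC H) (ipZl H) (ipC H). Qed.

Lemma scaleNC x : - x = (-1)%:C *: x.
Proof. by rewrite rmorphN1 scaleN1r. Qed.

Lemma ipNl x y : ip (- x) y = - ip x y.
Proof. by rewrite scaleNC (ipZl H) mulN1r. Qed.

Lemma ipNr x y : ip x (- y) = - ip x y.
Proof. by rewrite (ipC H) ipNl (ipC H). Qed.

Definition ipE := (ipDl H, ipDr, ipNl, ipNr, ipZl H, ipZr).

(** Turns a linear identity between vectors into one between reals, where [ring]
    applies. *)
Lemma ip_inj x y : (forall z, ip x z = ip y z) -> x = y.
Proof.
move=> h; apply/eqP; rewrite -subr_eq0; apply/eqP/(ip_eq0 H).
by rewrite (ipDl H) ipNl h subrr.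
Qed.

Lemma inorm_sqr x : nrm x ^+ 2 = ip x x.
Proof. by rewrite sqr_sqrtr// (ip_ge0 H). Qed.

Lemma inorm_ge0 x : 0 <= nrm x. Proof. exact: sqrtr_ge0. Qed.

Lemma inorm_eq0 x : nrm x = 0 -> x = 0.
Proof. by move=> x0; apply: (ip_eq0 H); rewrite -inorm_sqr x0 expr0n. Qed.

Lemma inorm0 : nrm 0 = 0.
Proof. by rewrite /inorm -(scale0r 0) -(rmorph0 (real_complex R)) (ipZl H) mul0r sqrtr0. Qed.

Lemma inorm_le x (c : R) : 0 <= c -> ip x x <= c ^+ 2 -> nrm x <= c.
Proof. by move=> c0 h; rewrite -(ler_pXn2r (n := 2))// ?nnegrE ?inorm_ge0// inorm_sqr. Qed.

Lemma inormZ r x : nrm (r%:C *: x) = `|r| * nrm x.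
Proof.
by rewrite /inorm (ipZl H) ipZr mulrA -expr2 sqrtrM ?sqr_ge0// sqrtr_sqr.
Qed.

Lemma inormN x : nrm (- x) = nrm x.
Proof. by rewrite scaleNC inormZ normrN1 mul1r. Qed.

Lemma inormB x y : nrm (x - y) = nrm (y - x).
Proof. by rewrite -inormN opprB. Qed.

Lemma ip_CS x y : `|ip x y| <= nrm x * nrm y.
Proof.
have [y0|y0] := eqVneq (ip y y) 0.
  by rewrite (ip_eq0 H y0) inorm0 mulr0 -(scale0r 0) -(rmorph0 (real_complex R)) ipZr mul0r normr0.
have yp : 0 < ip y y by rewrite lt_neqAle eq_sym y0 (ip_ge0 H).
rewrite -(ler_pXn2r (n := 2))// ?nnegrE ?mulr_ge0 ?inorm_ge0//.
rewrite exprMn !inorm_sqr real_normK ?num_real//.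
have := ip_ge0 H (x + (- (ip x y / ip y y))%:C *: y).
rewrite !ipE (ipC H y x) -(pmulr_lge0 _ yp) => h.
rewrite -subr_ge0; apply: le_trans h _; rewrite le_eqVlt; apply/orP; left.
by apply/eqP; field.
Qed.

Lemma ip_le x y : ip x y <= nrm x * nrm y.
Proof. exact: le_trans (ler_norm _) (ip_CS x y). Qed.

Lemma inormD x y : nrm (x + y) <= nrm x + nrm y.
Proof.
apply: inorm_le; first by rewrite addr_ge0 ?inorm_ge0.
rewrite !ipE (ipC H y x) sqrrD !inorm_sqr; have := ip_le x y; lra.
Qed.

Lemma inormDB x y z : nrm (x - z) <= nrm (x - y) + nrm (y - z).
Proof. by rewrite -[x - z](subrKA y); exact: inormD. Qed.

Lemma inorm_eq x y : (forall e, 0 < e -> nrm (x - y) <= e) -> x = y.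
Proof.
move=> h; apply/eqP; rewrite -subr_eq0; apply/eqP/inorm_eq0/eqP.
rewrite eq_le inorm_ge0 andbT; apply/ler_addgt0Pr => e e0; rewrite add0r; exact: h.
Qed.

End InnerProduct.

Definition icvg (R : realType) (V : lmodType R[i]) (ip : V -> V -> R)
    (u : nat -> V) (x : V) :=
  forall e, 0 < e -> \forall n \near \oo, inorm ip (u n - x) < e.

Definition icomplete (R : realType) (V : lmodType R[i]) (ip : V -> V -> R) :=
  forall u : nat -> V,
    (forall e, 0 < e -> exists N : nat, forall n k, (N <= n)%N ->
        inorm ip (u (n + k)%N - u n) <= e) ->
  exists x, icvg ip u x.

Section Convergence.
Context (R : realType) (V : lmodType R[i]) (ip : V -> V -> R).
Hypothesis H : inner_product ip.
Local Notation nrm := (inorm ip).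
Implicit Types (u v : nat -> V) (x y : V).

Lemma icvg_le u x y b : icvg ip u x ->
  (forall e, 0 < e -> \forall n \near \oo, nrm (u n - y) <= b + e) ->
  nrm (x - y) <= b.
Proof.
move=> ux uy; apply/ler_addgt0Pr => e e0; have e2 : 0 < e / 2 by rewrite divr_gt0.
near \oo => n.
apply: le_trans (inormDB H _ (u n) _) _; rewrite inormB//.
have h1 : nrm (u n - x) < e / 2 by near: n; exact: ux.
have h2 : nrm (u n - y) <= b + e / 2 by near: n; exact: uy.
by lra.
Unshelve. all: by end_near. Qed.

Lemma icvg_uniq u x y : icvg ip u x -> icvg ip u y -> x = y.
Proof.
move=> ux uy; apply: (inorm_eq H) => d d0; apply: le_trans (ltW d0).
apply: icvg_le ux _ => e e0; rewrite add0r.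
by near=> n; apply: ltW; near: n; exact: uy.
Unshelve. all: by end_near. Qed.

Lemma icvg_nrm u x : icvg ip u x -> nrm (u n) @[n --> \oo] --> nrm x.
Proof.
move=> ux; apply/cvgrPdist_le => e e0; near=> n; apply: ltW.
have un : nrm (u n - x) < e by near: n; exact: ux.
apply: le_lt_trans un; rewrite ler_norml; apply/andP; split.
  have := inormD H (u n - x) x; rewrite subrK; lra.
have := inormD H (x - u n) (u n); rewrite subrK inormB//; lra.
Unshelve. all: by end_near. Qed.

Lemma inormZC (a : R[i]) x : nrm (a *: x) = Normc.normc a * nrm x.
Proof.
by rewrite /inorm (ip_normZ H) sqrtrM ?sqr_ge0// sqrtr_sqr ger0_norm// normc_ge0.
Qed.

Lemma icvg_lin (a : R[i]) u v x y : icvg ip u x -> icvg ip v y ->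
  icvg ip (fun n => a *: u n + v n) (a *: x + y).
Proof.
move=> ux vy e e0; have e2 : 0 < e / 2 by rewrite divr_gt0.
have a1 : 0 < Normc.normc a + 1 by rewrite ltr_wpDl ?normc_ge0.
have ea : 0 < e / 2 / (Normc.normc a + 1) by rewrite divr_gt0.
near=> n.
have h1 : nrm (u n - x) < e / 2 / (Normc.normc a + 1) by near: n; exact: ux.
have h2 : nrm (v n - y) < e / 2 by near: n; exact: vy.
rewrite opprD addrACA -scalerBr; apply: le_lt_trans (inormD H _ _) _.
rewrite inormZC [e]splitr; apply: ler_ltD => //.
move: h1; rewrite ltr_pdivlMr// mulrC => /ltW; apply: le_trans.
by rewrite ler_wpM2r ?inorm_ge0// lerDl.
Unshelve. all: by end_near. Qed.

End Convergence.

Section Resolvent.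
Context (R : realType) (V : lmodType R[i]) (ip : V -> V -> R).
Hypothesis H : inner_product ip.
Hypothesis complete : icomplete ip.
Local Notation nrm := (inorm ip).
Variables (K : {linear V -> V}) (C : R).
Hypothesis C0 : 0 < C.
Hypothesis K_dis : forall y, ip y (K y) <= 0.
Hypothesis K_bound : forall y, nrm (K y) <= C * nrm y.
Implicit Types (x y z : V) (h : R).

(** Banach's theorem; only the metric given by the inner product is complete by
    hypothesis, so the iterates are followed by hand. *)
Let contraction_fixpoint (f : V -> V) (rho : R) : 0 <= rho -> rho < 1 ->
  (forall x y, nrm (f x - f y) <= rho * nrm (x - y)) ->
  exists z, f z = z.
Proof.
move=> r0 r1 fr.
pose u n := iter n f 0; pose B := nrm (f 0) / (1 - rho).
have B0 : 0 <= B by rewrite divr_ge0 ?inorm_ge0 ?subr_ge0 ?ltW.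
have uB n : nrm (u n - 0) <= B.
  elim: n => [|n IH]; first by rewrite subrr inorm0.
  rewrite (le_trans (inormDB H _ (f 0) _))// subr0 /u iterS.
  rewrite (le_trans (lerD (fr _ _) (lexx _)))// -/(u n).
  have -> : B = rho * B + nrm (f 0).
    by rewrite /B; field; lra.
  by rewrite lerD2r ler_wpM2l.
have uc n k : nrm (u (n + k)%N - u n) <= rho ^+ n * B.
  elim: n => [|n IH]; first by rewrite mul1r add0n; exact: uB.
  rewrite addSn /u !iterS (le_trans (fr _ _))// exprS -mulrA ler_wpM2l//.
have rn : rho ^+ n * B @[n --> \oo] --> (0 : R).
  rewrite -(mul0r B); apply: cvgMl; apply: cvg_expr.
  by rewrite ger0_norm.
have /= := complete (u := u).
case.
  move=> e e0; move/cvgrPdist_lt : rn => /(_ _ e0)[N _ hN].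
  exists N => n k Nn; apply: le_trans (uc n k) _.
  have /= := hN _ Nn; rewrite sub0r normrN ger0_norm; first exact: ltW.
  by rewrite mulr_ge0 ?exprn_ge0.
move=> z uz; exists z; apply: (inorm_eq H) => e e0.
have e2 : 0 < e / 2 by rewrite divr_gt0.
have [N _ hN] := uz _ e2.
have h1 := hN N (leqnn _); have h2 := hN _ (leqnSn N).
apply: le_trans (inormDB H _ (u N.+1) _) _; rewrite [e]splitr lerD//; last exact: ltW.
rewrite inormB// /u iterS (le_trans (fr _ _))//.
rewrite (le_trans _ (ltW h1))// ler_piMl ?inorm_ge0// ltW//.
Qed.

(** [K - h] is strictly dissipative, so [z |-> z + th (K z - h z - y)] contracts for
    small [th]: the cross term decreases [|d|^2] by [2 th h |d|^2], against an
    increase of at most [th^2 (C + h)^2 |d|^2]. *)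
Lemma resolvent_ex h y : 0 < h -> exists z, K z - h%:C *: z = y.
Proof.
move=> h0; pose L := C + h; pose th := h / L ^+ 2.
have L0 : 0 < L by rewrite /L addr_gt0.
have th0 : 0 < th by rewrite divr_gt0// exprn_gt0.
pose r2 := 1 - h ^+ 2 / L ^+ 2.
have hL : h ^+ 2 / L ^+ 2 <= 1.
  rewrite ler_pdivrMr ?exprn_gt0// mul1r ler_pXn2r ?nnegrE ?(ltW h0) ?(ltW L0)//.
  by rewrite /L lerDr ltW.
have r2_ge0 : 0 <= r2 by rewrite /r2 subr_ge0.
have r2_lt1 : r2 < 1 by rewrite /r2 ltrBlDr ltrDl divr_gt0// exprn_gt0.
(* [th = h / L ^ 2] minimizes the squared contraction factor
   [1 - 2 th h + th ^ 2 L ^ 2], whose minimum is [r2]. *)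
pose f z := z + th%:C *: (K z - h%:C *: z - y).
have [|||z fz] := @contraction_fixpoint f (Num.sqrt r2).
- exact: sqrtr_ge0.
- by rewrite -sqrtr1 ltr_sqrt.
- move=> x x'; pose d := x - x'.
  have -> : f x - f x' = d + th%:C *: (K d - h%:C *: d).
    by apply: (ip_inj H) => w; rewrite /f /d (linearB K) !(ipE H); ring.
  rewrite -/d; clearbody d.
  apply: (inorm_le H); first by rewrite mulr_ge0 ?sqrtr_ge0 ?inorm_ge0.
  rewrite exprMn sqr_sqrtr// !inorm_sqr//.
  have h1 : ip (K d - h%:C *: d) (K d - h%:C *: d) <= L ^+ 2 * ip d d.
    rewrite -!inorm_sqr// -exprMn ler_pXn2r ?nnegrE ?inorm_ge0 ?mulr_ge0 ?inorm_ge0 ?(ltW L0)//.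
    rewrite (le_trans (inormD H _ _))// inormN// inormZ// gtr0_norm// /L mulrDl.
    by rewrite lerD2r.
  set e := K d - h%:C *: d in h1 *.
  have h2 : ip d e <= - h * ip d d.
    by rewrite /e !(ipE H); have := K_dis d; lra.
  clearbody e; rewrite !(ipE H) (ipC H e d).
  have h3 : th * (th * ip e e) <= th * (th * (L ^+ 2 * ip d d)).
    by rewrite !ler_pM2l.
  have h4 : th * ip d e <= th * (- h * ip d d) by rewrite ler_pM2l.
  have e1 : th * (th * (L ^+ 2 * ip d d)) = h ^+ 2 / L ^+ 2 * ip d d.
    by rewrite /th; field; rewrite gt_eqF.
  have e2 : th * (- h * ip d d) = - (h ^+ 2 / L ^+ 2 * ip d d).
    by rewrite /th; field; rewrite gt_eqF.
  by rewrite /r2; lra.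
exists z; apply/eqP; rewrite -subr_eq0; apply/eqP.
have : th%:C *: (K z - h%:C *: z - y) = 0.
  by apply: (addrI z); rewrite addr0.
move/(congr1 (fun v => (th^-1)%:C *: v)).
rewrite scalerA -rmorphM/= mulVf ?gt_eqF// rmorph1 scale1r scaler0//.
Qed.

(** [zres h y] is [(K - h)^-1 y]. *)
Definition zres h y : V := xget 0 [set z | K z - h%:C *: z = y].

(** The resolvent [(1 - h A)^-1] of [A := K^-1], that is, one implicit Euler step for
    [u' = A u]. *)
Definition estep h y : V := K (zres h y).

Lemma zresP h y : 0 < h -> K (zres h y) - h%:C *: zres h y = y.
Proof.
move=> h0; have [z hz] := resolvent_ex y h0.
exact: (@xgetPex _ 0 [set z | K z - h%:C *: z = y] (ex_intro _ z hz)).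
Qed.

Lemma zres_uniq h y z : 0 < h -> K z - h%:C *: z = y -> zres h y = z.
Proof.
move=> h0 hz; apply/eqP; rewrite -subr_eq0; apply/eqP/(ip_eq0 H)/eqP.
set d := zres h y - z.
have : K d - h%:C *: d = 0.
  rewrite (_ : K d - _ = (K (zres h y) - h%:C *: zres h y) - (K z - h%:C *: z)).
    by rewrite zresP// hz subrr.
  by apply: (ip_inj H) => w; rewrite /d (linearB K) !(ipE H); ring.
clearbody d; move/(congr1 (ip d)); rewrite -(scale0r 0) -(rmorph0 (real_complex R)) !(ipE H) mul0r.
move=> e; have := K_dis d; have := ip_ge0 H d.
rewrite eq_le => d0 Kd; rewrite d0 andbT -(pmulr_rle0 _ h0); lra.
Qed.

Lemma estep_def h y : 0 < h -> estep h y = y + h%:C *: zres h y.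
Proof. by move=> h0; rewrite /estep -{2}(zresP y h0) subrK. Qed.

Lemma K_estep_sub h y : 0 < h -> K (estep h y - y) = h%:C *: estep h y.
Proof.
move=> h0; rewrite (_ : estep h y - y = h%:C *: zres h y); first by rewrite linearZ.
by rewrite estep_def// addrC addKr.
Qed.

Lemma zres_linear h (a : R[i]) x y : 0 < h ->
  zres h (a *: x + y) = a *: zres h x + zres h y.
Proof.
move=> h0; apply: zres_uniq => //; rewrite (linearP K).
transitivity (a *: (K (zres h x) - h%:C *: zres h x) +
              (K (zres h y) - h%:C *: zres h y)); last by rewrite !zresP.
by rewrite scalerDr scalerBr !scalerA (mulrC a) opprD addrACA.
Qed.

Lemma estep_linear h (a : R[i]) x y : 0 < h -> estep h (a *: x + y) = a *: estep h x + estep h y.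
Proof. by move=> h0; rewrite /estep zres_linear// linearP. Qed.

Lemma estepB h x y : 0 < h -> estep h (x - y) = estep h x - estep h y.
Proof. by move=> h0; rewrite addrC -scaleN1r estep_linear// scaleN1r addrC. Qed.

Lemma estep_K h y : 0 < h -> estep h (K y) = K (estep h y).
Proof.
move=> h0; rewrite /estep; congr (K _); apply: zres_uniq => //.
by rewrite -linearZ/= -(linearB K) zresP.
Qed.

Lemma estep_stepK h y : 0 < h -> estep h (K y) = K y + h%:C *: estep h y.
Proof.
move=> h0; rewrite estep_def//; congr (_ + _ *: _); rewrite /estep; apply: zres_uniq => //.
by rewrite -linearZ/= -(linearB K) zresP.
Qed.

(** [u' = A u] dissipates energy, and the implicit scheme inherits this for every
    step size. *)
Lemma estep_contr h y : 0 < h -> nrm (estep h y) <= nrm y.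
Proof.
move=> h0; have [->|/eqP x0] := eqVneq (nrm (estep h y)) 0; first exact: inorm_ge0.
have xp : 0 < nrm (estep h y) by rewrite lt_neqAle inorm_ge0 andbT eq_sym; apply/eqP.
rewrite -(ler_pM2r xp) -expr2 inorm_sqr//; apply: le_trans (ip_le H _ _).
rewrite -{3}(zresP y h0) -/(estep h y) !(ipE H) lerBrDr.
by rewrite gerDl pmulr_rle0// /estep K_dis.
Qed.

Definition estepn h n := iter n (estep h).

Lemma estepn_linear h n (a : R[i]) x y : 0 < h ->
  estepn h n (a *: x + y) = a *: estepn h n x + estepn h n y.
Proof. by move=> h0; elim: n => [//|n IH]; rewrite /estepn !iterS -!/(estepn h n _) IH estep_linear. Qed.

Lemma estepnB h n x y : 0 < h -> estepn h n (x - y) = estepn h n x - estepn h n y.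
Proof. by move=> h0; rewrite addrC -scaleN1r estepn_linear// scaleN1r addrC. Qed.

Lemma estepn_K h n y : 0 < h -> estepn h n (K y) = K (estepn h n y).
Proof. by move=> h0; elim: n => [//|n IH]; rewrite /estepn !iterS -!/(estepn h n _) IH estep_K. Qed.

Lemma estepn_contr h n y : 0 < h -> nrm (estepn h n y) <= nrm y.
Proof.
move=> h0; elim: n => [//|n IH]; rewrite /estepn iterS -/(estepn h n y).
exact: le_trans (estep_contr _ h0) IH.
Qed.

(** On the domain of [A ^ 2], one step of size [2 h] and two of size [h] both agree
    with the solution up to order [h ^ 2]; this local consistency makes the dyadic
    schemes converge. *)
Lemma estep_halve h y : 0 < h ->
  nrm (estep (2 * h) (K (K y)) - estep h (estep h (K (K y)))) <= 7 * h ^+ 2 * nrm y.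
Proof.
move=> h0; have h20 : 0 < 2 * h by rewrite mulr_gt0.
have -> : estep (2 * h) (K (K y)) - estep h (estep h (K (K y))) =
   (h ^+ 2)%:C *: (4%:C *: estep (2 * h) y - 2%:C *: estep h y - estep h (estep h y)).
  have jD (a : R[i]) u v : estep h (u + a *: v) = estep h u + a *: estep h v.
    by rewrite addrC estep_linear// addrC.
  have jK : estep h (K (K y)) = K (K y) + h%:C *: (K y + h%:C *: estep h y).
    by rewrite !estep_stepK.
  rewrite jK !jD jK !estep_stepK//.
  by apply: (ip_inj H) => w; rewrite !(ipE H); ring.
rewrite inormZ// (ger0_norm (sqr_ge0 h)).
have -> : 7 * h ^+ 2 * nrm y = h ^+ 2 * (7 * nrm y) by ring.
rewrite ler_pM2l ?exprn_gt0//.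
rewrite (le_trans (inormD H _ _))// (le_trans (lerD (inormD H _ _) (lexx _)))//.
rewrite !inormN// !inormZ// !ger0_norm//.
have a1 := estep_contr y h20; have a2 := estep_contr y h0; have a3 := estep_contr (estep h y) h0.
lra.
Qed.

(** Stability: contractivity transports the local errors without amplification. *)
Lemma estepn_halve h n y : 0 < h ->
  nrm (estepn (2 * h) n (K (K y)) - estepn h n.*2 (K (K y))) <= n%:R * (7 * h ^+ 2 * nrm y).
Proof.
move=> h0; have h20 : 0 < 2 * h by rewrite mulr_gt0.
elim: n => [|n IH]; first by rewrite subrr inorm0// mul0r.
rewrite doubleS /estepn !iterS -!/(estepn _ _ _).
apply: le_trans (inormDB H _ (estep (2 * h) (estepn h n.*2 (K (K y)))) _) _.
rewrite -estepB// -(natr1 n) (mulrDl n%:R) mul1r; apply: lerD.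
  exact: le_trans (estep_contr _ h20) IH.
rewrite !estepn_K//; apply: le_trans (estep_halve _ h0) _.
apply: ler_wpM2l; first by rewrite mulr_ge0 ?sqr_ge0.
exact: estepn_contr.
Qed.

Lemma estepn_dist h n y : 0 < h -> nrm (estepn h n (K y) - K y) <= n%:R * h * nrm y.
Proof.
move=> h0; elim: n => [|n IH]; first by rewrite subrr inorm0// !mul0r.
rewrite /estepn iterS -/(estepn h n _).
apply: le_trans (inormDB H _ (estep h (K y)) _) _.
rewrite -estepB// -(natr1 n) (mulrDl n%:R) mul1r mulrDl; apply: lerD.
  exact: le_trans (estep_contr _ h0) IH.
by rewrite estep_stepK// addrC addKr inormZ// gtr0_norm// ler_pM2l// estep_contr.
Qed.

(** The increments of the scheme started at [K y] are exactly [h] times the scheme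
    started at [y], since [A K y = y]. *)
Lemma estepn_deriv h n y b : 0 < h ->
  (forall j, (j <= n)%N -> nrm (estepn h j y - y) <= b) ->
  nrm (estepn h n (K y) - K y - (n%:R * h)%:C *: y) <= n%:R * h * b.
Proof.
move=> h0; elim: n => [|n IH] hb.
  by rewrite mul0r rmorph0 scale0r subrr subr0 inorm0// mul0r.
have -> : estepn h n.+1 (K y) - K y - (n.+1%:R * h)%:C *: y =
    (estepn h n (K y) - K y - (n%:R * h)%:C *: y) + h%:C *: (estepn h n.+1 y - y).
  rewrite /estepn !iterS -!/(estepn h n _) estepn_K// estep_stepK// -(natr1 n).
  by apply: (ip_inj H) => w; rewrite !(ipE H); ring.
apply: le_trans (inormD H _ _) _; rewrite inormZ// gtr0_norm// -(natr1 n) !mulrDl mul1r.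
by rewrite lerD// ?ler_pM2l ?hb// IH// => j jn; rewrite hb// ltnW.
Qed.

Lemma estep_near x e : 0 < e ->
  (forall x e, 0 < e -> exists y, nrm (x - K y) <= e) ->
  exists2 h0, 0 < h0 & forall h, 0 < h -> h < h0 -> nrm (estep h x - x) <= e.
Proof.
move=> e0 dense; have e40 : 0 < e / 4 by rewrite divr_gt0.
have [y hy] := dense x _ e40.
have y1 : 0 < nrm y + 1 by rewrite ltr_wpDl ?inorm_ge0.
exists (e / 2 / (nrm y + 1)); first by rewrite !divr_gt0.
move=> h h0 hh.
have -> : estep h x - x = estep h (x - K y) + (estep h (K y) - K y) + (K y - x).
  by rewrite estepB// subrKA subrKA.
apply: le_trans (inormD H _ _) _; rewrite (inormB H (K y)).
apply: le_trans (lerD (inormD H _ _) (lexx _)) _.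
have := estep_contr (x - K y) h0; have := @estepn_dist h 1 y h0; rewrite mul1r /estepn/=.
have : h * nrm y <= e / 2.
  rewrite -ler_pdivlMl// mulrC.
  move: hh; rewrite ltr_pdivlMr// => hh; rewrite ler_pdivlMr//.
  by rewrite mulrC; apply: le_trans (ltW hh); rewrite ler_wpM2l ?ltW// ltrDl.
move: hy; lra.
Qed.

Hypothesis K_inj : forall y, K y = 0 -> y = 0.

(** With [P] and [Q] the steps of sizes [h < g], [K (P - Q) = h P - g Q]; hence
    dissipativity gives [<P - Q, h P - g Q> <= 0], which makes [|P|^2] grow as the step
    size decreases, by at least [|P - Q|^2]. *)
Lemma estep_mono h g y : 0 < h -> h < g ->
  nrm (estep h y - estep g y) ^+ 2 <= nrm (estep h y) ^+ 2 - nrm (estep g y) ^+ 2.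
Proof.
move=> h0 hg; have g0 := lt_trans h0 hg.
have KX k : 0 < k -> K (estep k y - y) = k%:C *: estep k y by exact: K_estep_sub.
set P := estep h y; set Q := estep g y.
have : ip (P - Q) (h%:C *: P - g%:C *: Q) <= 0.
  have -> : h%:C *: P - g%:C *: Q = K (P - Q).
    by rewrite -!KX// -(linearB K); congr (K _); rewrite opprB addrA subrK.
  exact: K_dis.
rewrite !inorm_sqr// !(ipE H) (ipC H Q P) => h1.
have h2 := ip_ge0 H (P - Q); rewrite !(ipE H) (ipC H Q P) in h2.
move: h1 h2; set a := ip P P; set b := ip P Q; set c := ip Q Q => h1 h2.
have h3 : (g - h) * (b - c) >= h * (a - b - b + c) by lra.
have h4 : 0 <= b - c.
  rewrite -(pmulr_rge0 _ (_ : 0 < g - h)) ?subr_gt0//; apply: le_trans h3.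
  by rewrite mulr_ge0 ?(ltW h0)//; lra.
lra.
Qed.

(** The domain of [A] is dense. By [estep_mono] the steps [P n] of sizes tending to
    zero form a Cauchy sequence; [K (P n - x)] tends to zero, so injectivity of [K]
    identifies their limit as [x]. *)
Lemma range_dense x e : 0 < e -> exists y, nrm (x - K y) <= e.
Proof.
move=> e0; pose h n := n.+1%:R^-1 : R; pose P n := estep (h n) x.
have h0 n : 0 < h n by rewrite invr_gt0.
have PJ n k : (n <= k)%N ->
   nrm (P k - P n) ^+ 2 <= nrm (P k) ^+ 2 - nrm (P n) ^+ 2.
  rewrite leq_eqVlt => /orP[/eqP->|dindex]; first by rewrite !subrr inorm0// expr0n.
  by apply: estep_mono => //; rewrite ltf_pV2 ?posrE// ltr_nat.
pose a n := nrm (P n) ^+ 2.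
have a_nd : nondecreasing_seq a.
  by move=> n k dindex; rewrite -subr_ge0; apply: le_trans (PJ _ _ dindex); exact: sqr_ge0.
have a_cvg : cvgn a.
  apply: nondecreasing_is_cvgn => //; exists (nrm x ^+ 2) => _ [n _ <-].
  by rewrite /a ler_pXn2r ?nnegrE ?inorm_ge0//; exact: estep_contr.
have [|y Py] := complete (u := P).
  move=> d d0; have d20 : 0 < d ^+ 2 by rewrite exprn_gt0.
  have /cvgrPdist_lt /(_ _ d20)[N _ hN] := a_cvg.
  exists N => n k Nn; rewrite -(ler_pXn2r (n := 2)) ?nnegrE ?inorm_ge0 ?(ltW d0)//.
  apply: le_trans (PJ _ _ (leq_addr _ _)) _.
  have /= /ltW hn := hN n Nn; apply: le_trans _ hn.
  apply: le_trans (ler_norm _); rewrite lerB//.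
  exact: (nondecreasing_cvgn_le a_nd a_cvg (n + k)%N).
have KX n : K (P n - x) = (h n)%:C *: P n by exact: K_estep_sub.
have yx : y = x.
  apply/eqP; rewrite -subr_eq0; apply/eqP/K_inj/(inorm_eq H) => d d0; rewrite subr0.
  have d2 : 0 < d / 2 by rewrite divr_gt0.
  have dC : 0 < d / 2 / C by rewrite divr_gt0.
  have x1 : 0 < nrm x + 1 by rewrite ltr_wpDl ?inorm_ge0.
  have hx : 0 < d / 2 / (nrm x + 1) by rewrite divr_gt0.
  have hcv : \forall n \near \oo, h n < d / 2 / (nrm x + 1).
    by near=> n; rewrite /h; near: n; exact: near_infty_natSinv_lt (PosNum hx).
  near \oo => n.
  have -> : y - x = (P n - x) - (P n - y).
    by rewrite opprB [RHS]addrC subrKA.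
  rewrite linearB KX.
  apply: le_trans (inormD H _ _) _; rewrite inormN// [d]splitr inormZ// gtr0_norm//.
  apply: lerD.
    have hn : h n < d / 2 / (nrm x + 1) by near: n.
    rewrite (le_trans (ler_wpM2l (ltW (h0 n)) (estep_contr _ (h0 n))))//.
    move: hn; rewrite ltr_pdivlMr// => hn; apply: le_trans (ltW hn).
    by rewrite ler_wpM2l ?(ltW (h0 n))// lerDl.
  apply: le_trans (K_bound _) _; rewrite -ler_pdivlMl// mulrC; apply: ltW.
  by near: n; exact: Py.
have [N _ hN] := Py _ e0.
exists (zres (h N) x); rewrite -/(estep (h N) x) -/(P N) -yx inormB//.
exact/ltW/(hN N (leqnn N)).
Unshelve. all: by end_near. Qed.

Lemma range2_dense x e : 0 < e -> exists y, nrm (x - K (K y)) <= e.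
Proof.
move=> e0; have e2 : 0 < e / 2 by rewrite divr_gt0.
have [y1 h1] := range_dense x e2.
have eC : 0 < e / 2 / C by rewrite divr_gt0.
have [y h2] := range_dense y1 eC; exists y.
apply: le_trans (inormDB H _ (K y1) _) _; rewrite [e]splitr lerD//.
rewrite -(linearB K); apply: le_trans (K_bound _) _.
by rewrite -ler_pdivlMl// mulrC.
Qed.

(** Dyadic step sizes, for which [estepn_halve] compares consecutive schemes; the
    number of steps up to time [t] is rounded down, which costs at most one step. *)
Definition dstep (k : nat) : R := 2 ^- k.
Definition dindex (k : nat) (t : R) : nat := Num.truncn (t * 2 ^+ k).
Definition euler (k : nat) (t : R) (x : V) : V := estepn (dstep k) (dindex k t) x.

Lemma dstep_gt0 k : 0 < dstep k. Proof. by rewrite /dstep invr_gt0 exprn_gt0. Qed.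

Lemma dstepS k : dstep k = 2 * dstep k.+1.
Proof. by rewrite /dstep exprS invfM mulVKf. Qed.

Lemma dstep_cvg : dstep k @[k --> \oo] --> (0 : R).
Proof.
rewrite (_ : dstep = GRing.exp 2^-1); first by apply: cvg_expr; rewrite ger0_norm// invf_lt1// ltr1n.
by apply/funext => k; rewrite /dstep -exprVn.
Qed.

Lemma near_dstep c e : 0 < e -> \forall k \near \oo, dstep k * c <= e.
Proof.
move=> e0; have : dstep k * c @[k --> \oo] --> (0 : R) by rewrite -(mul0r c); apply: cvgMl; exact: dstep_cvg.
move/cvgrPdist_le => /(_ _ e0); apply: filterS => k; rewrite sub0r normrN.
by apply: le_trans; rewrite ler_norm.
Qed.

Lemma dindex_itv k t : 0 <= t -> (dindex k t)%:R * dstep k <= t < (dindex k t)%:R * dstep k + dstep k.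
Proof.
move=> t0; have k0 : 0 < (2 : R) ^+ k by rewrite exprn_gt0.
have /truncn_itv : 0 <= t * 2 ^+ k by rewrite mulr_ge0 ?(ltW k0).
rewrite -/(dindex k t) -ler_pdivrMr// => /andP[-> h] /=.
move: h; rewrite -(natr1 (dindex k t)) -ltr_pdivlMr// mulrDl mul1r => h.
exact: h.
Qed.

Lemma dindexS k t : 0 <= t -> dindex k.+1 t = (dindex k t).*2 \/ dindex k.+1 t = (dindex k t).*2.+1.
Proof.
move=> t0; have /andP[a b] := dindex_itv k t0; have /andP[c d] := dindex_itv k.+1 t0.
rewrite dstepS in a b; have h0 := dstep_gt0 k.+1; move: a b c d.
move: (dstep k.+1) h0 (dindex k t) (dindex k.+1 t) => h h0 n p a b c d.
have h1 : (p < n.*2.+2)%N.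
  rewrite -(ltr_nat R) -(ltr_pM2r h0) -!(natr1 _) -mul2n natrM.
  by apply: le_lt_trans c _; apply: lt_le_trans b _; lra.
have h2 : (n.*2 < p.+1)%N.
  rewrite -(ltr_nat R) -(ltr_pM2r h0) -!(natr1 p) -mul2n natrM.
  by apply: le_lt_trans (_ : _ <= t) _; lra.
have [e|e] := eqVneq p n.*2; [by left | right].
apply/eqP; rewrite eqn_leq -ltnS h1 /= ltn_neqAle eq_sym e /=.
by rewrite -ltnS.
Qed.

Lemma dindexD k s t : 0 <= s -> 0 <= t ->
  dindex k (s + t) = (dindex k s + dindex k t)%N \/ dindex k (s + t) = (dindex k s + dindex k t).+1.
Proof.
move=> s0 t0; have /andP[a b] := dindex_itv k s0; have /andP[c d] := dindex_itv k t0.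
have /andP[e f] := dindex_itv k (addr_ge0 s0 t0).
have h0 := dstep_gt0 k; move: a b c d e f.
move: (dstep k) h0 (dindex k s) (dindex k t) (dindex k (s + t)) => h h0 n p q a b c d e f.
have h1 : (q < (n + p).+2)%N.
  by rewrite -(ltr_nat R) -(ltr_pM2r h0) -!(natr1 _) natrD; lra.
have h2 : (n + p < q.+1)%N.
  by rewrite -(ltr_nat R) -(ltr_pM2r h0) -!(natr1 q) natrD; lra.
have [g|g] := eqVneq q (n + p)%N; [by left | right].
by apply/eqP; rewrite eqn_leq -ltnS h1 /= ltn_neqAle eq_sym g /= -ltnS.
Qed.

Lemma euler_step k t y : 0 <= t ->
  nrm (euler k.+1 t (K (K y)) - euler k t (K (K y))) <= dstep k.+1 * ((4 * t + C) * nrm y).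
Proof.
move=> t0; have h0 := dstep_gt0 k.+1; have /andP[nt _] := dindex_itv k t0.
rewrite /euler; move: nt; rewrite dstepS; set h := dstep k.+1; set n := dindex k t => nt.
have e1 := estepn_halve n y h0; rewrite -/h in e1.
have e2 : nrm (estepn h (dindex k.+1 t) (K (K y)) - estepn h n.*2 (K (K y))) <= h * C * nrm y.
  have [->|->] := dindexS k t0; rewrite -/n.
    by rewrite subrr inorm0// !mulr_ge0 ?inorm_ge0 ?(ltW h0) ?(ltW C0).
  rewrite /estepn iterS -!/(estepn h _ _) estepn_K//.
  apply: le_trans (@estepn_dist h 1 _ h0) _; rewrite mul1r -mulrA ler_pM2l// estepn_K//.
  by apply: le_trans (K_bound _) _; rewrite ler_pM2l// estepn_contr.
apply: le_trans (inormDB H _ (estepn h n.*2 (K (K y))) _) _.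
rewrite (inormB H (estepn h n.*2 _)) addrC.
have -> : h * ((4 * t + C) * nrm y) = h * (4 * t * nrm y) + h * C * nrm y by ring.
apply: lerD => //; apply: le_trans e1 _.
have -> : n%:R * (7 * h ^+ 2 * nrm y) = 7 / 2 * (n%:R * (2 * h)) * (h * nrm y) by field.
have -> : h * (4 * t * nrm y) = 4 * t * (h * nrm y) by ring.
by rewrite ler_wpM2r ?mulr_ge0 ?inorm_ge0 ?(ltW h0)//; lra.
Qed.

Lemma euler_cauchy k m t y : 0 <= t ->
  nrm (euler (k + m) t (K (K y)) - euler k t (K (K y))) <= dstep k * ((4 * t + C) * nrm y).
Proof.
move=> t0; set D := _ * nrm y.
have D0 : 0 <= D by rewrite mulr_ge0 ?inorm_ge0// addr_ge0 ?(ltW C0)// mulr_ge0.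
suff : nrm (euler (k + m) t (K (K y)) - euler k t (K (K y))) <= (dstep k - dstep (k + m)) * D.
  move=> h; apply: le_trans h _; rewrite ler_wpM2r// lerBlDr lerDl ltW//.
  exact: dstep_gt0.
elim: m => [|m IH]; first by rewrite addn0 !subrr inorm0// mul0r.
apply: le_trans (inormDB H _ (euler (k + m)%N t (K (K y))) _) _.
have := euler_step (k + m) y t0; rewrite -/D -addnS => h1.
have h2 : dstep (k + m)%N = 2 * dstep (k + m.+1)%N by rewrite addnS dstepS.
rewrite h2 in IH; apply: le_trans (lerD h1 IH) _; lra.
Qed.

Lemma euler_contr k t x : nrm (euler k t x) <= nrm x.
Proof. exact: estepn_contr (dstep_gt0 k). Qed.

Lemma eulerB k t x y : euler k t (x - y) = euler k t x - euler k t y.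
Proof. exact: estepnB (dstep_gt0 k). Qed.

Lemma euler_cvg t x : 0 <= t -> exists y, icvg ip (fun k => euler k t x) y.
Proof.
move=> t0; apply: complete => e e0.
have e3 : 0 < e / 3 by rewrite divr_gt0.
have [y hy] := range2_dense x e3.
have [N _ hN] := near_dstep ((4 * t + C) * nrm y) e3.
exists N => n k Nn.
have -> : euler (n + k) t x - euler n t x = (euler (n + k) t (x - K (K y)) - euler n t (x - K (K y))) +
    (euler (n + k) t (K (K y)) - euler n t (K (K y))).
  by rewrite !eulerB; apply: (ip_inj H) => w; rewrite !(ipE H); ring.
apply: le_trans (inormD H _ _) _.
have h1 := inormD H (euler (n + k) t (x - K (K y))) (- euler n t (x - K (K y))).
rewrite inormN// in h1.
have h2 := euler_contr (n + k) t (x - K (K y)); have h3 := euler_contr n t (x - K (K y)).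
have h4 := euler_cauchy n k y t0; have h5 := hN n Nn; rewrite /= in h5.
by lra.
Qed.

(** The semigroup [exp (t K^-1)]. *)
Definition expinv t x : V := xget 0 [set y | icvg ip (fun k => euler k t x) y].

Lemma expinv_cvg t x : 0 <= t -> icvg ip (fun k => euler k t x) (expinv t x).
Proof. by move=> t0; have [y hy] := euler_cvg x t0; exact: (@xgetPex _ 0 [set y | icvg ip (fun k => euler k t x) y] (ex_intro _ y hy)). Qed.

Lemma expinv_linear t (a : R[i]) x y : 0 <= t ->
  expinv t (a *: x + y) = a *: expinv t x + expinv t y.
Proof.
move=> t0; apply: (icvg_uniq H (expinv_cvg _ t0)).
rewrite (_ : (fun k => euler k t (a *: x + y)) = (fun k => a *: euler k t x + euler k t y)).
  by apply: icvg_lin => //; exact: expinv_cvg.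
by apply/funext => k; rewrite /euler estepn_linear//; exact: dstep_gt0.
Qed.

Lemma expinvB t x y : 0 <= t -> expinv t (x - y) = expinv t x - expinv t y.
Proof. by move=> t0; rewrite addrC -scaleN1r expinv_linear// scaleN1r addrC. Qed.

Lemma expinv_contr t x : 0 <= t -> nrm (expinv t x) <= nrm x.
Proof.
move=> t0; rewrite -[expinv t x]subr0; apply: (icvg_le H (expinv_cvg x t0)) => e e0.
by apply: nearW => k; rewrite subr0 (le_trans (euler_contr _ _ _))// lerDl ltW.
Qed.

Lemma expinv_K t y : 0 <= t -> expinv t (K y) = K (expinv t y).
Proof.
move=> t0; apply: (icvg_uniq H (expinv_cvg _ t0)) => e e0.
have eC : 0 < e / C by rewrite divr_gt0.
near=> k; rewrite /euler estepn_K ?dstep_gt0// -/(euler k t y) -(linearB K).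
apply: le_lt_trans (K_bound _) _; rewrite -ltr_pdivlMl// mulrC.
by near: k; exact: expinv_cvg.
Unshelve. all: by end_near. Qed.

Lemma expinv0 x : expinv 0 x = x.
Proof.
apply: (icvg_uniq H (expinv_cvg _ (lexx 0))) => e e0; apply: nearW => k.
by rewrite /euler /dindex mul0r truncn0 /estepn/= subrr inorm0.
Qed.

(** Rounding breaks the semigroup law of the schemes by at most one step, which is
    close to the identity on a fixed vector. *)
Lemma expinvD s t x : 0 <= s -> 0 <= t -> expinv (s + t) x = expinv s (expinv t x).
Proof.
move=> s0 t0; apply: (icvg_uniq H (expinv_cvg _ (addr_ge0 s0 t0))) => e e0.
have e4 : 0 < e / 4 by rewrite divr_gt0.
have [h0 h00 hJ] := estep_near x e4 (range_dense).
near=> k.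
have hkk : dstep k < h0.
  near: k; have /cvgrPdist_lt/(_ _ h00) := dstep_cvg; apply: filterS => k.
  by rewrite sub0r normrN; apply: le_lt_trans; exact: ler_norm.
have h1 : nrm (euler k (s + t) x - euler k s (euler k t x)) <= e / 4.
  rewrite /euler /estepn -iterD -!/(estepn _ _ _); have [->|->] := dindexD k s0 t0.
    by rewrite subrr inorm0// ltW.
  rewrite /estepn iterSr -!/(estepn _ _ _) -estepnB ?dstep_gt0//.
  apply: le_trans (estepn_contr _ _ (dstep_gt0 k)) _; apply: hJ => //; exact: dstep_gt0.
have h2 : nrm (euler k t x - expinv t x) < e / 4 by near: k; exact: expinv_cvg.
have h3 : nrm (euler k s (expinv t x) - expinv s (expinv t x)) < e / 4 by near: k; exact: expinv_cvg.
apply: le_lt_trans (inormDB H _ (euler k s (euler k t x)) _) _.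
have := inormDB H (euler k s (euler k t x)) (euler k s (expinv t x)) (expinv s (expinv t x)).
rewrite -eulerB; have := euler_contr k s (euler k t x - expinv t x); lra.
Unshelve. all: by end_near. Qed.

Lemma expinv_dist t y : 0 <= t -> nrm (expinv t (K y) - K y) <= t * nrm y.
Proof.
move=> t0; apply: (icvg_le H (expinv_cvg (K y) t0)) => e e0; apply: nearW => k.
have /andP[nt _] := dindex_itv k t0.
apply: le_trans (estepn_dist _ _ (dstep_gt0 k)) _.
apply: (@le_trans _ _ (t * nrm y)); last by rewrite lerDl ltW.
by rewrite ler_wpM2r ?inorm_ge0.
Qed.

Lemma expinv_deriv t y z : 0 <= t ->
  nrm (expinv t (K y) - (K y + t%:C *: y)) <= t * (2 * nrm (y - K z) + t * nrm z).
Proof.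
move=> t0; apply: (icvg_le H (expinv_cvg (K y) t0)) => e e0; near=> k.
have /andP[n1 n2] := dindex_itv k t0; have h0 := dstep_gt0 k.
set n := dindex k t in n1 n2; set h := dstep k in n1 n2 h0.
set b := 2 * nrm (y - K z) + t * nrm z.
have b0 : 0 <= b by rewrite addr_ge0 ?mulr_ge0 ?inorm_ge0.
have hb j : (j <= n)%N -> nrm (estepn h j y - y) <= b.
  move=> jn.
  have -> : estepn h j y - y = estepn h j (y - K z) + (estepn h j (K z) - K z) + (K z - y).
    by rewrite estepnB// subrKA subrKA.
  apply: le_trans (inormD H _ _) _; rewrite (inormB H (K z)).
  apply: le_trans (lerD (inormD H _ _) (lexx _)) _.
  have := estepn_contr j (y - K z) h0; have := estepn_dist j z h0.
  have : j%:R * h * nrm z <= t * nrm z.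
    rewrite ler_wpM2r ?inorm_ge0//; apply: le_trans n1; rewrite ler_wpM2r ?(ltW h0)//.
    by rewrite ler_nat.
  rewrite /b; lra.
have h1 := estepn_deriv h0 hb.
have -> : euler k t (K y) - (K y + t%:C *: y) =
   (estepn h n (K y) - K y - (n%:R * h)%:C *: y) - (t - n%:R * h)%:C *: y.
  by rewrite -/(euler k t (K y)); apply: (ip_inj H) => w; rewrite !(ipE H); ring.
apply: le_trans (inormD H _ _) _; rewrite inormN// inormZ// ger0_norm ?subr_ge0//.
apply: lerD.
  by apply: le_trans h1 _; rewrite ler_wpM2r.
apply: (@le_trans _ _ (h * nrm y)); first by rewrite ler_wpM2r ?inorm_ge0//; lra.
by rewrite /h; near: k; exact: near_dstep.
Unshelve. all: by end_near. Qed.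

(** In continuous time, the bounds of this section read as follows. Let [u = A^-1 z]
    and [z = A^-1 y] evolve by [u' = z] and [z' = y]. Then [- 2 ip z u] and [- 2 ip y z]
    are the rates at which the energies of [u] and of [z] decrease, and [2 m z u] is
    the derivative of [m u u]. The hypothesis [m_obs] thus says that [|u|^2] is at most
    minus the derivative of [lyap u z], so [|u|^2] is integrable in time; as it is
    also nonincreasing, it decays like [1 / t]. The proof runs the same computation
    along the implicit scheme, where the energies only lose further and [m] costs an
    error of order [h ^ 2] per step. *)
Section Decay.
Variables (m : V -> V -> R) (D : R).
Hypothesis D0 : 0 <= D.
Hypothesis mC : forall x y, m x y = m y x.
Hypothesis mDl : forall x y z, m (x + y) z = m x z + m y z.
Hypothesis mZl : forall (r : R) x y, m (r%:C *: x) y = r * m x y.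
Hypothesis m_le : forall x, `|m x x| <= ip x x.
Hypothesis m_obs : forall y, let z := K y in let u := K z in
  ip u u <= D * (- ip z u - ip y z) - 2 * m z u.

Lemma energy_step h y : 0 < h ->
  - (2 * h * ip (estep h y) (estep h (K y))) <= ip (K y) (K y) - ip (estep h (K y)) (estep h (K y)).
Proof.
move=> h0; have e : K y = estep h (K y) - h%:C *: estep h y by rewrite estep_stepK// addrK.
move: e; move: (estep h (K y)) (estep h y) => u z e; rewrite {}e.
have := mulr_ge0 (sqr_ge0 h) (ip_ge0 H z); rewrite !(ipE H) (ipC H u z); lra.
Qed.

Lemma m_step h y : 0 < h ->
  - (2 * h * m (estep h y) (estep h (K y))) <=
  m (K y) (K y) - m (estep h (K y)) (estep h (K y)) + h ^+ 2 * ip (estep h y) (estep h y).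
Proof.
move=> h0; have e : K y = estep h (K y) - h%:C *: estep h y by rewrite estep_stepK// addrK.
move: e; move: (estep h (K y)) (estep h y) => u z e; rewrite {}e.
have -> : u - h%:C *: z = u + (- h)%:C *: z by rewrite rmorphN/= scaleNr.
have mDr a b c : m a (b + c) = m a b + m a c by rewrite mC mDl !(mC a).
have mZr a b r : m a (r%:C *: b) = r * m a b by rewrite mC mZl (mC a).
have h1 : - m z z <= ip z z by rewrite lerNl; have := m_le z; rewrite ler_norml => /andP[].
have := ler_wpM2l (sqr_ge0 h) h1; rewrite !(mDl, mDr, mZl, mZr) (mC u z); lra.
Qed.

Definition lyap (u z : V) : R := D / 2 * (ip u u + ip z z) + m u u.

(** The left side replaces the sum of the [|u j|^2] by [n] times its last term,
    which is the smallest. *)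
Lemma obs_sum h n y : 0 < h ->
  n%:R * h * ip (estepn h n (K (K y))) (estepn h n (K (K y))) <=
  lyap (K (K y)) (K y) - lyap (estepn h n (K (K y))) (estepn h n (K y)) +
    n%:R * h * (h * ip (K y) (K y)).
Proof.
move=> h0; pose u j := estepn h j (K (K y)); pose z j := estepn h j (K y).
rewrite -/(u n) -/(z n); elim: n => [|n IH]; first by rewrite !mul0r subrr addr0.
have uS : u n.+1 = estep h (u n) by [].
have zS : z n.+1 = estep h (z n) by [].
have uK j : u j = K (z j) by rewrite /u estepn_K.
have zK j : z j = K (estepn h j y) by rewrite /z estepn_K.
have e1 := energy_step (z n) h0; rewrite -uK -zS -uS in e1.
have e2 := energy_step (estepn h n y) h0; rewrite -zK -zS in e2.
have e3 := m_step (z n) h0; rewrite -uK -zS -uS in e3.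
have e4 := m_obs (estepn h n.+1 y); cbv zeta in e4; rewrite -zK -uK in e4.
have {e4} := ler_wpM2l (ltW h0) e4; rewrite -[estepn h n.+1 y]/(estep h (estepn h n y)) => e4.
have D1 := ler_wpM2l D0 e1; have D2 := ler_wpM2l D0 e2.
have e5 : ip (z n.+1) (z n.+1) <= ip (K y) (K y).
  by rewrite -!inorm_sqr// ler_pXn2r ?nnegrE ?inorm_ge0//; exact: estepn_contr.
have e6 : ip (u n.+1) (u n.+1) <= ip (u n) (u n).
  by rewrite -!inorm_sqr// ler_pXn2r ?nnegrE ?inorm_ge0//; exact: estep_contr.
have e7 := ler_wpM2l (sqr_ge0 h) e5.
have nh : 0 <= n%:R * h by rewrite mulr_ge0 ?(ltW h0).
have e8 := ler_wpM2l nh e6.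
rewrite -(natr1 n); move: IH; rewrite /lyap => IH.
lra.
Qed.

Lemma expinv_decay t y : 0 <= t ->
  t * ip (expinv t (K (K y))) (expinv t (K (K y))) <=
  (D / 2 + 2) * (ip (K (K y)) (K (K y)) + ip (K y) (K y)).
Proof.
move=> t0; set x := K (K y); set B := (_ + 2) * _; set c := ip (K y) (K y).
have B0 k : (t - dstep k) * ip (euler k t x) (euler k t x) <= B + t * (dstep k * c).
  have h0 := dstep_gt0 k; have /andP[n1 n2] := dindex_itv k t0.
  have := obs_sum (dindex k t) y h0; rewrite /lyap -/x -/(euler k t x) -/c => h1.
  set u := euler k t x in h1 *; set z := estepn _ _ (K y) in h1.
  have c0 : 0 <= c by exact: ip_ge0.
  have h2 : (t - dstep k) * ip u u <= (dindex k t)%:R * dstep k * ip u u.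
    by rewrite ler_wpM2r ?(ip_ge0 H)//; lra.
  have h3 : (dindex k t)%:R * dstep k * (dstep k * c) <= t * (dstep k * c).
    by rewrite ler_wpM2r// mulr_ge0 ?(ltW h0).
  have h4 : 0 <= D / 2 * (ip u u + ip z z).
    by rewrite !mulr_ge0 ?addr_ge0 ?(ip_ge0 H)//.
  have h5 : - m u u <= ip u u by rewrite lerNl; have := m_le u; rewrite ler_norml => /andP[].
  have h6 : m x x <= ip x x by have := m_le x; rewrite ler_norml => /andP[].
  have h7 : ip u u <= ip x x.
    by rewrite -!inorm_sqr// ler_pXn2r ?nnegrE ?inorm_ge0//; exact: euler_contr.
  apply: le_trans h2 _; apply: le_trans h1 _; rewrite /B -/c; lra.
have c1 : (t - dstep k) * ip (euler k t x) (euler k t x) @[k --> \oo] --> (t - 0) * ip (expinv t x) (expinv t x).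
  apply: cvgM; first by apply: cvgB; [exact: cvg_cst|exact: dstep_cvg].
  rewrite -inorm_sqr// expr2 (_ : (fun k => ip (euler k t x) (euler k t x)) = (fun k => nrm (euler k t x) * nrm (euler k t x))).
    by apply: cvgM; apply: icvg_nrm => //; exact: expinv_cvg.
  by apply/funext => k; rewrite -expr2 inorm_sqr.
have c2 : B + t * (dstep k * c) @[k --> \oo] --> B + t * (0 * c).
  apply: cvgD; first exact: cvg_cst.
  apply: cvgM; first exact: cvg_cst.
  by apply: cvgMl; exact: dstep_cvg.
rewrite mul0r mulr0 addr0 in c2; rewrite subr0 in c1.
have := @ler_cvg_to _ _ _ _ _ _ _ _ c1 c2; apply.
by apply: nearW.
Qed.

Lemma expinv_stable x e : 0 < e -> exists t0, forall t, t0 <= t -> nrm (expinv t x) <= e.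
Proof.
move=> e0; have e2 : 0 < e / 2 by rewrite divr_gt0.
have [y hy] := range2_dense x e2.
set B := (D / 2 + 2) * (ip (K (K y)) (K (K y)) + ip (K y) (K y)).
have B0 : 0 <= B by rewrite mulr_ge0 ?addr_ge0 ?(ip_ge0 H)// mulr_ge0.
have e22 : 0 < (e / 2) ^+ 2 by rewrite exprn_gt0.
exists ((B + 1) / (e / 2) ^+ 2) => t tt.
have t0 : 0 < t by apply: lt_le_trans tt; rewrite divr_gt0// ltr_wpDl.
have h1 : nrm (expinv t (K (K y))) <= e / 2.
  apply: (inorm_le H); first exact: ltW.
  rewrite -(ler_pM2l t0); apply: le_trans (expinv_decay y (ltW t0)) _; rewrite -/B.
  by move: tt; rewrite ler_pdivrMr//; lra.
have -> : expinv t x = expinv t (x - K (K y)) + expinv t (K (K y)).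
  by rewrite expinvB ?subrK// ltW.
apply: le_trans (inormD H _ _) _.
have := expinv_contr (x - K (K y)) (ltW t0); lra.
Qed.

End Decay.

End Resolvent.

Section Topology.
Context (R : realType) (V : normedModType R[i]) (ip : V -> V -> R).
Hypothesis H : inner_product ip.
Hypothesis complete : icomplete ip.
Local Notation nrm := (inorm ip).
Variable M : R.
Hypothesis M0 : 0 < M.
Hypothesis norm_le : forall x : V, `|x| <= (M * nrm x)%:C.
Hypothesis nrm_le : forall x : V, (nrm x)%:C <= M%:C * `|x|.

(** The norm of [V] need not be that of [ip], only equivalent to it: on a product
    space it is the maximum of the norms of the factors. *)
Lemma cvg_inormP (T : Type) (F : set_system T) (FF : Filter F) (f : T -> V) (l : V) :
  f @ F --> l <-> (forall e : R, 0 < e -> \forall t \near F, nrm (f t - l) <= e).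
Proof.
split=> [fl e e0|fl].
  have eM : 0 < (e / M)%:C by rewrite ltcR divr_gt0.
  move/cvgrPdist_le : fl => /(_ _ eM); apply: filterS => t ht.
  rewrite inormB// -lecR; apply: le_trans (nrm_le _) _.
  apply: le_trans (ler_wpM2l _ ht) _; first by rewrite lecR ltW.
  by rewrite -rmorphM/= mulrC divfK ?gt_eqF.
apply/cvgrPdist_le => -[a b]; rewrite ltcE/= => /andP[/eqP-> a0].
have aM : 0 < a / M by rewrite divr_gt0.
apply: filterS (fl _ aM) => t ht; apply: le_trans (norm_le _) _.
by rewrite -[(a +i* 0)%C]/(a%:C) lecR -ler_pdivlMl// mulrC inormB.
Qed.

Variables (K : {linear V -> V}) (C : R).
Hypothesis C0 : 0 < C.
Hypothesis K_dis : forall y, ip y (K y) <= 0.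
Hypothesis K_bound : forall y, nrm (K y) <= C * nrm y.
Hypothesis K_inj : forall y, K y = 0 -> y = 0.

Local Notation T := (expinv ip K).

Lemma expinv_C0_semigroup : C0_semigroup T.
Proof.
split.
- move=> t t0; split; first by move=> a x y; exact: (expinv_linear H complete C0).
  move=> x; apply/cvg_inormP => e e0.
  have /cvg_inormP/(_ _ e0) : y @[y --> x] --> x by exact: cvg_id.
  apply: filterS => y hy; rewrite -(expinvB H complete C0)//.
  exact: le_trans (expinv_contr H complete C0 _ _ _ _ t0) hy.
- by move=> x; exact: (expinv0 H complete C0).
- by move=> s t x s0 t0; exact: (expinvD H complete C0).
- move=> x; apply/cvg_inormP => e e0.
  have e4 : 0 < e / 4 by rewrite divr_gt0.
  have [y hy] := range_dense H complete C0 K_dis K_bound K_inj x e4.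
  have y1 : 0 < nrm y + 1 by rewrite ltr_wpDl ?inorm_ge0.
  have ey : 0 < e / 2 / (nrm y + 1) by rewrite !divr_gt0.
  near=> t.
  have t0 : 0 <= t by apply: ltW; near: t; exact: nbhs_right_gt.
  have te : t * (nrm y + 1) <= e / 2.
    rewrite -ler_pdivlMr//; near: t; exact: nbhs_right_ltW.
  have -> : T t x - x = T t (x - K y) + (T t (K y) - K y) + (K y - x).
    by rewrite (expinvB H complete C0)// subrKA subrKA.
  apply: le_trans (inormD H _ _) _; rewrite (inormB H (K y)).
  apply: le_trans (lerD (inormD H _ _) (lexx _)) _.
  have := expinv_contr H complete C0 K_dis K_bound K_inj (x - K y) t0.
  have := expinv_dist H complete C0 K_dis K_bound K_inj y t0.
  lra.
Unshelve. all: by end_near. Qed.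

Lemma expinv_quotient y e : 0 < e ->
  \forall t \near 0^'+, nrm ((t^-1)%:C *: (T t (K y) - K y) - y) <= e.
Proof.
move=> e0; have e4 : 0 < e / 4 by rewrite divr_gt0.
have [z hz] := range_dense H complete C0 K_dis K_bound K_inj y e4.
have z1 : 0 < nrm z + 1 by rewrite ltr_wpDl ?inorm_ge0.
have ez : 0 < e / 2 / (nrm z + 1) by rewrite !divr_gt0.
near=> t.
have t0 : 0 < t by near: t; exact: nbhs_right_gt.
have te : t * (nrm z + 1) <= e / 2.
  rewrite -ler_pdivlMr//; near: t; exact: nbhs_right_ltW.
have -> : (t^-1)%:C *: (T t (K y) - K y) - y =
    (t^-1)%:C *: (T t (K y) - (K y + t%:C *: y)).
  by apply: (ip_inj H) => w; rewrite !(ipE H); field; rewrite gt_eqF.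
rewrite inormZ// gtr0_norm ?invr_gt0// ler_pdivrMl//.
apply: le_trans (expinv_deriv H complete C0 K_dis K_bound K_inj y z (ltW t0)) _.
rewrite ler_pM2l//; lra.
Unshelve. all: by end_near. Qed.

(** If the difference quotient at [x] tends to [y], apply the bounded operator [K],
    which commutes with the semigroup: the quotient at [K x] tends both to [K y]
    and, by [expinv_quotient], to [x]. *)
Lemma expinv_generator (D : set V) (A : V -> V) :
  (forall x y, D x /\ y = A x <-> x = K y) -> is_generator D A T.
Proof.
move=> DA x y; rewrite DA; split=> [|->]; last first.
  by apply/cvg_inormP => e e0; exact: expinv_quotient.
move=> /cvg_inormP h; apply: (inorm_eq H) => e e0.
have e2 : 0 < e / 2 by rewrite divr_gt0.
have eC : 0 < e / 2 / C by rewrite divr_gt0.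
near (0 : R)^'+ => t.
have t0 : 0 < t by near: t; exact: nbhs_right_gt.
have h1 : nrm ((t^-1)%:C *: (T t x - x) - y) <= e / 2 / C by near: t; exact: h.
have h2 : nrm ((t^-1)%:C *: (T t (K x) - K x) - x) <= e / 2.
  by near: t; exact: expinv_quotient.
apply: le_trans (inormDB H _ ((t^-1)%:C *: (T t (K x) - K x)) _) _.
rewrite inormB// [e]splitr lerD//.
rewrite (expinv_K H complete C0 K_dis K_bound K_inj x (ltW t0)).
rewrite (_ : _ - K y = K ((t^-1)%:C *: (T t x - x) - y)); last first.
  by rewrite (linearB K) linearZ/= (linearB K).
apply: le_trans (K_bound _) _; move: h1; rewrite ler_pdivlMr// mulrC.
exact.
Unshelve. all: by end_near. Qed.

Lemma expinv_strongly_stable (m : V -> V -> R) (D : R) : 0 <= D ->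
  (forall x y, m x y = m y x) ->
  (forall x y z, m (x + y) z = m x z + m y z) ->
  (forall (r : R) x y, m (r%:C *: x) y = r * m x y) ->
  (forall x, `|m x x| <= ip x x) ->
  (forall y, let z := K y in let u := K z in
    ip u u <= D * (- ip z u - ip y z) - 2 * m z u) ->
  strongly_stable T.
Proof.
move=> D0 mC mDl mZl m_le m_obs x; apply/cvg_inormP => e e0.
have [t0 ht] := expinv_stable H complete C0 K_dis K_bound K_inj D0 mC mDl mZl m_le m_obs x e0.
near=> t; rewrite subr0; apply: ht; near: t.
exact: nbhs_pinfty_ge (num_real _).
Unshelve. all: by end_near. Qed.

Theorem dissipative_inverse_stable_semigroup (D : set V) (A : V -> V)
    (m : V -> V -> R) (k : R) :
  (forall x y, D x /\ y = A x <-> x = K y) -> 0 <= k ->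
  (forall x y, m x y = m y x) ->
  (forall x y z, m (x + y) z = m x z + m y z) ->
  (forall (r : R) x y, m (r%:C *: x) y = r * m x y) ->
  (forall x, `|m x x| <= ip x x) ->
  (forall y, let z := K y in let u := K z in
    ip u u <= k * (- ip z u - ip y z) - 2 * m z u) ->
  [/\ C0_semigroup T, is_generator D A T & strongly_stable T].
Proof.
move=> DA k0 mC mDl mZl m_le m_obs; split.
- exact: expinv_C0_semigroup.
- exact: expinv_generator.
- exact: expinv_strongly_stable m_obs.
Qed.

End Topology.

(** * Integrals and absolutely continuous functions on an interval *)

Section Leb.
Context (R : realType).
Local Notation mu := (@lebesgue_measure R).
Implicit Types (a b : R) (f : R -> \bar R).

Lemma mu_aeS (P Q : R -> Prop) : (forall x, P x -> Q x) ->
  {ae mu, forall x, P x} -> {ae mu, forall x, Q x}.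
Proof. by move=> PQ; apply: (@filterS _ _ (ae_filter_ringOfSetsType mu)). Qed.

Lemma mu_aeS2 (P Q S : R -> Prop) : (forall x, P x -> Q x -> S x) ->
  {ae mu, forall x, P x} -> {ae mu, forall x, Q x} -> {ae mu, forall x, S x}.
Proof. by move=> PQ; apply: (@filterS2 _ _ (ae_filter_ringOfSetsType mu)). Qed.

Lemma leb_integral_ge0 a b f : measurable_fun setT f -> (forall x, (0 <= f x)%E) ->
  (\int[leb a b]_x f x = \int[mu]_(x in `[a, b]) f x)%E.
Proof.
move=> mf f0.
have mfS D : measurable_fun D f by exact: measurable_funS mf.
rewrite (@ge0_negligible_integral _ _ _ (leb a b) setT (~` `]a, b[))//=; last 2 first.
- exact: measurableC.
- by rewrite /leb/= /mrestr setICl measure0.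
rewrite setTD setCK.
rewrite -integral_itv_obnd_cbnd// -integral_itv_bndo_bndc//.
by apply: eq_measure_integral => A mA Aab; rewrite /leb/= /mrestr setIidl.
Qed.

Lemma leb_integral a b f : measurable_fun setT f ->
  (\int[leb a b]_x f x = \int[mu]_(x in `[a, b]) f x)%E.
Proof.
move=> mf; rewrite integralE [RHS]integralE !leb_integral_ge0//.
- exact: measurable_funeneg.
- exact: measurable_funepos.
Qed.

Lemma leb_ae a b (P : R -> Prop) :
  {ae leb a b, forall x, P x} <-> {ae mu, forall x, x \in `]a, b[ -> P x}.
Proof.
split=> [[A [mA A0 PA]]|[A [mA A0 PA]]].
  exists (A `&` `]a, b[); split => //; first exact: measurableI.
  by move=> x /= /not_implyP[xab Px]; split => //; exact: PA.
exists (A `|` ~` `]a, b[); split.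
- by apply: measurableU => //; exact: measurableC.
- rewrite /leb/= /mrestr setIUl setICl setU0; apply/eqP; rewrite -measure_le0 -A0.
  by apply: le_measure; rewrite ?inE//; exact: measurableI.
- move=> x /= Px; have [xab|xab] := boolP (x \in `]a, b[); last by right; apply/negP.
  by left; apply: PA => /= h; apply: Px; exact: h.
Qed.

Lemma leb_Rintegral a b (f : R -> R) : measurable_fun setT f ->
  \int[leb a b]_x f x = \int[mu]_(x in `[a, b]) f x.
Proof. by move=> mf; congr fine; apply: leb_integral; exact/measurable_EFinP. Qed.

(** The measure lives on the open interval, while primitives and the mean value
    estimates use the closed one. *)
Lemma ae_itvoc a b (P : R -> Prop) :
  {ae mu, forall x, x \in `]a, b[ -> P x} <->
  {ae mu, forall x, x \in `[a, b] -> P x}.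
Proof.
split; last first.
  by apply: mu_aeS => x h xab; apply: h; move: xab; rewrite !in_itv/= => /andP[/ltW-> /ltW->].
move=> [A [mA A0 PA]]; exists (A `|` [set a] `|` [set b]).
have mAa : measurable (A `|` [set a]) by apply: measurableU.
split.
- by apply: measurableU.
- rewrite measureU0//; last exact: lebesgue_measure_set1.
  by rewrite measureU0//; exact: lebesgue_measure_set1.
- move=> x /= /not_implyP[xab Px].
  have [->|xa] := eqVneq x a; first by left; right.
  have [->|xb] := eqVneq x b; first by right.
  left; left; apply: PA => /= h; apply: Px; apply: h.
  by move: xab; rewrite !in_itv/= => /andP[ax bx]; rewrite !lt_neqAle ax bx eq_sym xa xb.
Qed.

Lemma ae_eq_Rintegral D (f g : R -> R) : measurable D ->
  measurable_fun D f -> measurable_fun D g ->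
  {ae mu, forall x, x \in D -> f x = g x} ->
  \int[mu]_(x in D) f x = \int[mu]_(x in D) g x.
Proof.
move=> mD mf mg fg; congr fine; apply: ae_eq_integral => //.
- exact/measurable_EFinP.
- exact/measurable_EFinP.
- by apply: mu_aeS fg => x h Dx /=; rewrite h// inE.
Qed.

End Leb.

Section AbsolutelyContinuous.
Context (R : realType).
Local Notation mu := (@lebesgue_measure R).
Local Notation intg D f := (mu.-integrable D (EFin \o f)).
Implicit Types (a b : R) (F G f g : R -> R).

Lemma intg_fin (D : set R) f : measurable D -> intg D f ->
  (\int[mu]_(x in D) (f x)%:E)%E = (\int[mu]_(x in D) f x)%:E.
Proof. by move=> mD h; rewrite fineK//; exact: integrable_fin_num. Qed.

(** Both sides integrate [f s * g t] over the triangle [a <= t <= s <= x]; this is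
    integration by parts for primitives. *)
Lemma fubini_triangle a x f g : intg `[a, x] f -> intg `[a, x] g ->
  \int[mu]_(s in `[a, x]) (f s * \int[mu]_(t in `[a, s]) g t) =
  \int[mu]_(t in `[a, x]) ((\int[mu]_(s in `[a, x]) f s -
                          \int[mu]_(s in `[a, t]) f s) * g t).
Proof.
move=> fi gi.
have mI : measurable (`[a, x]%classic : set (measurableTypeR R)) by exact: measurable_itv.
pose ft := f \_ `[a, x]; pose gt := g \_ `[a, x].
have fti : intg setT ft by rewrite /ft -restrict_EFin; apply: (proj1 (integrable_mkcond _ _)).
have gti : intg setT gt by rewrite /gt -restrict_EFin; apply: (proj1 (integrable_mkcond _ _)).
have mft : measurable_fun setT ft by case/integrableP: fti => /measurable_EFinP.
have mgt : measurable_fun setT gt by case/integrableP: gti => /measurable_EFinP.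
pose k (z : measurableTypeR R * measurableTypeR R) : R := if z.2 <= z.1 then ft z.1 * gt z.2 else 0.
have mk : measurable_fun setT k.
  apply: measurable_fun_ifT => //.
    by apply: measurable_fun_ler; [exact: measurable_snd|exact: measurable_fst].
  apply: measurable_funM.
    exact: (measurableT_comp mft measurable_fst).
  exact: (measurableT_comp mgt measurable_snd).
have kE1 s t : k (s, t) = ft s * (g \_ `[a, s]) t.
  rewrite /k/= /ft /gt !patchE; case: ifPn => ts.
    case: ifPn => sI; last by rewrite !mul0r.
    congr (_ * _); move: sI; rewrite !mem_setE !in_itv/= => /andP[as' sx].
    by rewrite ts (le_trans ts sx).
  rewrite [X in _ = _ * X](_ : _ = 0) ?mulr0//.
  by rewrite ifF//; apply/negbTE; rewrite mem_setE in_itv/= negb_and (negbTE ts) orbT.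
have kE2 s t : k (s, t) = gt t * (f \_ `[t, x]) s.
  rewrite /k/= /ft /gt !patchE; case: ifPn => ts.
    case: (boolP (t \in _)) => tI; last by rewrite mulr0 mul0r.
    rewrite mulrC; congr (_ * _); move: tI; rewrite !mem_setE !in_itv/= => /andP[at' tx].
    by rewrite ts (le_trans at' ts).
  rewrite [X in _ = _ * X](_ : _ = 0) ?mulr0//.
  by rewrite ifF//; apply/negbTE; rewrite mem_setE in_itv/= negb_and (negbTE ts).
have ik : (mu \x mu)%E.-integrable setT (EFin \o k).
  apply/integrable12ltyP; first exact/measurable_EFinP.
  have /integrableP[_ ftf] := fti; have /integrableP[_ gtf] := gti.
  set c : \bar R := (\int[mu]_t `|(EFin \o gt) t|)%E in gtf.
  have h1 : (\int[mu]_s \int[mu]_t `|(EFin \o k) (s, t)| <=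
             \int[mu]_s (`|(EFin \o ft) s| * c))%E.
    apply: ge0_le_integral => //.
    - by move=> s _; exact: integral_ge0.
    - apply: (@measurable_fun_fubini_tonelli_F _ _ _ _ _ mu (fun z => `|(EFin \o k) z|%E)) => //.
      by apply: measurableT_comp => //; exact/measurable_EFinP.
    - by apply: emeasurable_funM => //; apply: measurableT_comp => //; exact/measurable_EFinP.
    - move=> s _; rewrite -ge0_integralZl//; last first.
        by apply: measurableT_comp => //; exact/measurable_EFinP.
      apply: ge0_le_integral => //.
      + by apply: measurableT_comp => //; apply/measurable_EFinP; exact: (measurableT_comp mk (pair1_measurable s)).
      + apply: emeasurable_funM => //; apply: measurableT_comp => //.
        exact/measurable_EFinP.
      + move=> t _; rewrite /= -EFinM lee_fin -normrM /k/=; case: ifPn => // _.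
        by rewrite normr0.
  apply: (le_lt_trans h1); rewrite ge0_integralZr//; last 2 first.
  - by apply: measurableT_comp => //; exact/measurable_EFinP.
  - exact: integral_ge0.
  apply: lte_mul_pinfty => //; first exact: integral_ge0.
  by rewrite ge0_fin_numE//; exact: integral_ge0.
have := Fubini ik.
have -> : (\int[mu]_s \int[mu]_t (EFin \o k) (s, t) =
   \int[mu]_s (((fun s => f s * \int[mu]_(t in `[a, s]) g t) \_ `[a, x]) s)%:E)%E.
  apply: eq_integral => s _ /=; under eq_integral => t _ do rewrite kE1 EFinM.
  rewrite patchE /ft patchE; case: ifPn => sI; last first.
    by under eq_integral => t _ do rewrite mul0e; rewrite integral0.
  have gs : intg setT (g \_ `[a, s]).
    rewrite -restrict_EFin; apply: (proj1 (integrable_mkcond _ _)) => //.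
    apply: integrableS gi => //; move: sI; rewrite mem_setE in_itv/= => /andP[_ sx].
    by apply: subset_itvl; rewrite bnd_simp.
  by rewrite integralZl// intg_fin// -EFinM -Rintegral_mkcond.
have -> : (\int[mu]_t \int[mu]_s (EFin \o k) (s, t) =
   \int[mu]_t (((fun t => (\int[mu]_(s in `[a, x]) f s -
                          \int[mu]_(s in `[a, t]) f s) * g t) \_ `[a, x]) t)%:E)%E.
  apply: eq_integral => t _ /=; under eq_integral => s _ do rewrite kE2 EFinM.
  rewrite patchE /gt patchE; case: ifPn => tI; last first.
    by under eq_integral => s _ do rewrite mul0e; rewrite integral0.
  move: tI; rewrite mem_setE in_itv/= => /andP[at' tx].
  have fs : intg setT (f \_ `[t, x]).
    rewrite -restrict_EFin; apply: (proj1 (integrable_mkcond _ _)) => //.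
    apply: integrableS fi => //; apply: subset_itvr; by rewrite bnd_simp.
  rewrite integralZl// intg_fin// -EFinM mulrC; congr ((_ * _)%:E).
  rewrite -Rintegral_mkcond -Rintegral_itv_obnd_cbnd; last first.
    by apply: integrableS fi => //; apply: subset_itvr; rewrite bnd_simp.
  by rewrite Rintegral_itvB.
move=> /(congr1 fine) h.
by rewrite Rintegral_mkcond [RHS]Rintegral_mkcond.
Qed.

(** Absolute continuity is taken in the form of the fundamental theorem of
    calculus, so that the derivative comes as part of the data. *)
Definition AC a b F f := intg `[a, b] f /\
  forall x, x \in `[a, b] -> F x = F a + \int[mu]_(t in `[a, x]) f t.

Lemma AC_ext a b F F' f : {in `[a, b], F =1 F'} -> AC a b F f -> AC a b F' f.
Proof.
move=> FF' [fi h]; split => // x xab; rewrite -!FF'//; first exact: h.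
by move: xab; rewrite !in_itv/= lexx => /andP[ax xb]; exact: le_trans xb.
Qed.

Lemma AC_meas a b F f : AC a b F f -> measurable_fun `[a, b] f.
Proof. by move=> [/integrableP[/measurable_EFinP]]. Qed.

Lemma intg_sub a b c d f : a <= c -> d <= b -> intg `[a, b] f -> intg `[c, d] f.
Proof.
move=> ac db; apply: integrableS => // x /=; rewrite !in_itv/= => /andP[cx xd].
by rewrite (le_trans ac cx) (le_trans xd db).
Qed.

Lemma intg_ae (D : set R) f g : measurable D -> measurable_fun D g ->
  {ae mu, forall x, x \in D -> f x = g x} -> intg D f -> intg D g.
Proof.
move=> mD mg fg /integrableP[mf hf]; apply/integrableP.
split; first exact/measurable_EFinP.
suff <- : (\int[mu]_(x in D) `|(EFin \o f) x| =
  \int[mu]_(x in D) `|(EFin \o g) x|)%E by [].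
apply: ae_eq_integral => //.
- exact: measurableT_comp.
- by apply: measurableT_comp => //; exact/measurable_EFinP.
- by apply: mu_aeS fg => x h Dx; rewrite /= h// inE.
Qed.

Lemma AC_ae a b F f g : measurable_fun `[a, b] g ->
  {ae mu, forall x, x \in `]a, b[ -> f x = g x} -> AC a b F f -> AC a b F g.
Proof.
move=> mg /ae_itvoc fg [fi h]; split.
  apply: (intg_ae _ mg _ fi) => //.
  by apply: mu_aeS fg => x h1 xab; apply: h1; rewrite mem_setE in xab.
move=> x xab; rewrite h//; congr (_ + _); apply: ae_eq_Rintegral => //.
- have [/measurable_EFinP mf _] := integrableP _ _ _ fi.
  by apply: measurable_funS mf => //; apply: subset_itvl; move: xab; rewrite in_itv bnd_simp => /andP[].
- by apply: measurable_funS mg => //; apply: subset_itvl; move: xab; rewrite in_itv bnd_simp => /andP[].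
- apply: mu_aeS fg => y h1; rewrite mem_setE => yax; apply: h1; move: yax xab.
  by rewrite !in_itv/= => /andP[-> yx] /andP[_ xb]; exact: le_trans yx xb.
Qed.

Lemma AC_continuous a b F f : a <= b -> AC a b F f -> {within `[a, b], continuous F}.
Proof.
move=> ab [fi h].
have c := parameterized_integral_continuous ab fi.
apply: (@subspace_eq_continuous _ _ _ (fun x => F a + parameterized_integral mu a x f)).
  by move=> x; rewrite mem_setE => xab; rewrite [RHS]h.
by move=> x; apply: cvgD; [exact: cvg_cst|exact: c].
Qed.

Lemma continuous_bounded_meas a b F : a <= b -> {within `[a, b], continuous F} ->
  measurable_fun `[a, b] F /\ [bounded F x | x in `[a, b]%classic].
Proof.
move=> ab cF; split; first exact: subspace_continuous_measurable_fun.
have [M MP] := EVT_max ab cF; have [m mP] := EVT_min ab cF.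
move=> M1 m1; exists (`|F M| + `|F m|); split; first exact: num_real.
move=> y hy x /= xab; have := M1 _ xab; have := m1 _ xab.
have h1 := ler_norm (F M); have h2 := ler_norm (- F m); rewrite normrN in h2.
have h3 := normr_ge0 (F M); have h4 := normr_ge0 (F m).
by move=> f1 f2; rewrite ler_norml; apply/andP; split; lra.
Qed.

(** The product rule, with the double integral handled by [fubini_triangle]. *)
Lemma AC_mul a b F G f g : a <= b -> AC a b F f -> AC a b G g ->
  AC a b (fun x => F x * G x) (fun x => f x * G x + F x * g x).
Proof.
move=> ab ACF ACG; have [fi hF] := ACF; have [gi hG] := ACG.
have [mF bF] := continuous_bounded_meas ab (AC_continuous ab ACF).
have [mG bG] := continuous_bounded_meas ab (AC_continuous ab ACG).
have fGi : intg `[a, b] (fun x => f x * G x).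
  exact: (integrableMl _ fi mG bG).
have Fgi : intg `[a, b] (fun x => F x * g x).
  rewrite (_ : (fun x => F x * g x) = (fun x => g x * F x)).
    exact: (integrableMl _ gi mF bF).
  by apply/funext => x; rewrite mulrC.
split; first exact: (integrableD _ fGi Fgi).
move=> x xab; have /andP[ax xb] : a <= x <= b by move: xab; rewrite in_itv.
have sub f' : intg `[a, b] f' -> intg `[a, x] f' by apply: intg_sub.
have mI : measurable (`[a, x]%classic : set (measurableTypeR R)) by exact: measurable_itv.
rewrite RintegralD//; try exact: sub.
have -> : \int[mu]_(t in `[a, x]) (f t * G t) =
    \int[mu]_(t in `[a, x]) (f t * G a + f t * \int[mu]_(s in `[a, t]) g s).
  apply: eq_Rintegral => t; rewrite inE/= in_itv/= => /andP[at' tx].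
  by rewrite -mulrDr -hG// in_itv/= at' (le_trans tx xb).
have i1 : intg `[a, x] (fun t => f t * G a).
  exact: (integrableZr _ _ (sub _ fi)).
rewrite RintegralD//; last first.
  have i2 : intg `[a, x] (fun t => f t * G t - f t * G a).
    exact: (integrableB _ (sub _ fGi) i1).
  apply: eq_integrable i2 => // t; rewrite mem_setE in_itv/= => /andP[at' tx].
  rewrite /= hG ?in_itv/= ?at' ?(le_trans tx xb)//; congr (_%:E); ring.
rewrite fubini_triangle ?RintegralZr//; try exact: sub.
have -> : \int[mu]_(t in `[a, x]) ((\int[mu]_(s in `[a, x]) f s - \int[mu]_(s in `[a, t]) f s) * g t)
   = \int[mu]_(t in `[a, x]) (F x * g t - F t * g t).
  apply: eq_Rintegral => t; rewrite inE/= in_itv/= => /andP[at' tx].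
  rewrite hF// (hF t) ?in_itv/= ?at' ?(le_trans tx xb)//; ring.
rewrite RintegralB ?RintegralZl//; try exact: sub.
  rewrite (hF x xab) (hG x xab); ring.
exact: (integrableZl _ _ (sub _ gi)).
Qed.

Lemma AC_lin a b (r : R) F G f g : AC a b F f -> AC a b G g ->
  AC a b (fun x => r * F x + G x) (fun x => r * f x + g x).
Proof.
move=> [fi hF] [gi hG].
have rfi : intg `[a, b] (fun x => r * f x) by exact: (integrableZl _ r fi).
split; first exact: (integrableD _ rfi gi).
move=> x xab; have xb : x <= b by move: xab; rewrite in_itv/= => /andP[].
rewrite RintegralD//; try exact: (intg_sub (lexx a) xb).
rewrite RintegralZl//; last exact: (intg_sub (lexx a) xb).
by rewrite (hF x)// (hG x)// mulrDr addrACA.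
Qed.

Lemma Rint_pt (c : R) f : \int[mu]_(t in `[c, c]) f t = 0.
Proof. by rewrite set_itv1 Rintegral_set1. Qed.

Lemma AC_prim a b (c : R) f : intg `[a, b] f ->
  AC a b (fun x => c + \int[mu]_(t in `[a, x]) f t) f.
Proof. by move=> fi; split => // x _; rewrite Rint_pt addr0. Qed.

Lemma mu_itv (c d : R) : c <= d -> mu (`[c, d]%classic : set R) = (d - c)%:E.
Proof.
move=> cd; rewrite lebesgue_measure_itv/= lte_fin.
by case: ifPn => //=; rewrite -leNgt => dc; rewrite (@le_anti _ _ c d) ?cd// subrr.
Qed.

Lemma Rint_cst (c d r : R) : c <= d -> \int[mu]_(t in `[c, d]) r = r * (d - c).
Proof.
move=> cd; rewrite Rintegral_cst//; congr (_ * _).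
by rewrite -[RHS]/(fine (d - c)%:E); congr fine; exact: mu_itv.
Qed.

Lemma intg_cst (c d r : R) : intg `[c, d] (fun=> r).
Proof.
apply: measurable_bounded_integrable => //.
  have [cd|dc] := leP c d; first by rewrite [X in (X < _)%E](mu_itv cd) ltry.
  by rewrite set_itv_ge ?measure0// bnd_simp -ltNge.
exists `|r|; split; first exact: num_real.
by move=> y hy x _ /=; exact: ltW.
Qed.

Lemma AC_id a b : AC a b id (fun=> 1).
Proof.
split; first exact: intg_cst.
move=> x; rewrite in_itv/= => /andP[ax _].
by rewrite Rint_cst// mul1r subrKC.
Qed.

Lemma Rint_sub a b x y f : a <= x -> x <= y -> y <= b -> intg `[a, b] f ->
  \int[mu]_(t in `[a, y]) f t - \int[mu]_(t in `[a, x]) f t =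
  \int[mu]_(t in `[x, y]) f t.
Proof.
move=> ax xy yb fi; have fy := intg_sub (lexx a) yb fi.
rewrite Rintegral_itvB ?bnd_simp// Rintegral_itv_obnd_cbnd//.
by apply: integrableS (intg_sub ax yb fi) => //; apply: subset_itvr; rewrite bnd_simp.
Qed.

Lemma AC_diff a b F f x y : AC a b F f -> a <= x -> x <= y -> y <= b ->
  F y - F x = \int[mu]_(t in `[x, y]) f t.
Proof.
move=> [fi h] ax xy yb; rewrite h ?in_itv/= ?(le_trans ax xy)//.
rewrite (h x) ?in_itv/= ?ax ?(le_trans xy yb)//.
by rewrite opprD addrACA subrr add0r (Rint_sub ax xy yb fi).
Qed.

Lemma le_Rint (c d : R) f g : intg `[c, d] f -> intg `[c, d] g ->
  (forall x, x \in `[c, d] -> f x <= g x) ->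
  \int[mu]_(x in `[c, d]) f x <= \int[mu]_(x in `[c, d]) g x.
Proof. by move=> fi gi h; apply: le_Rintegral. Qed.

Lemma Rint_ge0 (D : set R) f : (forall x, 0 <= f x) -> 0 <= \int[mu]_(x in D) f x.
Proof. by move=> h; apply: Rintegral_ge0. Qed.

Lemma Rint_D (c d : R) f g : intg `[c, d] f -> intg `[c, d] g ->
  \int[mu]_(x in `[c, d]) (f x + g x) =
  \int[mu]_(x in `[c, d]) f x + \int[mu]_(x in `[c, d]) g x.
Proof. by move=> fi gi; apply: RintegralD. Qed.

Lemma Rint_B (c d : R) f g : intg `[c, d] f -> intg `[c, d] g ->
  \int[mu]_(x in `[c, d]) (f x - g x) =
  \int[mu]_(x in `[c, d]) f x - \int[mu]_(x in `[c, d]) g x.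
Proof. by move=> fi gi; apply: RintegralB. Qed.

Lemma Rint_Z (c d r : R) f : intg `[c, d] f ->
  \int[mu]_(x in `[c, d]) (r * f x) = r * \int[mu]_(x in `[c, d]) f x.
Proof. by move=> fi; apply: RintegralZl. Qed.

(** The variance argument: expand [0 <= \int (f - I)^2] with [I = \int f]. *)
Lemma Rint_sqr_le (c d : R) f : c <= d -> d - c <= 1 -> intg `[c, d] f ->
  intg `[c, d] (fun x => f x ^+ 2) ->
  (\int[mu]_(x in `[c, d]) f x) ^+ 2 <= \int[mu]_(x in `[c, d]) (f x ^+ 2).
Proof.
move=> cd dc fi f2i; set I := \int[mu]_(x in _) f x.
have i1 : intg `[c, d] (fun x => (- 2 * I) * f x) by exact: (integrableZl _ _ fi).
have i2 := intg_cst c d (I ^+ 2).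
have i3 : intg `[c, d] (fun x => (- 2 * I) * f x + I ^+ 2) by exact: (integrableD _ i1 i2).
have : 0 <= \int[mu]_(x in `[c, d]) (f x ^+ 2 + ((- 2 * I) * f x + I ^+ 2)).
  apply: Rint_ge0 => x; have := sqr_ge0 (f x - I); rewrite sqrrB.
  by rewrite (_ : f x ^+ 2 + _ = f x ^+ 2 - f x * I *+ 2 + I ^+ 2)//; ring.
rewrite RintegralD// RintegralD// RintegralZl// Rint_cst// -/I.
have : 0 <= (1 - (d - c)) * I ^+ 2 by rewrite mulr_ge0 ?sqr_ge0// subr_ge0.
by lra.
Qed.

Lemma AC_sqr_le a b F f x y : AC a b F f -> b - a <= 1 ->
  intg `[a, b] (fun x => f x ^+ 2) -> x \in `[a, b] -> y \in `[a, b] ->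
  (F y - F x) ^+ 2 <= \int[mu]_(t in `[a, b]) (f t ^+ 2).
Proof.
wlog xy : x y / x <= y.
  move=> h; have [xy|/ltW yx] := leP x y; first exact: h.
  by move=> ? ? ? ? ?; rewrite -sqrrN opprB; exact: h.
move=> ACF ba f2 ; rewrite !in_itv/= => /andP[ax xb] /andP[ay yb].
rewrite (AC_diff ACF)//; have [fi _] := ACF.
apply: (@le_trans _ _ (\int[mu]_(t in `[x, y]) (f t ^+ 2))).
  by apply: Rint_sqr_le => //; [lra|exact: intg_sub fi|exact: intg_sub f2].
rewrite -(Rint_sub ax xy yb f2).
have h1 : 0 <= \int[mu]_(t in `[a, x]) (f t ^+ 2) by apply: Rint_ge0 => t; exact: sqr_ge0.
have := Rint_sub (le_trans ax xy) yb (lexx b) f2.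
have h2 : 0 <= \int[mu]_(t in `[y, b]) (f t ^+ 2) by apply: Rint_ge0 => t; exact: sqr_ge0.
lra.
Qed.

(** At a Lebesgue point, [f] is the derivative of its primitive, which vanishes. *)
Lemma zero_prim a b f : intg `[a, b] f ->
  (forall x, x \in `[a, b] -> \int[mu]_(t in `[a, x]) f t = 0) ->
  {ae mu, forall x, x \in `]a, b[ -> f x = 0}.
Proof.
move=> fi f0; have mI : measurable (`[a, b]%classic : set (measurableTypeR R)) by exact: measurable_itv.
have /lebesgue_differentiation := integrable_locally mI fi.
apply: mu_aeS => x fx; rewrite in_itv/= => /andP[ax xb].
have fri : intg [set` Interval (BLeft a) (BRight b)] (f \_ `[a, b]).
  apply: eq_integrable fi => // t tab; rewrite /= patchE.
  by rewrite tab.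
have /= := FTC1_lebesgue_pt xb fri.
move=> /(_ _ fx); rewrite lte_fin => /(_ ax)[d1 d2].
have xab : x \in `[a, b] by rewrite in_itv/= !ltW.
have -> : f x = (f \_ `[a, b]) x by rewrite patchE mem_setE xab.
rewrite -d2 derive1E.
rewrite (@near_eq_derive _ _ _ _ (fun=> 0)) ?derive_cst//.
near=> y.
transitivity (\int[mu]_(t in `[a, y]) f t).
  apply: eq_Rintegral => t; rewrite mem_setE in_itv/= => /andP[at' ty].
  rewrite patchE mem_setE in_itv/= at' (le_trans ty)//.
  by apply: ltW; near: y; apply: lt_nbhsl.
by apply: f0; rewrite in_itv/=; apply/andP; split; apply: ltW; near: y;
  [exact: lt_nbhsr|exact: lt_nbhsl].
Unshelve. all: by end_near. Qed.

Lemma AC_uniq a b F f g : AC a b F f -> AC a b F g ->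
  {ae mu, forall x, x \in `]a, b[ -> f x = g x}.
Proof.
move=> [fi hf] [gi hg].
have di : intg `[a, b] (fun x => f x - g x) by exact: (integrableB _ fi gi).
apply: mu_aeS (zero_prim di _) => [x h xab|x xab].
  by apply/eqP; rewrite -subr_eq0 h.
have xb : x <= b by move: xab; rewrite in_itv/= => /andP[].
rewrite RintegralB//; try exact: (intg_sub (lexx a) xb).
by have := hf x xab; rewrite (hg x xab) => /addrI ->; rewrite subrr.
Qed.

Lemma AC_C1 a b (F : R -> R) : a < b -> (forall x, derivable F x 1) ->
  (forall x, derivable (derive1 F) x 1) -> AC a b F (derive1 F).
Proof.
move=> ab dF dF'.
have cF' : continuous (derive1 F).
  by move=> x; apply/differentiable_continuous/derivable1_diffP; exact: dF'.
have cF : continuous F.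
  by move=> x; apply/differentiable_continuous/derivable1_diffP; exact: dF.
have F'i x y : intg `[x, y] (derive1 F).
  apply: continuous_compact_integrable; first exact: segment_compact.
  exact: continuous_subspaceT.
split => // x; rewrite in_itv/= => /andP[]; rewrite le_eqVlt => /orP[/eqP<- _|ax xb].
  by rewrite Rint_pt addr0.
have := @continuous_FTC2 R (derive1 F) F a x ax (continuous_subspaceT cF').
rewrite intg_fin// -EFinB => h.
have D : derivable_oo_LRcontinuous F a x.
  split; first by move=> y _; exact: dF.
  - by apply: cvg_at_right_filter; exact: cF.
  - by apply: cvg_at_left_filter; exact: cF.
have e := h D (fun _ _ => erefl).
by case: e => ->; rewrite addrC subrK.
Qed.

End AbsolutelyContinuous.

(** * Smooth test functions and weak derivatives *)

Section Smooth.
Context (R : realType).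
Implicit Types (f g : R -> R).

(** Smoothness by recursion on the derivative, so that the closure properties below
    go by induction. *)
Fixpoint differentiable_upto (n : nat) f : Prop :=
  (forall x, derivable f x 1) /\
  if n is n'.+1 then differentiable_upto n' (derive1 f) else True.

Definition smooth f := forall n, differentiable_upto n f.

Lemma smooth_derive1n f n (x : R) : smooth f -> derivable (derive1n n f) x 1.
Proof.
elim: n f => [|n IH] f sf; first by have [] := sf 0%N.
by rewrite derive1Sn; apply: (IH (derive1 f)) => k; have [_] := sf k.+1.
Qed.

Lemma duptoS n f : differentiable_upto n.+1 f -> differentiable_upto n f.
Proof. elim: n f => [|n IH] f [df h]; split => //; exact: (IH _ h). Qed.

Lemma dupto_derive n f g : (forall x : R, is_derive x 1 f (g x)) ->
  differentiable_upto n g -> differentiable_upto n.+1 f.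
Proof.
move=> h sg; have e : derive1 f = g by apply/funext => x; rewrite derive1E; have [_ ->] := h x.
by split; [move=> x; have [] := h x|rewrite e].
Qed.

Lemma dupto_is_derive n f (x : R) : differentiable_upto n f -> is_derive x 1 f (derive1 f x).
Proof. by case: n => [|n] [df _]; rewrite derive1E; exact: derivableP. Qed.

Lemma dupto_add n f g : differentiable_upto n f -> differentiable_upto n g ->
  differentiable_upto n (fun x => f x + g x).
Proof.
elim: n f g => [|n IH] f g sf sg.
  by split => // x; apply: derivableD; [have [] := sf|have [] := sg].
apply: (@dupto_derive _ _ (fun x => derive1 f x + derive1 g x)).
  by move=> x; apply: is_deriveD; [exact: (dupto_is_derive _ sf)|exact: (dupto_is_derive _ sg)].
by apply: IH; [have [] := sf|have [] := sg].
Qed.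

Lemma dupto_mul n f g : differentiable_upto n f -> differentiable_upto n g ->
  differentiable_upto n (fun x => f x * g x).
Proof.
elim: n f g => [|n IH] f g sf sg.
  by split => // x; apply: derivableM; [have [] := sf|have [] := sg].
apply: (@dupto_derive _ _ (fun x => f x * derive1 g x + g x * derive1 f x)).
  by move=> x; apply: is_deriveM; [exact: (dupto_is_derive _ sf)|exact: (dupto_is_derive _ sg)].
have [_ sf'] := sf; have [_ sg'] := sg.
by apply: dupto_add; apply: IH => //; exact: duptoS.
Qed.

Lemma dupto_cst n (c : R) : differentiable_upto n (fun=> c).
Proof.
elim: n c => [|n IH] c; first by split => // x; exact: derivable_cst.
by apply: (@dupto_derive _ _ (fun=> 0)) => // x; exact: is_derive_cst.
Qed.

Lemma dupto_affine n f (k c : R) : differentiable_upto n f ->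
  differentiable_upto n (fun x => f (k * x + c)).
Proof.
have h m g (x : R) : differentiable_upto m g ->
    is_derive x 1 (fun x => g (k * x + c)) (derive1 g (k * x + c) * k).
  move=> sg.
  apply: (@is_derive1_comp _ g (fun x => k * x + c) x); first exact: (dupto_is_derive _ sg).
  have : is_derive x 1 (fun x : R => k * x + c) (k *: 1 + 0).
    by apply: is_deriveD; apply: is_deriveZ; exact: is_derive_id.
  by rewrite addr0 /GRing.scale/= mulr1.
elim: n f => [|n IH] f sf.
  by split => // x; have [] := h _ _ x sf.
refine (@dupto_derive n (fun x => f (k * x + c)) (fun x => derive1 f (k * x + c) * k) _ _).
  by move=> x; exact: (h n.+1 f x sf).
by apply: dupto_mul; [apply: IH; have [] := sf|exact: dupto_cst].
Qed.

Lemma horner_bound (p : {poly R}) : exists C n, 0 <= C /\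
  forall y, 1 <= y -> `|p.[y]| <= C * y ^+ n.
Proof.
elim/poly_ind: p => [|p c [C [n [C0 h]]]].
  by exists 0, 0%N; split => // y _; rewrite horner0 normr0 mul0r.
exists (C + `|c|), n.+1; split; first by rewrite addr_ge0.
move=> y y1; have y0 : 0 <= y by lra.
rewrite hornerMXaddC mulrDl; apply: le_trans (ler_normD _ _) _; apply: lerD.
  by rewrite normrM (ger0_norm y0) exprSr mulrA ler_wpM2r// h.
by rewrite ler_peMr// exprn_ege1.
Qed.

Lemma expR_bound n (y : R) : 0 <= y -> y ^+ n <= n%:R ^+ n * expR y.
Proof.
move=> y0; case: n => [|n]; first by rewrite !expr0 mul1r -expR0 ler_expR.
have n0 : 0 < n.+1%:R :> R by [].
have -> : y = n.+1%:R * (y / n.+1%:R) by field.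
rewrite expRM_natl exprMn ler_pM2l ?exprn_gt0// ler_pXn2r ?nnegrE ?expR_ge0 ?divr_ge0//.
by apply: le_trans (expR_ge1Dx _); rewrite lerDr.
Qed.

(** The family [p (1 / x) exp (- 1 / x)], [p] a polynomial, extended by zero to
    [x <= 0], is closed under differentiation; all its members are therefore smooth. *)
Definition flat (p : {poly R}) (x : R) : R :=
  if 0 < x then p.[x^-1] * expR (- x^-1) else 0.

(** Quadratic decay at [0] gives derivative [0] there. *)
Lemma flat_bound p : exists2 D, 0 <= D &
  forall x, x <= 1 -> `|flat p x| <= D * x ^+ 2.
Proof.
have [C [n [C0 h]]] := horner_bound p.
exists (C * n.+2%:R ^+ n.+2); first by rewrite mulr_ge0 ?exprn_ge0.
move=> x x1; rewrite /flat; case: ifPn => [x0|_]; last first.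
  by rewrite normr0 mulr_ge0 ?sqr_ge0// mulr_ge0 ?exprn_ge0.
have y1 : 1 <= x^-1 by rewrite invf_ge1.
have y0 : 0 < x^-1 by rewrite invr_gt0.
rewrite normrM (ger0_norm (expR_ge0 _)) expRN ler_pdivrMr ?expR_gt0//.
apply: le_trans (h _ y1) _; rewrite -mulrA -mulrA ler_wpM2l//.
have h1 := ler_wpM2r (sqr_ge0 x) (expR_bound n.+2 (ltW y0)).
have e : x^-1 ^+ n.+2 * x ^+ 2 = x^-1 ^+ n.
  by rewrite -[n.+2]addn2 exprD -mulrA -exprMn mulVf ?gt_eqF// expr1n mulr1.
rewrite e in h1; apply: le_trans h1 _.
by rewrite le_eqVlt; apply/orP; left; apply/eqP; ring.
Qed.

Lemma is_derive_flat p (x : R) : is_derive x 1 (flat p) (flat ('X^2 * (p - p^`())) x).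
Proof.
have [x0|x0|->] := ltgtP x 0.
- rewrite [X in is_derive _ _ _ X](_ : _ = 0); last by rewrite /flat ltNge (ltW x0).
  apply: (near_eq_is_derive (f := fun=> 0)).
  near=> y; rewrite /flat ifF//; apply/negbTE; rewrite -leNgt ltW//.
  by near: y; exact: lt_nbhsl.
- have dV : is_derive x 1 (fun y : R => y^-1) (- x ^- 2).
    have := @is_deriveV R id x 1 1 _ (is_derive_id _ _).
    by rewrite /GRing.scale/= mulr1; apply; rewrite gt_eqF.
  have dNV : is_derive x 1 (fun y : R => - y^-1) (x ^- 2).
    by rewrite -[x ^- 2]opprK; exact: (is_deriveN dV).
  have d1 : is_derive x 1 (fun y : R => p.[y^-1]) (p^`().[x^-1] * (- x ^- 2)).
    exact: (@is_derive1_comp _ (horner p) (fun y => y^-1)).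
  have d2 : is_derive x 1 (fun y : R => expR (- y^-1)) (expR (- x^-1) * x ^- 2).
    exact: (@is_derive1_comp _ expR (fun y => - y^-1)).
  have := is_deriveM d1 d2.
  rewrite [X in is_derive _ _ _ X -> _](_ : _ = flat ('X^2 * (p - p^`())) x); last first.
    rewrite /flat x0 hornerM hornerXn hornerD hornerN /GRing.scale/= exprVn.
    ring.
  apply: near_eq_is_derive; near=> y; rewrite /flat ifT//.
  by near: y; exact: lt_nbhsr.
- rewrite [X in is_derive _ _ _ X](_ : _ = 0); last by rewrite /flat ltxx.
  have [D D0 hD] := flat_bound p.
  have lim : h^-1 *: (flat p (h *: 1 + 0) - flat p 0) @[h --> 0^'] --> (0 : R).
    apply/cvgrPdist_le => e e0; near=> h.
    have h0 : h != 0 by near: h; exact: nbhs_dnbhs_neq.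
    have h1 : `|h| <= 1 by near: h; apply: dnbhs0_le.
    have he : `|h| <= e / (D + 1) by near: h; apply: dnbhs0_le; rewrite divr_gt0// ltr_wpDl.
    rewrite sub0r normrN addr0 {2}/flat ltxx subr0 /GRing.scale/= mulr1 normrM normfV.
    rewrite ler_pdivrMl ?normr_gt0//.
    apply: le_trans (hD _ (le_trans (ler_norm _) h1)) _.
    rewrite -real_normK ?num_real// expr2 mulrA (mulrC `|h| e) ler_wpM2r//.
    move: he; rewrite ler_pdivlMr ?ltr_wpDl// => he; apply: le_trans he.
    by rewrite mulrC ler_wpM2l// lerDl.
  apply: DeriveDef; first by apply/cvg_ex; exists 0; exact: lim.
  by apply/cvg_lim => //; exact: lim.
Unshelve. all: by end_near. Qed.

Lemma smooth_flat p : smooth (flat p).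
Proof.
move=> n; elim: n p => [|n IH] p; first by split => // x; have [] := is_derive_flat p x.
by apply: (@dupto_derive _ _ (flat ('X^2 * (p - p^`())))) => // x; exact: is_derive_flat.
Qed.

End Smooth.

Section Bump.
Context (R : realType).
Local Notation mu := (@lebesgue_measure R).
Local Notation intg D f := (mu.-integrable D (EFin \o f)).

Definition bump (x : R) : R := flat 1 (1 * x + 1) * flat 1 ((-1) * x + 1).

Lemma flat1E (x : R) : flat 1 x = if 0 < x then expR (- x^-1) else 0.
Proof. by rewrite /flat hornerC mul1r. Qed.

Lemma flat1_itv (x : R) : 0 <= flat 1 x <= 1.
Proof.
rewrite flat1E; case: ifPn => [x0|_]; last by rewrite lexx ler01.
by rewrite expR_ge0/= -expR0 ler_expR oppr_le0 invr_ge0 ltW.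
Qed.

Lemma bump_ge0 x : 0 <= bump x.
Proof. by rewrite mulr_ge0//; have /andP[] := flat1_itv (1 * x + 1); have /andP[] := flat1_itv (-1 * x + 1). Qed.

Lemma bump_le1 x : bump x <= 1.
Proof.
have /andP[a b] := flat1_itv (1 * x + 1); have /andP[c d] := flat1_itv (-1 * x + 1).
by rewrite -[leRHS]mulr1; exact: ler_pM.
Qed.

Lemma bump_gt0 x : `|x| < 1 -> 0 < bump x.
Proof.
rewrite ltr_norml => /andP[a b].
by rewrite /bump !flat1E !ifT ?mulr_gt0 ?expR_gt0//; lra.
Qed.

Lemma bump_eq0 x : 1 <= `|x| -> bump x = 0.
Proof.
rewrite /bump !flat1E ler_normr => /orP[x1|x1].
  by rewrite [X in _ * X]ifF ?mulr0//; apply/negbTE; rewrite -leNgt; lra.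
by rewrite ifF ?mul0r//; apply/negbTE; rewrite -leNgt; lra.
Qed.

Lemma smooth_bump : smooth bump.
Proof. by move=> n; apply: dupto_mul; apply: dupto_affine; exact: smooth_flat. Qed.

Lemma continuous_bump : continuous bump.
Proof.
move=> x; apply/differentiable_continuous/derivable1_diffP.
by have [] := smooth_bump 0.
Qed.

Lemma intg_bump (A : set R) : measurable A -> intg A bump.
Proof.
move=> mA; apply: (@integrableS _ _ _ mu setT) => //.
have mI : measurable (`[-1, 1]%classic : set (measurableTypeR R)) by exact: measurable_itv.
rewrite (_ : EFin \o bump = (EFin \o bump) \_ `[-1, 1]).
  apply: (proj1 (integrable_mkcond _ mI)).
  apply: continuous_compact_integrable; first exact: segment_compact.
  by apply: continuous_subspaceT; exact: continuous_bump.
apply/funext => x; rewrite patchE mem_setE in_itv/= -ler_norml.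
by case: ifPn => //; rewrite -ltNge => /ltW x1; rewrite /= bump_eq0.
Qed.

(** A smooth step: the primitive of [bump], constant outside [[-1, 1]]. *)
Definition step (x : R) : R := \int[mu]_(t in `]-oo, x]) bump t.

Lemma is_derive_step (x : R) : is_derive x 1 step (bump x).
Proof.
have xu : x < x + 1 by rewrite ltrDl.
have bi : intg [set` Interval -oo%O (BRight (x + 1))] bump.
  by apply: intg_bump; exact: measurable_itv.
have [d1 d2] := continuous_FTC1 xu bi (ltNyr x) (@continuous_bump x).
split; first exact: d1.
by rewrite -derive1E; exact: d2.
Qed.

Lemma derive1_step : derive1 step = bump.
Proof. by apply/funext => x; rewrite derive1E; have [_ ->] := is_derive_step x. Qed.

Lemma smooth_step : smooth step.
Proof. by move=> n; apply: duptoS; apply: (dupto_derive is_derive_step (smooth_bump _)). Qed.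

Lemma step_left x : x <= -1 -> step x = 0.
Proof.
move=> x1; rewrite /step (@eq_Rintegral _ _ _ _ _ (fun=> 0)); first by rewrite /Rintegral integral0.
move=> t; rewrite mem_setE in_itv/= => tx; apply: bump_eq0.
by rewrite ler_normr; apply/orP; right; lra.
Qed.

Lemma step_AC a b : a < b -> AC a b step bump.
Proof.
move=> ab; rewrite -derive1_step; apply: AC_C1 => // x.
  by have [] := smooth_step 0.
by rewrite derive1_step; have [] := smooth_bump 0.
Qed.

Lemma step_right x : 1 <= x -> step x = step 1.
Proof.
rewrite le_eqVlt => /orP[/eqP<-//|x1].
have := AC_diff (step_AC x1) (lexx 1) (ltW x1) (lexx x).
rewrite (@eq_Rintegral _ _ _ _ _ (fun=> 0)); last first.
  move=> t; rewrite mem_setE in_itv/= => /andP[t1 _]; apply: bump_eq0.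
  by rewrite ler_normr t1.
by rewrite Rint_cst ?ltW// mul0r => /eqP; rewrite subr_eq0 => /eqP.
Qed.

Lemma step_gt0 : 0 < step 1.
Proof.
have c : continuous step.
  move=> x; apply/differentiable_continuous/derivable1_diffP.
  by have [] := smooth_step 0.
have [] := @MVT R step bump (-1) 1 _ (fun x _ => is_derive_step x) (continuous_subspaceT c).
  by lra.
move=> x; rewrite in_itv/= => x1; rewrite (step_left (lexx _)) subr0 => ->.
by rewrite mulr_gt0 ?bump_gt0 ?ltr_norml//; lra.
Qed.

(** Copies centred at [c] of width [d]. The affine map is written in the form
    that [dupto_affine] expects. *)
Definition bumpat (c d : R) (x : R) : R := bump (d^-1 * x + - (d^-1 * c)).
Definition stepat (c d : R) (x : R) : R := step (d^-1 * x + - (d^-1 * c)).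

Lemma atE (c d x : R) : d^-1 * x + - (d^-1 * c) = (x - c) / d.
Proof. by rewrite -mulrBr mulrC. Qed.

Lemma stepat_derive (c d x : R) : is_derive x 1 (stepat c d) (d^-1 * bumpat c d x).
Proof.
rewrite mulrC; apply: (@is_derive1_comp _ step (fun x => d^-1 * x + - (d^-1 * c)) x).
  exact: is_derive_step.
have : is_derive x 1 (fun x : R => d^-1 * x + - (d^-1 * c)) (d^-1 *: 1 + 0).
  by apply: is_deriveD; apply: is_deriveZ; exact: is_derive_id.
by rewrite addr0 /GRing.scale/= mulr1.
Qed.

Lemma smooth_stepat (c d : R) : smooth (stepat c d).
Proof. by move=> n; apply: dupto_affine; exact: smooth_step. Qed.

Lemma smooth_bumpat (c d : R) : smooth (bumpat c d).
Proof. by move=> n; apply: dupto_affine; exact: smooth_bump. Qed.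

Lemma bumpat_meas_bounded (a b c d : R) : measurable_fun `[a, b] (bumpat c d) /\
  [bounded bumpat c d x | x in `[a, b]%classic].
Proof.
split.
  apply: measurable_funS (_ : measurable_fun setT _) => //.
  apply: continuous_measurable_fun => x; apply/differentiable_continuous/derivable1_diffP.
  by have [] := smooth_bumpat c d 0.
exists 1; split; first exact: num_real.
by move=> y y1 x _ /=; rewrite ger0_norm ?bump_ge0// (le_trans (bump_le1 _))// ltW.
Qed.

(** A smoothed indicator function of [[c, c']]; its derivative is the difference of
    two bumps, which compares the values of a function near [c] and near [c']. *)
Lemma test_stepat a b c c' d : 0 < d -> a < c - d -> c < c' -> c' + d < b ->
  test_function a b (fun x => stepat c d x - stepat c' d x).
Proof.
move=> d0 ac cc' cb.
have sub : closure [set x | stepat c d x - stepat c' d x != 0] `<=` `[c - d, c' + d]%classic.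
  rewrite [X in _ `<=` X](closure_id _).1; last exact: itv_closed.
  apply: closureS => x /=; apply: contraNP => /negP.
  rewrite in_itv/= negb_and -!ltNge /stepat !atE => /orP[x1|x1].
    rewrite !step_left ?subrr// ler_pdivrMr//; lra.
  rewrite step_right; last by rewrite ler_pdivlMr//; lra.
  by rewrite [X in _ - X]step_right ?subrr// ler_pdivlMr//; lra.
split.
- move=> n x; apply: smooth_derive1n => k.
  have -> : (fun x => stepat c d x - stepat c' d x) = (fun x => stepat c d x + (-1) * stepat c' d x).
    by apply/funext => y; rewrite mulN1r.
  apply: dupto_add; first exact: smooth_stepat.
  by apply: dupto_mul; [exact: dupto_cst|exact: smooth_stepat].
- apply: subclosed_compact sub; first exact: closed_closure.
  exact: segment_compact.
- apply: (subset_trans sub) => x /=; rewrite !in_itv/= => /andP[x1 x2].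
  by rewrite (lt_le_trans ac x1) (le_lt_trans x2 cb).
Qed.

Lemma int_bumpat a b c d : 0 < d -> a < c - d -> c + d < b ->
  \int[mu]_(x in `[a, b]) bumpat c d x = d * step 1.
Proof.
move=> d0 ac cb; have ab : a < b by lra.
have dB x : derivable (stepat c d) x 1 by have [] := smooth_stepat c d 0.
have e : derive1 (stepat c d) = (fun x => d^-1 * bumpat c d x).
  by apply/funext => x; rewrite derive1E; have [_ ->] := stepat_derive c d x.
have dB' x : derivable (derive1 (stepat c d)) x 1 by have [_ []] := smooth_stepat c d 1.
have ACs := AC_C1 ab dB dB'.
have := AC_diff ACs (lexx a) (ltW ab) (lexx b).
have [fi _] := ACs; rewrite e in fi *.
have bi : intg `[a, b] (bumpat c d).
  rewrite (_ : bumpat c d = (fun x => d * (d^-1 * bumpat c d x))).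
    exact: (integrableZl _ d fi).
  by apply/funext => x; rewrite mulrA divff ?gt_eqF// mul1r.
rewrite (Rint_Z _ bi) /stepat !atE step_right; last by rewrite ler_pdivlMr//; lra.
rewrite [X in _ - X]step_left ?subr0; last by rewrite ler_pdivrMr//; lra.
by move=> ->; rewrite mulrA divff ?gt_eqF// mul1r.
Qed.

(** The bump is at most [1] and supported in the ball of radius [d], so the error
    is at most twice the mean deviation over this ball, which vanishes in the limit
    at a Lebesgue point. *)
Lemma bumpat_lebesgue_pt a b c (u : R -> R) : a < c -> c < b -> intg `[a, b] u ->
  lebesgue_pt (u \_ `[a, b]) c ->
  d^-1 * \int[mu]_(x in `[a, b]) (u x * bumpat c d x) @[d --> 0^'+] --> step 1 * u c.
Proof.
move=> ac cb ui up.
have ub : u c = (u \_ `[a, b]) c by rewrite patchE mem_setE in_itv/= !ltW.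
apply/cvgrPdist_le => e e0.
have e20 : (0 < e / 2)%R by rewrite divr_gt0.
move/fine_cvgP : up => [upf /cvgrPdist_le/(_ _ e20) up].
near=> d.
have d0 : 0 < d by near: d; exact: nbhs_right_gt.
have d1 : a < c - d.
  rewrite ltrBrDr addrC -ltrBrDr; near: d; apply: nbhs_right_lt; lra.
have d2 : c + d < b.
  rewrite addrC -ltrBrDr; near: d; apply: nbhs_right_lt; lra.
have h1 : `|0 - fine (davg (u \_ `[a, b]) c d)| <= e / 2 by near: d; exact: up.
have h2 : davg (u \_ `[a, b]) c d \is a fin_num by near: d; exact: upf.
have [mB bB] := bumpat_meas_bounded a b c d.
have i1 : intg `[a, b] (fun x => u x * bumpat c d x) by exact: (integrableMl _ ui mB bB).
have i2 : intg `[a, b] (fun x => u c * bumpat c d x).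
  exact: (integrableMl _ (intg_cst a b (u c)) mB bB).
have i0 : intg `[a, b] (fun x => u x - u c).
  exact: (integrableB _ ui (intg_cst a b (u c))).
have i3 : intg `[a, b] (fun x => (u x - u c) * bumpat c d x).
  exact: (integrableMl _ i0 mB bB).
have bi : intg `[a, b] (bumpat c d).
  rewrite (_ : bumpat c d = (fun x => 1 * bumpat c d x)).
    exact: (integrableMl _ (intg_cst a b 1) mB bB).
  by apply/funext => x; rewrite mul1r.
have -> : step 1 * u c - d^-1 * \int[mu]_(x in `[a, b]) (u x * bumpat c d x) =
   - (d^-1 * \int[mu]_(x in `[a, b]) ((u x - u c) * bumpat c d x)).
  have -> : \int[mu]_(x in `[a, b]) ((u x - u c) * bumpat c d x) =
     \int[mu]_(x in `[a, b]) (u x * bumpat c d x - u c * bumpat c d x).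
    by apply: eq_Rintegral => x _; rewrite mulrBl.
  rewrite (Rint_B i1 i2) (Rint_Z _ bi) int_bumpat//; field; lra.
rewrite normrN normrM gtr0_norm ?invr_gt0// ler_pdivrMl//.
apply: le_trans (le_normr_Rintegral _ i3) _ => //.
rewrite -lee_fin -intg_fin//; last exact: (integrable_norm i3).
have bdm : measurable (ball c d : set (measurableTypeR R)) by exact: measurable_ball.
have mI : measurable (`[a, b]%classic : set (measurableTypeR R)) by exact: measurable_itv.
have mut : measurable_fun setT (u \_ `[a, b]).
  apply/(measurable_restrictT _ _).1 => //.
  by have [/measurable_EFinP] := integrableP _ _ _ ui.
have le : (\int[mu]_(y in ball c d) `|((u \_ `[a, b]) y - u c)%:E| <= (d * e)%:E)%E.
  move: h1; rewrite sub0r normrN ger0_norm ?fine_ge0 ?davg_ge0// => h1.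
  have : (davg (u \_ `[a, b]) c d <= (e / 2)%:E)%E by rewrite -(fineK h2) lee_fin.
  rewrite /davg /iavg/= -ub lebesgue_measure_ball ?(ltW d0)//.
  rewrite inver mulrn_eq0/= gt_eqF//= lee_pdivrMl ?mulrn_wgt0//.
  by rewrite -EFinM (_ : d *+ 2 * (e / 2) = d * e)//; field.
apply: le_trans le; rewrite integral_mkcond [leRHS]integral_mkcond.
apply: ge0_le_integral => //.
- by move=> x _; rewrite patchE; case: ifP => // _; rewrite lee_fin.
- apply/(measurable_restrictT _ _).1 => //.
  by apply/measurable_EFinP/measurableT_comp => //; have [/measurable_EFinP] := integrableP _ _ _ i3.
- apply/(measurable_restrictT _ _).1 => //; apply: measurable_funTS.
  do 2 apply: measurableT_comp => //; exact: measurable_funB.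
- move=> x _; rewrite !patchE; case: ifPn => xab; last by case: ifP => // _; rewrite lee_fin.
  case: ifPn => xB.
    by rewrite lee_fin ?xab normrM ler_piMr// ger0_norm ?bump_ge0// bump_le1.
  rewrite /bumpat atE bump_eq0 ?mulr0 ?normr0// normrM normfV (gtr0_norm d0).
  rewrite ler_pdivlMr// mul1r leNgt; apply: contra xB => xd.
  by rewrite inE/ball/= distrC.
Unshelve. all: by end_near. Qed.

End Bump.

Section WeakDerivative.
Context (R : realType).
Local Notation mu := (@lebesgue_measure R).
Local Notation intg D f := (mu.-integrable D (EFin \o f)).
Implicit Types (a b : R) (u f g : R -> R).

(** Test with a smoothed indicator of [[c1, c2]] and let the smoothing width tend
    to zero: [u] takes the same value at any two Lebesgue points. *)
Lemma du_bois_reymond a b u : a < b -> intg `[a, b] u ->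
  (forall phi, test_function a b phi ->
     \int[mu]_(x in `[a, b]) (u x * derive1 phi x) = 0) ->
  exists k, {ae mu, forall x, x \in `]a, b[ -> u x = k}.
Proof.
move=> ab ui u0.
have mI : measurable (`[a, b]%classic : set (measurableTypeR R)) by exact: measurable_itv.
have lp := lebesgue_differentiation (integrable_locally mI ui).
have [c [ca cb cl]] : exists c, [/\ a < c, c < b & lebesgue_pt (u \_ `[a, b]) c].
  apply: contrapT => /forallNP nc.
  have [N [mN N0 sN]] := lp.
  have : (mu `]a, b[ <= mu N)%E.
    apply: le_measure; rewrite ?inE//.
    move=> x /=; rewrite in_itv/= => /andP[xa xb]; apply: (sN x) => h.
    by apply: (nc x).
  rewrite N0 lebesgue_measure_itv/= lte_fin ab -EFinD lee_fin; lra.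
have key c1 c2 : a < c1 -> c1 < c2 -> c2 < b -> lebesgue_pt (u \_ `[a, b]) c1 ->
    lebesgue_pt (u \_ `[a, b]) c2 -> u c1 = u c2.
  move=> a1 c12 b2 l1 l2.
  have h1 := bumpat_lebesgue_pt a1 (lt_trans c12 b2) ui l1.
  have h2 := bumpat_lebesgue_pt (lt_trans a1 c12) b2 ui l2.
  have s0 := step_gt0 R.
  suff : step 1 * u c1 = step 1 * u c2 by apply: mulfI; rewrite gt_eqF.
  apply: (cvg_unique (Rhausdorff (R := R)) h1); apply: cvg_trans h2.
  apply: near_eq_cvg; near=> d.
  have d0 : 0 < d by near: d; exact: nbhs_right_gt.
  have d1 : a < c1 - d.
    rewrite ltrBrDr addrC -ltrBrDr; near: d; apply: nbhs_right_lt; lra.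
  have d2 : c2 + d < b.
    rewrite addrC -ltrBrDr; near: d; apply: nbhs_right_lt; lra.
  have := u0 _ (test_stepat d0 d1 c12 d2).
  have -> : derive1 (fun x => stepat c1 d x - stepat c2 d x) =
      (fun x => d^-1 * bumpat c1 d x - d^-1 * bumpat c2 d x).
    apply/funext => x; rewrite derive1E.
    by have [_ ->] := is_deriveB (stepat_derive c1 d x) (stepat_derive c2 d x).
  have bi c' : intg `[a, b] (fun x => u x * bumpat c' d x).
    have [mB bB] := bumpat_meas_bounded a b c' d.
    exact: (integrableMl _ ui mB bB).
  have bi' c' : intg `[a, b] (fun x => d^-1 * (u x * bumpat c' d x)).
    exact: (integrableZl _ _ (bi c')).
  have -> : \int[mu]_(x in `[a, b])
      (u x * (d^-1 * bumpat c1 d x - d^-1 * bumpat c2 d x)) =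
    \int[mu]_(x in `[a, b])
      (d^-1 * (u x * bumpat c1 d x) - d^-1 * (u x * bumpat c2 d x)).
    by apply: eq_Rintegral => x _; rewrite mulrBr !(mulrCA (u _)).
  rewrite (Rint_B (bi' c1) (bi' c2)) (Rint_Z _ (bi c1)) (Rint_Z _ (bi c2)).
  by move=> /subr0_eq /esym.
exists (u c); apply: mu_aeS lp => x xl; rewrite in_itv/= => /andP[ax xb].
by have [xc|xc|->//] := ltgtP x c; [|apply/esym]; exact: key.
Unshelve. all: by end_near. Qed.

Lemma test_AC a b phi : a < b -> test_function a b phi ->
  [/\ AC a b phi (derive1 phi), phi a = 0 & phi b = 0].
Proof.
move=> ab [sm _ sub]; split.
- by apply: AC_C1 => // x; [exact: (sm 0%N)|exact: (sm 1%N)].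
- apply/eqP/negPn/negP => /(@subset_closure _ [set x | phi x != 0]) /sub /=.
  by rewrite in_itv/= ltxx.
- apply/eqP/negPn/negP => /(@subset_closure _ [set x | phi x != 0]) /sub /=.
  by rewrite in_itv/= ltxx andbF.
Qed.

Lemma AC_weak a b F f phi : a < b -> AC a b F f -> test_function a b phi ->
  \int[mu]_(x in `[a, b]) (F x * derive1 phi x) =
  - \int[mu]_(x in `[a, b]) (f x * phi x).
Proof.
move=> ab ACF tphi; have [ACp pa pb] := test_AC ab tphi.
have h := AC_diff (AC_mul (ltW ab) ACF ACp) (lexx a) (ltW ab) (lexx b).
have [mF bF] := continuous_bounded_meas (ltW ab) (AC_continuous (ltW ab) ACF).
have [mp bp] := continuous_bounded_meas (ltW ab) (AC_continuous (ltW ab) ACp).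
have [fi _] := ACF; have [pi _] := ACp.
have i1 : intg `[a, b] (fun x => f x * phi x) by exact: (integrableMl _ fi mp bp).
have i2 : intg `[a, b] (fun x => F x * derive1 phi x).
  rewrite (_ : (fun x => _) = (fun x => derive1 phi x * F x)).
    exact: (integrableMl _ pi mF bF).
  by apply/funext => x; rewrite mulrC.
move: h; rewrite pa pb !mulr0 subrr (Rint_D i1 i2); lra.
Qed.

(** Subtract from [f] a primitive of its weak derivative; the difference has weak
    derivative zero. *)
Lemma weak_AC a b f g : a < b -> intg `[a, b] f -> intg `[a, b] g ->
  (forall phi, test_function a b phi ->
    \int[mu]_(x in `[a, b]) (f x * derive1 phi x) =
    - \int[mu]_(x in `[a, b]) (g x * phi x)) ->
  exists2 F, AC a b F g & {ae mu, forall x, x \in `]a, b[ -> f x = F x}.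
Proof.
move=> ab fi gi w.
pose F0 x := 0 + \int[mu]_(t in `[a, x]) g t.
have AC0 : AC a b F0 g by exact: AC_prim.
have [mF bF] := continuous_bounded_meas (ltW ab) (AC_continuous (ltW ab) AC0).
have F0i : intg `[a, b] F0.
  apply: measurable_bounded_integrable => //.
  by rewrite [X in (X < _)%E](mu_itv (ltW ab)) ltry.
have ui : intg `[a, b] (fun x => f x - F0 x) by exact: (integrableB _ fi F0i).
have [phi tphi|k hk] := du_bois_reymond ab ui.
  have [ACp _ _] := test_AC ab tphi.
  have mp : measurable_fun `[a, b] (derive1 phi) := AC_meas ACp.
  have bp : [bounded derive1 phi x | x in `[a, b]%classic].
    apply: (proj2 (@continuous_bounded_meas R a b (derive1 phi) (ltW ab) _)).
    apply: continuous_subspaceT => x; apply/differentiable_continuous/derivable1_diffP.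
    by have [sm _ _] := tphi; exact: (sm 1%N).
  have i1 : intg `[a, b] (fun x => f x * derive1 phi x) by exact: (integrableMl _ fi mp bp).
  have i2 : intg `[a, b] (fun x => F0 x * derive1 phi x) by exact: (integrableMl _ F0i mp bp).
  rewrite -[RHS](subrr (\int[mu]_(x in `[a, b]) (F0 x * derive1 phi x))).
  rewrite [X in _ = X - _](AC_weak ab AC0 tphi) -(w _ tphi) -(Rint_B i1 i2).
  by apply: eq_Rintegral => x _; rewrite mulrBl.
exists (fun x => k + \int[mu]_(t in `[a, x]) g t); first exact: AC_prim.
by apply: mu_aeS hk => x h xab; rewrite -(h xab) /F0 add0r subrK.
Qed.

End WeakDerivative.

(** * Completeness of the real square integrable functions *)

Section RieszFischer.
Context (R : realType).
Local Notation mu := (@lebesgue_measure R).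
Local Notation intg D f := (mu.-integrable D (EFin \o f)).
Implicit Types (a b : R) (f g : R -> R).

(** Measurability is asked on the whole line, as for the representatives of classes
    of square integrable functions. *)
Definition sqint a b f :=
  measurable_fun setT f /\ intg `[a, b] (fun x => f x ^+ 2).

Lemma intg_le a b f g : measurable_fun setT f ->
  (forall x, `|f x| <= g x) -> intg `[a, b] g -> intg `[a, b] f.
Proof.
move=> mf fg; apply: le_integrable => //.
  by apply/measurable_EFinP; exact: measurable_funS mf.
by move=> x _; rewrite /= lee_fin (le_trans (fg x))// ler_norm.
Qed.

Lemma sqint_mul a b f g : sqint a b f -> sqint a b g -> intg `[a, b] (fun x => f x * g x).
Proof.
move=> [mf fi] [mg gi].
apply: (@intg_le a b _ (fun x => f x ^+ 2 + g x ^+ 2)).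
- exact: measurable_funM.
- move=> x; rewrite ler_norml; apply/andP.
  have := sqr_ge0 (f x + g x); have := sqr_ge0 (f x - g x).
  by have := sqr_ge0 (f x); have := sqr_ge0 (g x); rewrite sqrrB sqrrD; split; lra.
- exact: (integrableD _ fi gi).
Qed.

Lemma sqint_cst a b (r : R) : sqint a b (fun=> r).
Proof. by split; [exact: measurable_cst|exact: intg_cst]. Qed.

Lemma sqint_intg a b f : sqint a b f -> intg `[a, b] f.
Proof.
move=> sf; rewrite (_ : f = (fun x => f x * 1)); first exact: (sqint_mul sf (sqint_cst _ _ _)).
by apply/funext => x; rewrite mulr1.
Qed.

Lemma sqint_lin a b (r : R) f g : sqint a b f -> sqint a b g ->
  sqint a b (fun x => r * f x + g x).
Proof.
move=> sf sg; have [mf fi] := sf; have [mg gi] := sg; split.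
  by apply: measurable_funD => //; apply: measurable_funM.
rewrite (_ : (fun x => _) = (fun x => (r ^+ 2 * f x ^+ 2 + (2 * r) * (f x * g x)) + g x ^+ 2)).
  have fg := sqint_mul sf sg.
  have i1 : intg `[a, b] (fun x => r ^+ 2 * f x ^+ 2) by exact: (integrableZl _ _ fi).
  have i2 : intg `[a, b] (fun x => (2 * r) * (f x * g x)) by exact: (integrableZl _ _ fg).
  have i3 : intg `[a, b] (fun x => r ^+ 2 * f x ^+ 2 + (2 * r) * (f x * g x)) by exact: (integrableD _ i1 i2).
  exact: (integrableD _ i3 gi).
by apply/funext => x; ring.
Qed.

Lemma sqintB a b f g : sqint a b f -> sqint a b g -> sqint a b (fun x => f x - g x).
Proof.
move=> sf sg; rewrite (_ : (fun x => _) = (fun x => (-1) * g x + f x)); first exact: sqint_lin.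
by apply/funext => x; rewrite mulN1r addrC.
Qed.

Lemma sqintD a b f g : sqint a b f -> sqint a b g -> sqint a b (fun x => f x + g x).
Proof.
move=> sf sg; rewrite (_ : (fun x => _) = (fun x => 1 * f x + g x)); first exact: sqint_lin.
by apply/funext => x; rewrite mul1r.
Qed.

Lemma sqint_ae a b f g : measurable_fun setT g ->
  {ae mu, forall x, x \in `]a, b[ -> f x = g x} -> sqint a b f -> sqint a b g.
Proof.
move=> mg /ae_itvoc fg [mf fi]; split => //.
apply: intg_ae fi => //.
  by apply: measurable_funX; exact: measurable_funS mg.
by apply: mu_aeS fg => x h xab; rewrite h//; rewrite mem_setE in xab.
Qed.

Lemma Rint_ae a b f g : measurable_fun `[a, b] f -> measurable_fun `[a, b] g ->
  {ae mu, forall x, x \in `]a, b[ -> f x = g x} ->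
  \int[mu]_(x in `[a, b]) f x = \int[mu]_(x in `[a, b]) g x.
Proof.
move=> mf mg /ae_itvoc fg; apply: ae_eq_Rintegral => //.
by apply: mu_aeS fg => x h xab; apply: h; rewrite mem_setE in xab.
Qed.

(** The increments have summable norms, so their series converges absolutely almost
    everywhere. *)
Lemma L1_cauchy_ae_cvg a b (r : nat -> R -> R) : (forall k, intg `[a, b] (r k)) ->
  (forall k, measurable_fun setT (r k)) ->
  (forall k, \int[mu]_(x in `[a, b]) `|r k.+1 x - r k x| <= 2 ^- k) ->
  {ae mu, forall x, x \in `[a, b] -> cvgn (fun k => r k x)}.
Proof.
move=> ri mr rk.
pose g k x := `|r k.+1 x - r k x|.
have gi k : intg `[a, b] (g k).
  exact: (integrable_norm (integrableB _ (ri k.+1) (ri k))).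
have mg k : measurable_fun `[a, b] (EFin \o g k) by case/integrableP: (gi k).
have g0 k x : (0 <= (EFin \o g k) x)%E by rewrite lee_fin /g.
have fin : (\int[mu]_(x in `[a, b]) \sum_(0 <= k <oo) (EFin \o g k) x < +oo)%E.
  rewrite integral_nneseries//.
  apply: (@le_lt_trans _ _ 2%:E); last exact: ltry.
  have le k : (\int[mu]_(x in `[a, b]) (EFin \o g k) x <= (2 ^- k)%:E)%E.
    by rewrite intg_fin// lee_fin; exact: rk.
  have c : cvgn (fun n => \sum_(0 <= k < n) \int[mu]_(x in `[a, b]) (EFin \o g k) x)%E.
    by apply: is_cvg_nneseries => k _ _; exact: integral_ge0.
  apply: lime_le => //; apply: nearW => n.
  apply: (@le_trans _ _ (\sum_(0 <= k < n) (2 ^- k)%:E)%E); first exact: lee_sum.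
  rewrite sumEFin lee_fin.
  suff : \sum_(0 <= k < n) 2 ^- k = 2 - 2 * 2 ^- n :> R.
    by move=> ->; rewrite gerBl mulr_ge0// invr_ge0 exprn_ge0.
  elim: n => [|n IH]; first by rewrite big_geq// expr0 invr1 mulr1 subrr.
  by rewrite big_nat_recr//= IH exprS; field; rewrite expf_neq0.
have si : mu.-integrable `[a, b] (fun x => \sum_(0 <= k <oo) (EFin \o g k) x)%E.
  have ms : measurable_fun `[a, b] (fun x => \sum_(0 <= k <oo) (EFin \o g k) x)%E.
    by apply: ge0_emeasurable_sum.
  apply/integrableP; split => //.
  apply: le_lt_trans fin; apply: ge0_le_integral => //.
  - exact: measurableT_comp.
  - by move=> x _; rewrite gee0_abs//; exact: nneseries_ge0.
have := @integrable_ae _ _ _ mu _ (measurable_itv _) _ si.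
apply: mu_aeS => x h xab; have {}h := h xab.
pose d k := r k.+1 x - r k x.
have cd : cvgn (series d).
  apply: (@normed_cvg R R^o d).
  apply: nondecreasing_is_cvgn.
    by apply: nondecreasing_series => k _ _; exact: normr_ge0.
  exists (fine (\sum_(0 <= k <oo) (EFin \o g k) x)%E) => _ [n _ <-].
  rewrite -lee_fin fineK// /series/= -sumEFin.
  exact: nneseries_lim_ge.
have e : (fun k => r k x) = (fun k => r 0%N x + series d k).
  by apply/funext => k; rewrite {1}(eq_sum_telescope (fun k => r k x) k).
by rewrite e; apply: is_cvgD => //; exact: is_cvg_cst.
Qed.

(** The almost everywhere limit is the limit in the mean square, by Fatou's lemma. *)
Lemma riesz_fischer a b (r : nat -> R -> R) : a <= b -> b - a <= 1 ->
  (forall k, sqint a b (r k)) ->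
  (forall k m, (k <= m)%N ->
    \int[mu]_(x in `[a, b]) ((r m x - r k x) ^+ 2) <= (2 ^- k) ^+ 2) ->
  exists2 f, sqint a b f &
    forall k, \int[mu]_(x in `[a, b]) ((f x - r k x) ^+ 2) <= (2 ^- k) ^+ 2.
Proof.
move=> ab ba sr rk.
have mI : measurable (`[a, b]%classic : set (measurableTypeR R)) by exact: measurable_itv.
have mr k : measurable_fun setT (r k) by have [] := sr k.
have cv : {ae mu, forall x, x \in `[a, b] -> cvgn (fun k => r k x)}.
  apply: L1_cauchy_ae_cvg => // [k|k]; first exact: sqint_intg.
  have sd := sqintB (sr k.+1) (sr k).
  rewrite -(ler_pXn2r (n := 2))// ?nnegrE ?invr_ge0 ?exprn_ge0//; last first.
    by apply: Rint_ge0 => x.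
  apply: le_trans (rk _ _ (leqnSn k)).
  have sdi : intg `[a, b] (fun x => `|r k.+1 x - r k x|) := integrable_norm (sqint_intg sd).
  have e : (fun x => `|r k.+1 x - r k x| ^+ 2) = (fun x => (r k.+1 x - r k x) ^+ 2).
    by apply/funext => x; rewrite real_normK ?num_real.
  have := @Rint_sqr_le R a b (fun x => `|r k.+1 x - r k x|) ab ba sdi.
  by rewrite e; apply; have [] := sd.
have [N [mN N0 sN]] := cv.
(* Setting every [r k] to zero on the exceptional set makes the sequence converge
   everywhere, and its limit measurable. *)
pose E := `[a, b]%classic `\` N.
have mE : measurable (E : set (measurableTypeR R)) by exact: measurableD.
pose rt k := r k \_ E.
have mrt k : measurable_fun setT (rt k).
  apply/(measurable_restrictT _ _).1 => //; exact: measurable_funS (mr k).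
have rtE k : {ae mu, forall x, x \in `]a, b[ -> r k x = rt k x}.
  exists N; split => // x /= /not_implyP[xab h]; apply: contrapT => nN; apply: h.
  rewrite /rt patchE ifT// inE; split => //=.
  by move: xab; rewrite !in_itv/= => /andP[/ltW-> /ltW->].
have srt k : sqint a b (rt k) by exact: sqint_ae (rtE k) (sr k).
have crt x : cvgn (fun k => rt k x).
  have [xE|xE] := boolP (x \in E).
    rewrite (_ : (fun k => _) = (fun k => r k x)); last first.
      by apply/funext => k; rewrite /rt patchE xE.
    move: xE; rewrite inE => -[xab xN]; apply: contrapT => nc; apply/xN/sN => /= h.
    exact/nc/h.
  rewrite (_ : (fun k => _) = (fun k => 0)); first exact: is_cvg_cst.
  by apply/funext => k; rewrite /rt patchE (negbTE xE).
pose f x := limn (fun k => rt k x).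
have mf : measurable_fun setT f.
  by apply: (measurable_fun_cvg mrt) => x _; exact: crt.
have key k : (\int[mu]_(x in `[a, b]) ((f x - rt k x) ^+ 2)%:E <= ((2 ^- k) ^+ 2)%:E)%E.
  pose h m x := ((rt (m + k)%N x - rt k x) ^+ 2)%:E.
  have mh m : measurable_fun `[a, b] (h m).
    apply/measurable_EFinP; apply: measurable_funX; apply: measurable_funB;
      exact: measurable_funS (mrt _).
  have h0 m x : `[a, b]%classic x -> (0 <= h m x)%E by rewrite lee_fin sqr_ge0.
  have := fatou mu mI mh h0.
  have -> : (\int[mu]_(x in `[a, b]) limn_einf (h ^~ x) =
      \int[mu]_(x in `[a, b]) ((f x - rt k x) ^+ 2)%:E)%E.
    apply: eq_integral => x _.
    have c : (h ^~ x) @ \oo --> ((f x - rt k x) ^+ 2)%:E.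
      apply/cvg_EFin; first by near=> m.
      have c1 : rt (m + k)%N x @[m --> \oo] --> f x.
        by move: (crt x); rewrite -(cvg_shiftn k).
      rewrite expr2; apply: cvgM; apply: cvgB => //; exact: cvg_cst.
    by have [-> _] := cvg_limn_einf_sup c.
  move=> /le_trans; apply; rewrite limn_einf_lim; apply: lime_le; first exact: is_cvg_einfs.
  apply: nearW => m; apply: (@le_trans _ _ (\int[mu]_(x in `[a, b]) h m x)%E).
    by apply: ereal_inf_lbound; exists m => /=.
  have -> : (\int[mu]_(x in `[a, b]) h m x =
     (\int[mu]_(x in `[a, b]) ((r (m + k)%N x - r k x) ^+ 2))%:E)%E.
    have [_ si] := sqintB (srt (m + k)%N) (srt k).
    rewrite /h intg_fin//; congr (_%:E); apply: Rint_ae.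
    - by apply/measurable_EFinP; case/integrableP: si.
    - by have [_ /integrableP[/measurable_EFinP]] := sqintB (sr (m + k)%N) (sr k).
    - by apply: mu_aeS2 (rtE (m + k)%N) (rtE k) => x h1 h2 xab; rewrite h1// h2.
  by rewrite lee_fin rk// leq_addl.
have sfr k : sqint a b (fun x => f x - rt k x).
  split; first exact: measurable_funB.
  apply/integrableP; split.
    apply/measurable_EFinP; apply: measurable_funX; apply: measurable_funB.
      exact: measurable_funS mf.
    exact: measurable_funS (mrt k).
  apply: le_lt_trans (ltry _); apply: le_trans (key k).
  rewrite le_eqVlt; apply/orP; left; apply/eqP; apply: eq_integral => x _.
  by rewrite gee0_abs// lee_fin sqr_ge0.
have sf : sqint a b f.
  rewrite (_ : f = (fun x => f x - rt 0%N x + rt 0%N x)); first exact: sqintD.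
  by apply/funext => x; rewrite subrK.
exists f => // k; rewrite -lee_fin; apply: le_trans (key k).
have [_ si] := sqintB sf (sr k); have [_ sit] := sfr k.
rewrite intg_fin// lee_fin le_eqVlt; apply/orP; left; apply/eqP; apply: Rint_ae.
- by apply/measurable_EFinP; case/integrableP: si.
- by apply/measurable_EFinP; case/integrableP: sit.
- by apply: mu_aeS (rtE k) => x h xab; rewrite h.
Unshelve. all: by end_near. Qed.

End RieszFischer.

(** * The Hilbert space structure of L2 and of products *)

Section L2Hilbert.
Context (R : realType) (a b : R).
Hypothesis ab : a < b.
Hypothesis ba1 : b - a <= 1.
Local Notation mu := (@lebesgue_measure R).
Local Notation intg D f := (mu.-integrable D (EFin \o f)).
Local Notation L := (L2itv a b).
Implicit Types (u v w : L) (f : R -> R[i]).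

Definition reL u (x : R) : R := complex.Re (L2rep u x).
Definition imL u (x : R) : R := complex.Im (L2rep u x).

Lemma ReIm_eq (z z' : R[i]) : complex.Re z = complex.Re z' ->
  complex.Im z = complex.Im z' -> z = z'.
Proof. by case: z z' => [x y] [x' y'] /= -> ->. Qed.

Lemma normc_sqr (z : R[i]) : Normc.normc z ^+ 2 = complex.Re z ^+ 2 + complex.Im z ^+ 2.
Proof. by case: z => x y /=; rewrite sqr_sqrtr// addr_ge0 ?sqr_ge0. Qed.

Lemma Lnorm_cabs f : cmeasurable f ->
  ('N[leb a b]_2%:E[EFin \o cabs f] `^ 2 =
   \int[mu]_(x in `[a, b]) ((complex.Re (f x)) ^+ 2 + (complex.Im (f x)) ^+ 2)%:E)%E.
Proof.
move=> mf; rewrite poweR_Lnorm ?pnatr_eq0//.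
have [mr mi] := mf.
have pt x : (`|(EFin \o cabs f) x| `^ 2)%E =
    ((complex.Re (f x)) ^+ 2 + (complex.Im (f x)) ^+ 2)%:E.
  transitivity (`|cabs f x| `^ 2)%:E; first by [].
  by rewrite powR_mulrn// real_normK ?num_real// /cabs normc_sqr.
under eq_integral do rewrite pt.
apply: leb_integral.
by apply/measurable_EFinP; apply: measurable_funD; apply: measurable_funX.
Qed.

Lemma cLfun2_sqint f : f \in cLfun (leb a b) 2%:E <->
  sqint a b (fun x => complex.Re (f x)) /\ sqint a b (fun x => complex.Im (f x)).
Proof.
have ge0 (g : R -> R[i]) x : (0 <= ((complex.Re (g x)) ^+ 2 + (complex.Im (g x)) ^+ 2 : R)%:E)%E.
  by rewrite lee_fin addr_ge0 ?sqr_ge0.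
split=> [/cLfunP[mf]|[[mr sr] [mi si]]].
  rewrite /finite_norm => fin; have e := Lnorm_cabs mf; have [mr mi] := mf.
  have i : intg `[a, b] (fun x => (complex.Re (f x)) ^+ 2 + (complex.Im (f x)) ^+ 2).
    apply/integrableP; split.
      apply/measurable_EFinP; apply: (measurable_funS (E := setT)) => //.
      by apply: measurable_funD; apply: measurable_funX.
    under eq_integral => x _ do rewrite (gee0_abs (ge0 f x)).
    by rewrite -e; apply: poweR_lty.
  split; split => //; apply: intg_le i; try exact: measurable_funX.
    by move=> x; rewrite ger0_norm ?sqr_ge0// lerDl sqr_ge0.
  by move=> x; rewrite ger0_norm ?sqr_ge0// lerDr sqr_ge0.
have mf : cmeasurable f by split.
apply/cLfunP; split => //; rewrite /finite_norm.
have e := Lnorm_cabs mf.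
have fin : ('N[leb a b]_2%:E[EFin \o cabs f] `^ 2 < +oo)%E.
  have i : intg `[a, b] (fun x => (complex.Re (f x)) ^+ 2 + (complex.Im (f x)) ^+ 2).
    exact: (integrableD _ sr si).
  rewrite e; have /integrableP[_] := i.
  by under eq_integral => x _ do rewrite (gee0_abs (ge0 f x)).
move: fin; case: ('N[_]__[_])%E (Lnorm_ge0 (leb a b) 2%:E (EFin \o cabs f)) => [r _ _|_|//].
  exact: ltry.
by rewrite poweRyr// pnatr_eq0.
Qed.

Lemma sqint_reL u : sqint a b (reL u).
Proof. by have /cLfun2_sqint[] := L2funP (repr u). Qed.

Lemma sqint_imL u : sqint a b (imL u).
Proof. by have /cLfun2_sqint[] := L2funP (repr u). Qed.

Lemma measurable_reL u : measurable_fun setT (reL u).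
Proof. by have [] := sqint_reL u. Qed.

Lemma measurable_imL u : measurable_fun setT (imL u).
Proof. by have [] := sqint_imL u. Qed.

Lemma ae_rep_add u v : {ae mu, forall x, x \in `]a, b[ ->
  L2rep (u + v) x = L2rep u x + L2rep v x}.
Proof.
apply/(@leb_ae _ a b (fun x => L2rep (u + v) x = L2rep u x + L2rep v x)).
have := @L2repP _ _ _ (leb a b) (repr u + repr v).
by rewrite pi_L2D !reprK; apply: filterS => x /(_ I).
Qed.

Lemma ae_rep_scale (c : R[i]) u : {ae mu, forall x, x \in `]a, b[ ->
  L2rep (c *: u) x = c * L2rep u x}.
Proof.
apply/(@leb_ae _ a b (fun x => L2rep (c *: u) x = c * L2rep u x)).
have := @L2repP _ _ _ (leb a b) (c *: repr u).
by apply: filterS => x /(_ I).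
Qed.

Lemma L2_eq u v : {ae mu, forall x, x \in `]a, b[ -> L2rep u x = L2rep v x} -> u = v.
Proof.
move=> /(@leb_ae _ a b (fun x => L2rep u x = L2rep v x)) h.
rewrite -[u]reprK -[v]reprK; apply/L2eqP.
by move: h; apply: (@filterS _ _ (ae_filter_ringOfSetsType (leb a b))) => x h _.
Qed.

Lemma ae_rep_toL2 f : sqint a b (fun x => complex.Re (f x)) ->
  sqint a b (fun x => complex.Im (f x)) ->
  {ae mu, forall x, x \in `]a, b[ -> L2rep (toL2 (leb a b) f) x = f x}.
Proof.
move=> sr si; apply/(@leb_ae _ a b (fun x => L2rep (toL2 (leb a b) f) x = f x)).
have /toL2P := (proj2 (cLfun2_sqint f)) (conj sr si).
by apply: filterS => x /(_ I).
Qed.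

Definition ipL u v : R :=
  \int[mu]_(x in `[a, b]) (reL u x * reL v x + imL u x * imL v x).

Lemma ipL_intg u v : intg `[a, b] (fun x => reL u x * reL v x + imL u x * imL v x).
Proof.
have h1 := sqint_mul (sqint_reL u) (sqint_reL v).
have h2 := sqint_mul (sqint_imL u) (sqint_imL v).
exact: (integrableD _ h1 h2).
Qed.

Lemma Rint_itv_ae (f g : R -> R) : intg `[a, b] f -> intg `[a, b] g ->
  {ae mu, forall x, x \in `]a, b[ -> f x = g x} ->
  \int[mu]_(x in `[a, b]) f x = \int[mu]_(x in `[a, b]) g x.
Proof.
move=> /integrableP[/measurable_EFinP mf _] /integrableP[/measurable_EFinP mg _].
exact: Rint_ae.
Qed.

Lemma ipL_normE u : ipL u u = L2norm u ^+ 2.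
Proof.
have [mf _] := cLfunP _ _ _ (L2funP (repr u)).
have := Lnorm_cabs mf; rewrite -L2normE.
have e : \int[mu]_(x in `[a, b]) ((reL u x) ^+ 2 + (imL u x) ^+ 2) = ipL u u.
  by apply: eq_Rintegral => x _; rewrite !expr2.
have i : intg `[a, b] (fun x => (reL u x) ^+ 2 + (imL u x) ^+ 2).
  rewrite (_ : (fun x => _) = (fun x => reL u x * reL u x + imL u x * imL u x)).
    exact: ipL_intg.
  by apply/funext => x; rewrite !expr2.
rewrite -[X in _ = X]/(\int[mu]_(x in `[a, b]) ((reL u x) ^+ 2 + (imL u x) ^+ 2)%:E)%E.
rewrite intg_fin// e => -[<-]; rewrite powR_mulrn//.
by rewrite /L2norm fine_ge0// Lnorm_ge0.
Qed.

Lemma ipL_inner_product : inner_product ipL.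
Proof.
split.
- by move=> u v; apply: eq_Rintegral => x _; rewrite (mulrC (reL u x)) (mulrC (imL u x)).
- move=> u v w; rewrite /ipL -(Rint_D (ipL_intg u w) (ipL_intg v w)).
  apply: Rint_itv_ae; [exact: ipL_intg|exact: (integrableD _ (ipL_intg u w) (ipL_intg v w))|].
  apply: mu_aeS (ae_rep_add u v) => x h xab; rewrite /reL /imL (h xab).
  by case: (L2rep u x) (L2rep v x) => [? ?] [? ?] /=; ring.
- move=> r u v; rewrite /ipL -(Rint_Z r (ipL_intg u v)).
  apply: Rint_itv_ae; [exact: ipL_intg|exact: (integrableZl _ r (ipL_intg u v))|].
  apply: mu_aeS (ae_rep_scale r%:C u) => x h xab; rewrite /reL /imL (h xab).
  by case: (L2rep u x) => [? ?] /=; ring.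
- by move=> c u; rewrite !ipL_normE L2normZ exprMn.
- by move=> u; rewrite ipL_normE sqr_ge0.
- by move=> u; rewrite ipL_normE => /eqP; rewrite sqrf_eq0 => /eqP /L2norm_eq0.
Qed.

Lemma inorm_ipL u : inorm ipL u = L2norm u.
Proof.
rewrite /inorm ipL_normE sqrtr_sqr ger0_norm//.
by rewrite /L2norm fine_ge0// Lnorm_ge0.
Qed.

(** A subsequence that is Cauchy at the rate [2 ^- k] satisfies the hypotheses of
    [riesz_fischer], separately for the real and imaginary parts. *)
Lemma ipL_complete : icomplete ipL.
Proof.
move=> u cu; have H := ipL_inner_product.
have N_ex k : exists N : nat, forall n m, (N <= n)%N -> inorm ipL (u (n + m)%N - u n) <= 2 ^- k.
  by apply: cu; rewrite invr_gt0 exprn_gt0.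
pose N k := sval (cid (N_ex k)).
have NP k n m : (N k <= n)%N -> inorm ipL (u (n + m)%N - u n) <= 2 ^- k.
  exact: (svalP (cid (N_ex k)) n m).
(* The sum, rather than the value at [k], makes [phi] monotone. *)
pose phi k := (\sum_(j < k.+1) N j)%N.
have phiN k : (N k <= phi k)%N by rewrite /phi big_ord_recr/= leq_addl.
have phi_mono k m : (k <= m)%N -> (phi k <= phi m)%N.
  move=> km; rewrite -(subnK km); elim: (m - k)%N => [|n IH]; first by rewrite add0n.
  by rewrite (leq_trans IH)// addSn /phi [leqRHS]big_ord_recr/= leq_addr.
pose v k := u (phi k).
have vv k m : (k <= m)%N -> ipL (v m - v k) (v m - v k) <= (2 ^- k) ^+ 2.
  move=> km; rewrite -inorm_sqr// ler_pXn2r ?nnegrE ?inorm_ge0 ?invr_ge0 ?exprn_ge0//.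
  by rewrite /v -(subnKC (phi_mono _ _ km)); apply: NP.
have i2 (f : R -> R) : sqint a b f -> intg `[a, b] (fun x => f x ^+ 2) by case.
have ipLE w (f g : R -> R) : sqint a b f -> sqint a b g ->
    {ae mu, forall x, x \in `]a, b[ -> reL w x = f x /\ imL w x = g x} ->
    ipL w w = \int[mu]_(x in `[a, b]) (f x ^+ 2) + \int[mu]_(x in `[a, b]) (g x ^+ 2).
  move=> sf sg h; rewrite -(Rint_D (i2 _ sf) (i2 _ sg)).
  apply: Rint_itv_ae; [exact: ipL_intg|exact: (integrableD _ (i2 _ sf) (i2 _ sg))|].
  by apply: mu_aeS h => x h xab; have [-> ->] := h xab; rewrite !expr2.
have dif w w' : {ae mu, forall x, x \in `]a, b[ ->
    reL (w - w') x = reL w x - reL w' x /\ imL (w - w') x = imL w x - imL w' x}.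
  apply: mu_aeS2 (ae_rep_add w (- w')) (ae_rep_scale (-1) w') => x h1 h2 xab.
  rewrite /reL /imL (h1 xab) -scaleN1r (h2 xab) mulN1r.
  by case: (L2rep w x) (L2rep w' x) => [? ?] [? ?].
have sd w w' : sqint a b (fun x => reL w x - reL w' x) /\
    sqint a b (fun x => imL w x - imL w' x).
  by split; apply: sqintB; (exact: sqint_reL || exact: sqint_imL).
have sq0 (f : R -> R) : 0 <= \int[mu]_(x in `[a, b]) (f x ^+ 2).
  by apply: Rint_ge0 => x; exact: sqr_ge0.
have ipB w w' := ipLE _ _ _ (sd w w').1 (sd w w').2 (dif w w').
have [f sf fP] : exists2 f, sqint a b f &
    forall k, \int[mu]_(x in `[a, b]) ((f x - reL (v k) x) ^+ 2) <= (2 ^- k) ^+ 2.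
  apply: riesz_fischer => //; first exact: ltW.
    by move=> k; exact: sqint_reL.
  by move=> k m km; apply: le_trans (vv k m km); rewrite ipB lerDl.
have [g sg gP] : exists2 g, sqint a b g &
    forall k, \int[mu]_(x in `[a, b]) ((g x - imL (v k) x) ^+ 2) <= (2 ^- k) ^+ 2.
  apply: riesz_fischer => //; first exact: ltW.
    by move=> k; exact: sqint_imL.
  by move=> k m km; apply: le_trans (vv k m km); rewrite ipB lerDr.
pose w : L := toL2 (leb a b) (fun x => (f x +i* g x)%C).
have hw := ae_rep_toL2 (f := fun x => (f x +i* g x)%C) sf sg.
have wv k : inorm ipL (w - v k) <= 2 * 2 ^- k.
  apply: (inorm_le H); first by rewrite mulr_ge0 ?invr_ge0 ?exprn_ge0.
  rewrite (ipLE _ (fun x => f x - reL (v k) x) (fun x => g x - imL (v k) x)).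
  - by have := fP k; have := gP k; have := sqr_ge0 (2 ^- k : R); lra.
  - by apply: sqintB => //; exact: sqint_reL.
  - by apply: sqintB => //; exact: sqint_imL.
  - apply: mu_aeS2 (dif w (v k)) hw => x h1 h2 xab; have [-> ->] := h1 xab.
    have -> : reL w x = f x by rewrite /reL /w (h2 xab).
    by have -> : imL w x = g x by rewrite /imL /w (h2 xab).
exists w => e e0.
have [K _ hK] : \forall k \near \oo, dstep R k * 3 < e.
  have : dstep R k * 3 @[k --> \oo] --> (0 : R) by rewrite -(mul0r 3); apply: cvgMl; exact: dstep_cvg.
  move/cvgrPdist_lt => /(_ _ e0); apply: filterS => k; rewrite sub0r normrN.
  by apply: le_lt_trans; exact: ler_norm.
have {hK} hK := hK K (leqnn K); rewrite /= /dstep in hK.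
exists (phi K) => // n /= Kn.
have h1 := NP K (phi K) (n - phi K)%N (phiN K); rewrite subnKC// -/(v K) in h1.
have h2 := wv K; rewrite inormB// in h2.
by have := inormDB H (u n) (v K) w; lra.
Qed.

End L2Hilbert.

Section PairInnerProduct.
Context (R : realType) (V W : lmodType R[i]) (ip1 : V -> V -> R) (ip2 : W -> W -> R).
Hypothesis H1 : inner_product ip1.
Hypothesis H2 : inner_product ip2.

Definition ip_pair (x y : V * W) : R := ip1 x.1 y.1 + ip2 x.2 y.2.

Lemma pair_inner_product : inner_product ip_pair.
Proof.
split.
- by move=> x y; rewrite /ip_pair (ipC H1) (ipC H2).
- by move=> x y z; rewrite /ip_pair (ipDl H1) (ipDl H2) addrACA.
- by move=> r x y; rewrite /ip_pair (ipZl H1) (ipZl H2) mulrDr.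
- by move=> c x; rewrite /ip_pair (ip_normZ H1) (ip_normZ H2) mulrDr.
- by move=> x; rewrite addr_ge0 ?(ip_ge0 H1) ?(ip_ge0 H2).
- move=> [x y] /eqP; rewrite /ip_pair/= paddr_eq0 ?(ip_ge0 H1) ?(ip_ge0 H2)//.
  by move=> /andP[/eqP/(ip_eq0 H1)-> /eqP/(ip_eq0 H2)->].
Qed.

Lemma inorm_pair_le1 x : inorm ip1 x.1 <= inorm ip_pair x.
Proof.
apply: (inorm_le H1); first exact: inorm_ge0.
by rewrite (inorm_sqr pair_inner_product) lerDl (ip_ge0 H2).
Qed.

Lemma inorm_pair_le2 x : inorm ip2 x.2 <= inorm ip_pair x.
Proof.
apply: (inorm_le H2); first exact: inorm_ge0.
by rewrite (inorm_sqr pair_inner_product) lerDr (ip_ge0 H1).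
Qed.

Lemma inorm_pair_ge x : inorm ip_pair x <= inorm ip1 x.1 + inorm ip2 x.2.
Proof.
apply: (inorm_le pair_inner_product); first by rewrite addr_ge0 ?inorm_ge0.
rewrite sqrrD (inorm_sqr H1) (inorm_sqr H2) -/(ip_pair x x) addrAC lerDl.
by rewrite mulrn_wge0// mulr_ge0// inorm_ge0.
Qed.

Lemma pair_complete : icomplete ip1 -> icomplete ip2 -> icomplete ip_pair.
Proof.
move=> C1 C2 u cu.
have [|x hx] := C1 (fun n => (u n).1).
  move=> e /cu [N hN]; exists N => n k Nn; apply: le_trans (hN n k Nn).
  exact: (inorm_pair_le1 (u (n + k)%N - u n)).
have [|y hy] := C2 (fun n => (u n).2).
  move=> e /cu [N hN]; exists N => n k Nn; apply: le_trans (hN n k Nn).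
  exact: (inorm_pair_le2 (u (n + k)%N - u n)).
exists (x, y) => e e0; have e2 : 0 < e / 2 by rewrite divr_gt0.
near=> n.
apply: le_lt_trans (inorm_pair_ge _) _; rewrite [e]splitr; apply: ltrD.
  by near: n; exact: hx.
by near: n; exact: hy.
Unshelve. all: by end_near. Qed.

End PairInnerProduct.

Section PairNorm.
Context (R : realType) (V W : normedModType R[i]) (ip1 : V -> V -> R) (ip2 : W -> W -> R).
Hypothesis H1 : inner_product ip1.
Hypothesis H2 : inner_product ip2.

(** A product of normed spaces carries the maximum norm. *)
Lemma pair_norm_le (M : R) : 0 <= M ->
  (forall x : V, `|x| <= (M * inorm ip1 x)%:C) ->
  (forall x : W, `|x| <= (M * inorm ip2 x)%:C) ->
  forall x : V * W, `|x| <= (M * inorm (ip_pair ip1 ip2) x)%:C.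
Proof.
move=> M0 h1 h2 x; rewrite prod_normE /Num.max; case: ifP => _.
  by apply: le_trans (h2 _) _; rewrite lecR ler_wpM2l// inorm_pair_le2.
by apply: le_trans (h1 _) _; rewrite lecR ler_wpM2l// inorm_pair_le1.
Qed.

Lemma pair_norm_ge (M1 M2 : R) : 0 <= M1 -> 0 <= M2 ->
  (forall x : V, (inorm ip1 x)%:C <= M1%:C * `|x|) ->
  (forall x : W, (inorm ip2 x)%:C <= M2%:C * `|x|) ->
  forall x : V * W, (inorm (ip_pair ip1 ip2) x)%:C <= (M1 + M2)%:C * `|x|.
Proof.
move=> M10 M20 h1 h2 x.
have l1 : `|x.1| <= `|x|.
  by rewrite prod_normE /Num.max; case: ifPn => // /ltW.
have l2 : `|x.2| <= `|x|.
  rewrite prod_normE /Num.max; case: ifPn => //.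
  by rewrite -real_leNgt ?normr_real.
apply: (@le_trans _ _ (inorm ip1 x.1 + inorm ip2 x.2)%:C).
  by rewrite lecR; exact: inorm_pair_ge.
rewrite !rmorphD/= mulrDl; apply: lerD.
  by apply: le_trans (h1 _) _; rewrite ler_wpM2l// lecR.
by apply: le_trans (h2 _) _; rewrite ler_wpM2l// lecR.
Qed.

End PairNorm.

(** * Absolutely continuous representatives *)

Section ContinuousRep.
Context (R : realType).
Local Notation mu := (@lebesgue_measure R).
Implicit Types (F G : R -> R).

Lemma continuous_ae_eq (a b : R) F G : a < b ->
  {within `[a, b], continuous F} -> {within `[a, b], continuous G} ->
  {ae mu, forall x, x \in `]a, b[ -> F x = G x} ->
  forall x, x \in `[a, b] -> F x = G x.
Proof.
move=> ab cF cG [N [mN N0 sN]] x xab; apply/eqP/negPn/negP => FG.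
have cD : (fun y => F y - G y) @ within `[a, b]%classic (nbhs x) --> F x - G x.
  by apply: cvgB; [move/subspace_continuousP : cF|move/subspace_continuousP : cG]; exact.
have d0 : 0 < `|F x - G x| by rewrite normr_gt0 subr_eq0.
move/cvgrPdist_lt/(_ _ d0) : cD => -[e /= e0 he].
pose c := Num.max a (x - e); pose d := Num.min b (x + e).
move: xab; rewrite in_itv/= => /andP[ax xb].
have cd : c < d.
  rewrite /c /d lt_min !gt_max ab/=; apply/andP; split; lra.
have sub : `]c, d[%classic `<=` N.
  move=> y /=; rewrite in_itv/= /c /d gt_max lt_min => /andP[/andP[ay xy] /andP[yb yx]].
  apply: sN => /= /(_ _) h.
  have yab : y \in `]a, b[ by rewrite in_itv/= ay yb.
  have := he y; rewrite /ball/= ltr_distl => /(_ _ _).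
  rewrite (h yab) subrr subr0 ltxx => k; suff: false by [].
  by apply: k; [apply/andP; split; lra|rewrite in_itv/= !ltW].
have : (mu `]c, d[ <= mu N)%E by apply: le_measure; rewrite ?inE//.
by rewrite N0 lebesgue_measure_itv/= lte_fin cd -EFinD lee_fin; lra.
Qed.

Lemma complex_cvgP (T : Type) (A : set_system T) (FA : Filter A) (f : T -> R[i]^o) (l : R[i]^o) :
  f @ A --> l <->
  ((fun x => complex.Re (f x)) @ A --> complex.Re l /\
   (fun x => complex.Im (f x)) @ A --> complex.Im l).
Proof.
have ReB (z w : R[i]) : complex.Re (z - w) = complex.Re z - complex.Re w.
  by case: z w => [? ?] [? ?].
have ImB (z w : R[i]) : complex.Im (z - w) = complex.Im z - complex.Im w.
  by case: z w => [? ?] [? ?].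
have normE (z : R[i]^o) : `|z| = (Normc.normc z)%:C by [].
split=> [fl|[rl il]].
  split; apply/cvgrPdist_le => e e0; move/cvgrPdist_le : fl => /(_ e%:C).
    rewrite ltcR => /(_ e0); apply: filterS => x; rewrite normE lecR; apply: le_trans.
    rewrite -ReB -(ler_pXn2r (n := 2))// ?nnegrE ?normc_ge0//.
    by rewrite real_normK ?num_real// normc_sqr lerDl sqr_ge0.
  rewrite ltcR => /(_ e0); apply: filterS => x; rewrite normE lecR; apply: le_trans.
  rewrite -ImB -(ler_pXn2r (n := 2))// ?nnegrE ?normc_ge0//.
  by rewrite real_normK ?num_real// normc_sqr lerDr sqr_ge0.
apply/cvgrPdist_le => -[e ei]; rewrite ltcE/= => /andP[/eqP-> e0].
have e2 : 0 < e / 2 by rewrite divr_gt0.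
near=> x; rewrite normE -[(e +i* 0)%C]/(e%:C) lecR.
have h1 : `|complex.Re l - complex.Re (f x)| <= e / 2.
  by near: x; move/cvgrPdist_le : rl; exact.
have h2 : `|complex.Im l - complex.Im (f x)| <= e / 2.
  by near: x; move/cvgrPdist_le : il; exact.
rewrite -(ler_pXn2r (n := 2))// ?nnegrE ?normc_ge0 ?(ltW e0)//.
rewrite normc_sqr ReB ImB.
have h3 : (complex.Re l - complex.Re (f x)) ^+ 2 <= (e / 2) ^+ 2.
  by rewrite -[leLHS]real_normK ?num_real// ler_pXn2r ?nnegrE ?(ltW e2).
have h4 : (complex.Im l - complex.Im (f x)) ^+ 2 <= (e / 2) ^+ 2.
  by rewrite -[leLHS]real_normK ?num_real// ler_pXn2r ?nnegrE ?(ltW e2).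
by have := sqr_ge0 e; lra.
Unshelve. all: by end_near. Qed.

Lemma complex_within_continuousP (a b : R) (F : R -> R[i]^o) :
  {within `[a, b], continuous F} <->
  {within `[a, b], continuous (fun x => complex.Re (F x))} /\
  {within `[a, b], continuous (fun x => complex.Im (F x))}.
Proof.
split=> [/subspace_continuousP c|[/subspace_continuousP c1 /subspace_continuousP c2]].
  by split; apply/subspace_continuousP => x xab; have /complex_cvgP[] := c x xab.
by apply/subspace_continuousP => x xab; apply/complex_cvgP; split; [exact: c1|exact: c2].
Qed.

End ContinuousRep.

Section SobolevRep.
Context (R : realType) (a b : R).
Hypothesis ab : a < b.
Hypothesis ba1 : b - a <= 1.
Local Notation mu := (@lebesgue_measure R).
Local Notation intg D f := (mu.-integrable D (EFin \o f)).
Local Notation L := (L2itv a b).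
Implicit Types (u v g h : L) (F G : R -> R[i]).

(** The concrete form of [u] in H1 with derivative [g]: [F] is an absolutely
    continuous representative of [u], which gives boundary values a meaning. *)
Definition acrep u g F :=
  [/\ AC a b (fun x => complex.Re (F x)) (reL g),
      AC a b (fun x => complex.Im (F x)) (imL g) &
      {ae mu, forall x, x \in `]a, b[ -> L2rep u x = F x}].

Lemma acrep_re u g F : acrep u g F ->
  {ae mu, forall x, x \in `]a, b[ -> reL u x = complex.Re (F x)}.
Proof. by move=> [_ _ h]; apply: mu_aeS h => x h xab; rewrite /reL h. Qed.

Lemma acrep_im u g F : acrep u g F ->
  {ae mu, forall x, x \in `]a, b[ -> imL u x = complex.Im (F x)}.
Proof. by move=> [_ _ h]; apply: mu_aeS h => x h xab; rewrite /imL h. Qed.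

Lemma test_measurable phi : test_function a b phi ->
  measurable_fun setT phi /\ measurable_fun setT (derive1 phi).
Proof.
move=> [sm _ _].
by split; apply: continuous_measurable_fun => x; apply/differentiable_continuous/derivable1_diffP;
  [exact: (sm 0%N)|exact: (sm 1%N)].
Qed.

Lemma weak_derivativeP u g : weak_derivative u g <->
  forall phi, test_function a b phi ->
    (\int[mu]_(x in `[a, b]) (reL u x * derive1 phi x) =
      - \int[mu]_(x in `[a, b]) (reL g x * phi x)) /\
    (\int[mu]_(x in `[a, b]) (imL u x * derive1 phi x) =
      - \int[mu]_(x in `[a, b]) (imL g x * phi x)).
Proof.
have cE (w : L) (psi : R -> R) : measurable_fun setT psi ->
   cRintegral a b (fun x => L2rep w x * (psi x)%:C) =
   ((\int[mu]_(x in `[a, b]) (reL w x * psi x)) +i*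
    (\int[mu]_(x in `[a, b]) (imL w x * psi x)))%C.
  move=> mpsi; rewrite /cRintegral.
  have -> : (fun x => complex.Re (L2rep w x * (psi x)%:C)) = (fun x => reL w x * psi x).
    by apply/funext => x; rewrite /reL; case: (L2rep w x) => p q /=; rewrite mulr0 subr0.
  have -> : (fun x => complex.Im (L2rep w x * (psi x)%:C)) = (fun x => imL w x * psi x).
    by apply/funext => x; rewrite /imL; case: (L2rep w x) => p q /=; rewrite mulr0 add0r.
  by rewrite !leb_Rintegral//; apply: measurable_funM => //;
    [exact: measurable_imL|exact: measurable_reL].
by split=> h phi tphi; have [m1 m2] := test_measurable tphi;
  have := h _ tphi; rewrite !cE//; [case=> -> ->|case=> -> ->].
Qed.

Lemma acrep_weak u g F : acrep u g F -> weak_derivative u g.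
Proof.
move=> r; have [ACr ACi _] := r; apply/weak_derivativeP => phi tphi.
have [mp mp'] := test_measurable tphi.
have mpI : measurable_fun `[a, b] (derive1 phi) by exact: measurable_funS mp'.
have mF (f g' : R -> R) : AC a b f g' -> measurable_fun `[a, b] f.
  by move=> ACf; have [] := continuous_bounded_meas (ltW ab) (AC_continuous (ltW ab) ACf).
split; [rewrite -(AC_weak ab ACr tphi)|rewrite -(AC_weak ab ACi tphi)]; apply: Rint_ae.
- by apply: measurable_funM => //; apply: measurable_funS (measurable_reL u).
- by apply: measurable_funM => //; exact: mF ACr.
- by apply: mu_aeS (acrep_re r) => x h xab; rewrite h.
- by apply: measurable_funM => //; apply: measurable_funS (measurable_imL u).
- by apply: measurable_funM => //; exact: mF ACi.
- by apply: mu_aeS (acrep_im r) => x h xab; rewrite h.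
Qed.

Lemma weak_acrep u g : weak_derivative u g -> exists F, acrep u g F.
Proof.
move=> /weak_derivativeP h.
have [F1 AC1 e1] := weak_AC ab (sqint_intg (sqint_reL u)) (sqint_intg (sqint_reL g))
  (fun phi tphi => (h phi tphi).1).
have [F2 AC2 e2] := weak_AC ab (sqint_intg (sqint_imL u)) (sqint_intg (sqint_imL g))
  (fun phi tphi => (h phi tphi).2).
exists (fun x => (F1 x +i* F2 x)%C); split => //.
by apply: mu_aeS2 e1 e2 => x h1 h2 xab; apply: ReIm_eq => /=; [exact: h1|exact: h2].
Qed.

Lemma acrep_continuous u g F : acrep u g F ->
  {within `[a, b], continuous (F : R -> R[i]^o)}.
Proof.
by move=> [r i _]; apply/complex_within_continuousP; split; apply: AC_continuous (ltW ab) _; eassumption.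
Qed.

Lemma acrep_eq u g g' F F' : acrep u g F -> acrep u g' F' ->
  forall x, x \in `[a, b] -> F x = F' x.
Proof.
move=> r r' x xab; have [r1 i1 _] := r; have [r2 i2 _] := r'.
apply: ReIm_eq.
  apply: (continuous_ae_eq ab (AC_continuous (ltW ab) r1) (AC_continuous (ltW ab) r2)) xab.
  by apply: mu_aeS2 (acrep_re r) (acrep_re r') => y h1 h2 yab; rewrite -h1// -h2.
apply: (continuous_ae_eq ab (AC_continuous (ltW ab) i1) (AC_continuous (ltW ab) i2)) xab.
by apply: mu_aeS2 (acrep_im r) (acrep_im r') => y h1 h2 yab; rewrite -h1// -h2.
Qed.

Lemma acrep_uniq u g g' F F' : acrep u g F -> acrep u g' F' -> g = g'.
Proof.
move=> r r'; have e := acrep_eq r r'; have [r1 i1 _] := r; have [r2 i2 _] := r'.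
have r2' : AC a b (fun x => complex.Re (F x)) (reL g').
  by apply: AC_ext r2 => x xab; rewrite e.
have i2' : AC a b (fun x => complex.Im (F x)) (imL g').
  by apply: AC_ext i2 => x xab; rewrite e.
apply: L2_eq; apply: mu_aeS2 (AC_uniq r1 r2') (AC_uniq i1 i2') => x h1 h2 xab.
by apply: ReIm_eq; [exact: h1|exact: h2].
Qed.

Lemma ddzE u g F : acrep u g F -> ddz u = g /\ H1 u.
Proof.
move=> r; have w := acrep_weak r; split; last by exists g.
have : weak_derivative u (ddz u).
  exact: (@xgetPex _ 0 [set g | weak_derivative u g] (ex_intro _ g w)).
by move=> /weak_acrep [F' r']; exact: acrep_uniq r' r.
Qed.

Lemma H1_acrep u : H1 u -> exists F, acrep u (ddz u) F.
Proof.
move=> [g w]; apply: weak_acrep.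
exact: (@xgetPex _ 0 [set g | weak_derivative u g] (ex_intro _ g w)).
Qed.

Lemma crepE u g F x : acrep u g F -> x \in `[a, b] -> crep u x = F x.
Proof.
move=> r xab.
pose P := [set F : R -> R[i]^o |
  {within `[a, b], continuous F} /\ F = L2rep u %[ae leb a b]].
have PF : P F.
  split; first exact: acrep_continuous r.
  have [_ _ h] := r.
  have {}h : {ae leb a b, forall x, L2rep u x = F x} by apply/leb_ae.
  by apply: (@filterS _ _ (ae_filter_ringOfSetsType (leb a b))) h => y -> _.
have [/complex_within_continuousP[c1 c2] h] : P (crep u).
  exact: (@xgetPex _ (fun=> 0) P (ex_intro _ F PF)).
have {}h : {ae leb a b, forall x, crep u x = L2rep u x}.
  by apply: (@filterS _ _ (ae_filter_ringOfSetsType (leb a b))) h => y /(_ I).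
move/(@leb_ae _ a b (fun x => crep u x = L2rep u x)) : h => h.
have [r1 i1 hF] := r.
apply: ReIm_eq.
  apply: (continuous_ae_eq ab c1 (AC_continuous (ltW ab) r1)) xab.
  by apply: mu_aeS2 h hF => y h1 h2 yab; rewrite h1// h2.
apply: (continuous_ae_eq ab c2 (AC_continuous (ltW ab) i1)) xab.
by apply: mu_aeS2 h hF => y h1 h2 yab; rewrite h1// h2.
Qed.

End SobolevRep.

(** * One dimensional Sobolev estimates *)

Section SobolevEstimates.
Context (R : realType) (a b : R).
Hypothesis ab : a < b.
Hypothesis ba1 : b - a <= 1.
Local Notation mu := (@lebesgue_measure R).
Local Notation intg D f := (mu.-integrable D (EFin \o f)).
Local Notation L := (L2itv a b).
Implicit Types (u v g h : L) (F G : R -> R[i]) (c : R[i]).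

Let leab : a <= b := ltW ab.

Lemma ae_rep_lin c u v : {ae mu, forall x, x \in `]a, b[ ->
  L2rep (c *: u + v) x = c * L2rep u x + L2rep v x}.
Proof.
by apply: mu_aeS2 (ae_rep_add (c *: u) v) (ae_rep_scale c u) => x h1 h2 xab; rewrite h1// h2.
Qed.

Lemma acrep_lin c u u' g g' F F' : acrep u g F -> acrep u' g' F' ->
  acrep (c *: u + u') (c *: g + g') (fun x => c * F x + F' x).
Proof.
move=> [r i h] [r' i' h']; split.
- have := AC_lin (complex.Re c) r (AC_lin (- complex.Im c) i r').
  rewrite (_ : (fun x => _ * complex.Re (F x) + _) = (fun x => complex.Re (c * F x + F' x))).
    apply: AC_ae; first by apply: measurable_funS (measurable_reL _).
    apply: mu_aeS (ae_rep_lin c g g') => x e xab; rewrite /reL /imL (e xab) {e}.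
    by case: c (L2rep g x) (L2rep g' x) => [? ?] [? ?] [? ?] /=; ring.
  by apply/funext => x; case: c (F x) (F' x) => [? ?] [? ?] [? ?] /=; ring.
- have := AC_lin (complex.Re c) i (AC_lin (complex.Im c) r i').
  rewrite (_ : (fun x => _ * complex.Im (F x) + _) = (fun x => complex.Im (c * F x + F' x))).
    apply: AC_ae; first by apply: measurable_funS (measurable_imL _).
    apply: mu_aeS (ae_rep_lin c g g') => x e xab; rewrite /reL /imL (e xab) {e}.
    by case: c (L2rep g x) (L2rep g' x) => [? ?] [? ?] [? ?] /=; ring.
  by apply/funext => x; case: c (F x) (F' x) => [? ?] [? ?] [? ?] /=; ring.
- have hh : {ae mu, forall x, x \in `]a, b[ -> L2rep u x = F x /\ L2rep u' x = F' x}.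
    by apply: mu_aeS2 h h' => x e e' xab; split; [exact: e|exact: e'].
  by apply: mu_aeS2 (ae_rep_lin c u u') hh => x e e' xab; rewrite (e xab); have [-> ->] := e' xab.
Qed.

Lemma AC_bounded_sqint (F f : R -> R) : AC a b F f -> sqint a b (F \_ `[a, b]).
Proof.
move=> ACF; have [mF bF] := continuous_bounded_meas leab (AC_continuous leab ACF).
have mFr : measurable_fun setT (F \_ `[a, b]) by apply/(measurable_restrictT _ _).1.
split => //; apply: measurable_bounded_integrable => //.
- by rewrite [X in (X < _)%E](mu_itv leab) ltry.
- by apply: measurable_funX; apply: measurable_funS mFr.
- have [M [Mr MF]] := bF; have M1 : M < `|M| + 1 by rewrite ltr_pwDr// ler_norm.
  exists ((`|M| + 1) ^+ 2); split; first exact: num_real.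
  move=> y hy x xab; apply: le_trans (ltW hy); rewrite patchE mem_set//.
  by rewrite normrX ler_pXn2r ?nnegrE ?addr_ge0//; exact: MF M1 x xab.
Qed.

(** The boundary value problems below reduce to integrations of this form. *)
Lemma prim_ex g x0 c : x0 \in `[a, b] -> exists u F, acrep u g F /\ F x0 = c.
Proof.
move=> x0ab.
pose Fr x := complex.Re c - \int[mu]_(t in `[a, x0]) reL g t + \int[mu]_(t in `[a, x]) reL g t.
pose Fi x := complex.Im c - \int[mu]_(t in `[a, x0]) imL g t + \int[mu]_(t in `[a, x]) imL g t.
have ACr : AC a b Fr (reL g) by apply: AC_prim; exact: sqint_intg (sqint_reL g).
have ACi : AC a b Fi (imL g) by apply: AC_prim; exact: sqint_intg (sqint_imL g).
exists (toL2 (leb a b) (fun x => ((Fr \_ `[a, b]) x +i* (Fi \_ `[a, b]) x)%C)).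
exists (fun x => (Fr x +i* Fi x)%C); split; last first.
  by apply: ReIm_eq; rewrite /= /Fr /Fi subrK.
split => //.
have := ae_rep_toL2 (f := fun x => ((Fr \_ `[a, b]) x +i* (Fi \_ `[a, b]) x)%C)
  (AC_bounded_sqint ACr) (AC_bounded_sqint ACi).
apply: mu_aeS => x h xab; rewrite h// !patchE mem_set//=.
by move: xab; rewrite !in_itv/= => /andP[/ltW-> /ltW->].
Qed.

(** Squared modulus, and real part of [z] times the conjugate of [w]. *)
Definition nsq (z : R[i]) : R := complex.Re z ^+ 2 + complex.Im z ^+ 2.
Definition rprod (z w : R[i]) : R :=
  complex.Re z * complex.Re w + complex.Im z * complex.Im w.

Lemma nsq_ge0 z : 0 <= nsq z. Proof. by rewrite addr_ge0 ?sqr_ge0. Qed.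

Lemma nsq_le2 z w : nsq z <= 2 * nsq w + 2 * nsq (z - w).
Proof.
rewrite /nsq; case: z w => [p q] [p' q'] /=.
by have := sqr_ge0 (2 * p' - p); have := sqr_ge0 (2 * q' - q); lra.
Qed.

Lemma sq_intg (f : R -> R) : sqint a b f -> intg `[a, b] (fun x => f x ^+ 2).
Proof. by case. Qed.

Lemma ipL_self u : ipL u u =
  \int[mu]_(x in `[a, b]) (reL u x ^+ 2) + \int[mu]_(x in `[a, b]) (imL u x ^+ 2).
Proof.
rewrite -(Rint_D (sq_intg (sqint_reL u)) (sq_intg (sqint_imL u))).
by apply: eq_Rintegral => x _; rewrite !expr2.
Qed.

Lemma acrep_pt u g F x y : acrep u g F -> x \in `[a, b] -> y \in `[a, b] ->
  nsq (F x - F y) <= ipL g g.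
Proof.
move=> [r i _] xab yab; rewrite ipL_self /nsq.
have := AC_sqr_le r ba1 (sq_intg (sqint_reL g)) yab xab.
have := AC_sqr_le i ba1 (sq_intg (sqint_imL g)) yab xab.
by case: (F x) (F y) => [? ?] [? ?] /=; lra.
Qed.

Lemma acrep_pt2 u g F x y : acrep u g F -> x \in `[a, b] -> y \in `[a, b] ->
  nsq (F x) <= 2 * nsq (F y) + 2 * ipL g g.
Proof.
move=> r xab yab; apply: le_trans (nsq_le2 _ (F y)) _.
by have := acrep_pt r xab yab; lra.
Qed.

Lemma acrep_intg u g F : acrep u g F -> intg `[a, b] (fun x => nsq (F x)) /\
  ipL u u = \int[mu]_(x in `[a, b]) nsq (F x).
Proof.
move=> r; have [r1 i1 h] := r.
have [mr br] := continuous_bounded_meas leab (AC_continuous leab r1).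
have [mi bi] := continuous_bounded_meas leab (AC_continuous leab i1).
have i2 : intg `[a, b] (fun x => nsq (F x)).
  rewrite (_ : (fun x => _) = (fun x => complex.Re (F x) * complex.Re (F x) +
     complex.Im (F x) * complex.Im (F x))); last first.
    by apply/funext => x; rewrite /nsq !expr2.
  have bI (G : R -> R) : measurable_fun `[a, b] G -> [bounded G x | x in `[a, b]%classic] -> intg `[a, b] G.
    move=> mG bG; apply: measurable_bounded_integrable => //.
    by rewrite [X in (X < _)%E](mu_itv leab) ltry.
  have j1 : intg `[a, b] (fun x => complex.Re (F x) * complex.Re (F x)).
    exact: (integrableMl _ (bI _ mr br) mr br).
  have j2 : intg `[a, b] (fun x => complex.Im (F x) * complex.Im (F x)).
    exact: (integrableMl _ (bI _ mi bi) mi bi).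
  exact: (integrableD _ j1 j2).
split => //; apply: Rint_itv_ae => //; first exact: ipL_intg.
by apply: mu_aeS h => x e xab; rewrite /reL /imL e// /nsq !expr2.
Qed.

Lemma acrep_le u g F (k : R) : acrep u g F -> 0 <= k ->
  (forall x, x \in `[a, b] -> nsq (F x) <= k) -> ipL u u <= k.
Proof.
move=> r k0 h; have [i ->] := acrep_intg r.
apply: le_trans (le_Rint i (intg_cst a b k) h) _.
by rewrite Rint_cst// ler_piMr.
Qed.

(** Average [acrep_pt2] over the second point. *)
Lemma acrep_avg u g F x : b - a = 1 -> acrep u g F -> x \in `[a, b] ->
  nsq (F x) <= 2 * ipL u u + 2 * ipL g g.
Proof.
move=> ba r xab; have [i e] := acrep_intg r.
have i2 : intg `[a, b] (fun y => 2 * nsq (F y)) by exact: (integrableZl _ _ i).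
have i3 := intg_cst a b (2 * ipL g g).
have i4 : intg `[a, b] (fun y => 2 * nsq (F y) + 2 * ipL g g) by exact: (integrableD _ i2 i3).
have := le_Rint (intg_cst a b (nsq (F x))) i4 (fun y yab => acrep_pt2 r xab yab).
by rewrite (Rint_D i2 i3) (Rint_Z _ i) !Rint_cst// ba !mulr1 e.
Qed.

Lemma acrep_ibp u v g h F G : acrep u g F -> acrep v h G ->
  ipL g v + ipL u h = rprod (F b) (G b) - rprod (F a) (G a).
Proof.
move=> rF rG; have [r1 i1 hF] := rF; have [r2 i2 hG] := rG.
have e1 := AC_diff (AC_mul leab r1 r2) (lexx a) leab (lexx b).
have e2 := AC_diff (AC_mul leab i1 i2) (lexx a) leab (lexx b).
have [j1 _] := AC_mul leab r1 r2; have [j2 _] := AC_mul leab i1 i2.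
rewrite /rprod opprD addrACA e1 e2 -(Rint_D j1 j2) -(Rint_D (ipL_intg g v) (ipL_intg u h)).
apply: Rint_itv_ae.
- exact: (integrableD _ (ipL_intg g v) (ipL_intg u h)).
- exact: (integrableD _ j1 j2).
- apply: mu_aeS2 hF hG => x h1 h2 xab; rewrite /reL /imL h1// h2//; ring.
Qed.

(** The weight [x] is the multiplier of the energy identity [acrep_multiplier]. *)
Definition wip u v : R := \int[mu]_(x in `[a, b]) (x * (reL u x * reL v x + imL u x * imL v x)).

Lemma wip_intg u v : intg `[a, b] (fun x => x * (reL u x * reL v x + imL u x * imL v x)).
Proof.
rewrite (_ : (fun x => _) = (fun x => (reL u x * reL v x + imL u x * imL v x) * x)).
  have [mid bid] := continuous_bounded_meas leab (AC_continuous leab (AC_id a b)).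
  exact: (integrableMl _ (ipL_intg u v) mid bid).
by apply/funext => x; rewrite mulrC.
Qed.

Lemma wipC u v : wip u v = wip v u.
Proof. by apply: eq_Rintegral => x _; rewrite (mulrC (reL u x)) (mulrC (imL u x)). Qed.

Lemma wip_lin (r : R) u v w : wip (r%:C *: u + v) w = r * wip u w + wip v w.
Proof.
have i1 : intg `[a, b] (fun x => r * (x * (reL u x * reL w x + imL u x * imL w x))).
  exact: (integrableZl _ r (wip_intg u w)).
rewrite /wip -(Rint_Z r (wip_intg u w)) -(Rint_D i1 (wip_intg v w)).
apply: Rint_itv_ae; [exact: wip_intg|exact: (integrableD _ i1 (wip_intg v w))|].
apply: mu_aeS (ae_rep_lin r%:C u v) => x e xab; rewrite /reL /imL e//.
by case: (L2rep u x) (L2rep v x) => [? ?] [? ?] /=; ring.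
Qed.

Lemma wip_le u v : 0 <= a -> b <= 1 -> `|2 * wip u v| <= ipL u u + ipL v v.
Proof.
move=> a0 b1.
have iuv : intg `[a, b] (fun x => reL u x * reL u x + imL u x * imL u x +
    (reL v x * reL v x + imL v x * imL v x)).
  exact: (integrableD _ (ipL_intg u u) (ipL_intg v v)).
have i2 : intg `[a, b] (fun x => 2 * (x * (reL u x * reL v x + imL u x * imL v x))).
  exact: (integrableZl _ _ (wip_intg u v)).
have i3 : intg `[a, b] (fun x => (-2) * (x * (reL u x * reL v x + imL u x * imL v x))).
  exact: (integrableZl _ _ (wip_intg u v)).
have pt s x : (s = 2 \/ s = -2) -> x \in `[a, b] -> s * (x * (reL u x * reL v x + imL u x * imL v x)) <=
  reL u x * reL u x + imL u x * imL u x + (reL v x * reL v x + imL v x * imL v x).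
  move=> hs; rewrite in_itv/= => /andP[ax xb].
  have x01 : 0 <= 1 - x by lra.
  have x0 : 0 <= x by lra.
  set p := reL u x; set q := imL u x; set p' := reL v x; set q' := imL v x.
  have h1 := mulr_ge0 x0 (sqr_ge0 (p - p')); have h2 := mulr_ge0 x0 (sqr_ge0 (q - q')).
  have h3 := mulr_ge0 x0 (sqr_ge0 (p + p')); have h4 := mulr_ge0 x0 (sqr_ge0 (q + q')).
  have h5 := mulr_ge0 x01 (addr_ge0 (addr_ge0 (sqr_ge0 p) (sqr_ge0 q)) (addr_ge0 (sqr_ge0 p') (sqr_ge0 q'))).
  by case: hs => ->; lra.
rewrite ler_norml; apply/andP; split.
  rewrite lerNl -mulNr /wip -(Rint_Z _ (wip_intg u v)) -(Rint_D (ipL_intg u u) (ipL_intg v v)).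
  by apply: (le_Rint i3 iuv) => x; apply: pt; right.
rewrite /wip -(Rint_Z _ (wip_intg u v)) -(Rint_D (ipL_intg u u) (ipL_intg v v)).
by apply: (le_Rint i2 iuv) => x; apply: pt; left.
Qed.

(** Integration by parts of [x (|F|^2)'], which expresses the energy [ipL u u] by a
    boundary value at [b] when [a = 0]. *)
Lemma acrep_multiplier u g F : acrep u g F ->
  2 * wip g u + ipL u u = b * nsq (F b) - a * nsq (F a).
Proof.
move=> rF; have [r1 i1 hF] := rF.
have ACr := AC_mul leab (AC_id a b) (AC_mul leab r1 r1).
have ACi := AC_mul leab (AC_id a b) (AC_mul leab i1 i1).
have e1 := AC_diff ACr (lexx a) leab (lexx b); have e2 := AC_diff ACi (lexx a) leab (lexx b).
have [j1 _] := ACr; have [j2 _] := ACi.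
have i2 : intg `[a, b] (fun x => 2 * (x * (reL g x * reL u x + imL g x * imL u x))).
  exact: (integrableZl _ _ (wip_intg g u)).
have -> : b * nsq (F b) - a * nsq (F a) =
  (b * (complex.Re (F b) * complex.Re (F b)) - a * (complex.Re (F a) * complex.Re (F a))) +
  (b * (complex.Im (F b) * complex.Im (F b)) - a * (complex.Im (F a) * complex.Im (F a))).
  by rewrite /nsq; ring.
rewrite e1 e2 -(Rint_D j1 j2) /wip -(Rint_Z _ (wip_intg g u)) -(Rint_D i2 (ipL_intg u u)).
apply: Rint_itv_ae.
- exact: (integrableD _ i2 (ipL_intg u u)).
- exact: (integrableD _ j1 j2).
- by apply: mu_aeS hF => x h1 xab; rewrite /reL /imL h1//; ring.
Qed.

End SobolevEstimates.

(** * Multiplication by the coefficient *)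

Section AeMonotone.
Context (R : realType).
Local Notation mu := (@lebesgue_measure R).
Local Notation intg D f := (mu.-integrable D (EFin \o f)).

(** Reduces to the pointwise comparison with [max f g], which equals [g] almost
    everywhere. *)
Lemma le_Rint_ae (a b : R) (f g : R -> R) : intg `[a, b] f -> intg `[a, b] g ->
  {ae mu, forall x, x \in `]a, b[ -> f x <= g x} ->
  \int[mu]_(x in `[a, b]) f x <= \int[mu]_(x in `[a, b]) g x.
Proof.
move=> fi gi fg.
have [/measurable_EFinP mf _] := integrableP _ _ _ fi.
have [/measurable_EFinP mg _] := integrableP _ _ _ gi.
pose k x := Num.max (f x) (g x).
have ke : {ae mu, forall x, x \in `]a, b[ -> g x = k x}.
  by apply: mu_aeS fg => x h xab; rewrite /k max_r// h.
have mk : measurable_fun `[a, b] k by exact: measurable_maxr.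
have ik : intg `[a, b] k.
  apply: (intg_ae _ mk _ gi) => //.
  by move/ae_itvoc : ke; apply: mu_aeS => x h xab; apply: h; rewrite mem_setE in xab.
rewrite (Rint_itv_ae gi ik ke).
by apply: (le_Rint fi ik) => x _; rewrite /k le_max lexx.
Qed.

End AeMonotone.

Section ComplexProduct.
Context (R : realType).
Implicit Types (z w : R[i]) (k : R).

Lemma Re_mul_ge z w k : k <= complex.Re z ->
  k * (complex.Re w * complex.Re w + complex.Im w * complex.Im w) <=
  complex.Re (z * w) * complex.Re w + complex.Im (z * w) * complex.Im w.
Proof.
case: z w => [s t] [p q] /= h.
have -> : (s * p - t * q) * p + (s * q + t * p) * q = s * (p * p + q * q) by ring.
by rewrite ler_wpM2r// addr_ge0// -expr2 sqr_ge0.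
Qed.

Lemma nsq_mul_le z w k : nsq z <= k ->
  complex.Re (z * w) * complex.Re (z * w) + complex.Im (z * w) * complex.Im (z * w) <=
  k * (complex.Re w * complex.Re w + complex.Im w * complex.Im w).
Proof.
rewrite /nsq; case: z w => [s t] [p q] /= h.
have -> : (s * p - t * q) * (s * p - t * q) + (s * q + t * p) * (s * q + t * p) =
  (s ^+ 2 + t ^+ 2) * (p * p + q * q) by ring.
by rewrite ler_wpM2r// addr_ge0// -expr2 sqr_ge0.
Qed.

End ComplexProduct.

Section Coefficient.
Context (R : realType) (S : R -> R[i]) (nu : R).
Hypothesis S_Linfty : S \in cLfun (leb 1 2) +oo%E.
Hypothesis nu_gt0 : 0 < nu.
Hypothesis ReS_ge : {ae leb 1 2, forall x, nu <= complex.Re (S x)}.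
Local Notation mu := (@lebesgue_measure R).
Local Notation intg D f := (mu.-integrable D (EFin \o f)).
Local Notation L := (L2itv (1 : R) 2).

Lemma lt12 : (1 : R) < 2. Proof. lra. Qed.
Lemma len12 : (2 : R) - 1 = 1. Proof. lra. Qed.
Lemma le12 : (2 : R) - 1 <= 1. Proof. lra. Qed.

Lemma S_meas : measurable_fun setT (fun x => complex.Re (S x)) /\
  measurable_fun setT (fun x => complex.Im (S x)).
Proof. by have /cLfunP[] := S_Linfty. Qed.

Lemma S_bounded : exists2 M, 0 < M &
  {ae mu, forall x, x \in `]1, 2[ -> nsq (S x) <= M ^+ 2}.
Proof.
have /cLfunP[mS] := S_Linfty; rewrite /finite_norm unlock.
have -> : (leb 1 2 [set: measurableTypeR R] > 0)%E.
  rewrite /leb/= /mrestr setTI lebesgue_measure_itv/= lte_fin lt12.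
  by rewrite -EFinD lte_fin; lra.
move=> fin.
have [|M hM] := @ess_supr_bounded _ _ _ (leb 1 2) (cabs S).
  apply: le_lt_trans fin; apply: le_ess_sup; apply: nearW => x /=.
  by rewrite lee_fin ler_norm.
exists (`|M| + 1); first by rewrite ltr_wpDl.
apply/(@leb_ae _ 1 2 (fun x => nsq (S x) <= (`|M| + 1) ^+ 2)).
apply: (@filterS _ _ (ae_filter_ringOfSetsType (leb 1 2))) hM => x hx.
rewrite /nsq -normc_sqr ler_pXn2r ?nnegrE ?addr_ge0 ?normc_ge0//.
by apply: (le_trans hx); apply: (le_trans (ler_norm _)); rewrite lerDl.
Qed.

Lemma sqint_bd (a b M : R) (h f : R -> R) : measurable_fun setT h ->
  {ae mu, forall x, x \in `]a, b[ -> `|h x| <= M} -> sqint a b f ->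
  sqint a b (fun x => h x * f x).
Proof.
move=> mh hM sf; have [mf fi] := sf.
(* Truncation makes the bound on the multiplier hold everywhere. *)
pose k x := if `|h x| <= M then h x else 0.
have mk : measurable_fun setT k.
  apply: measurable_fun_ifT => //; apply: measurable_fun_ler => //.
  exact: measurableT_comp.
apply: (sqint_ae (f := fun x => k x * f x)); first exact: measurable_funM.
  by apply: mu_aeS hM => x hx xab; rewrite /k hx.
split; first exact: measurable_funM.
apply: (@intg_le _ _ _ _ (fun x => M ^+ 2 * f x ^+ 2)).
- by apply: measurable_funX; exact: measurable_funM.
- move=> x; rewrite ger0_norm ?sqr_ge0// exprMn ler_wpM2r ?sqr_ge0// /k.
  case: ifPn => hx; last by rewrite expr0n/= sqr_ge0.
  by rewrite -[leLHS]real_normK ?num_real// ler_pXn2r ?nnegrE// (le_trans (normr_ge0 _) hx).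
- exact: (integrableZl _ _ fi).
Qed.

Lemma Re_le_nsq (z : R[i]) (M : R) : 0 < M -> nsq z <= M ^+ 2 ->
  `|complex.Re z| <= M /\ `|complex.Im z| <= M.
Proof.
move=> M0; rewrite /nsq => h; have := sqr_ge0 (complex.Re z); have := sqr_ge0 (complex.Im z).
move=> h1 h2; split; rewrite -(ler_pXn2r (n := 2))// ?nnegrE ?(ltW M0)// real_normK ?num_real//; lra.
Qed.

Lemma mult_rep (h : R -> R[i]) (M : R) (u : L) : 0 < M ->
  measurable_fun setT (fun x => complex.Re (h x)) ->
  measurable_fun setT (fun x => complex.Im (h x)) ->
  {ae mu, forall x, x \in `]1, 2[ -> nsq (h x) <= M ^+ 2} ->
  {ae mu, forall x, x \in `]1, 2[ ->
    L2rep (toL2 (leb 1 2) (fun x => h x * L2rep u x)) x = h x * L2rep u x}.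
Proof.
move=> M0 mr mi hM.
have b1 : {ae mu, forall x, x \in `]1, 2[ -> `|complex.Re (h x)| <= M}.
  by apply: mu_aeS hM => x hx xab; have [] := Re_le_nsq M0 (hx xab).
have b2 : {ae mu, forall x, x \in `]1, 2[ -> `|complex.Im (h x)| <= M}.
  by apply: mu_aeS hM => x hx xab; have [] := Re_le_nsq M0 (hx xab).
apply: (ae_rep_toL2 (f := fun x => h x * L2rep u x)).
  rewrite (_ : (fun x => _) = (fun x => complex.Re (h x) * reL u x - complex.Im (h x) * imL u x)).
    by apply: sqintB; [exact: sqint_bd b1 (sqint_reL u)|exact: sqint_bd b2 (sqint_imL u)].
  by apply/funext => x; rewrite /reL /imL; case: (h x) (L2rep u x) => [? ?] [? ?].
rewrite (_ : (fun x => _) = (fun x => complex.Re (h x) * imL u x + complex.Im (h x) * reL u x)).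
  by apply: sqintD; [exact: sqint_bd b1 (sqint_imL u)|exact: sqint_bd b2 (sqint_reL u)].
by apply/funext => x; rewrite /reL /imL; case: (h x) (L2rep u x) => [? ?] [? ?].
Qed.

Lemma mulS_rep (u : L) : {ae mu, forall x, x \in `]1, 2[ ->
  L2rep (mulS S u) x = S x * L2rep u x}.
Proof.
have [M M0 hM] := S_bounded; have [mr mi] := S_meas.
exact: mult_rep M0 mr mi hM.
Qed.

Lemma mulS_lin (c : R[i]) (u v : L) : mulS S (c *: u + v) = c *: mulS S u + mulS S v.
Proof.
apply: L2_eq.
have h : {ae mu, forall x, x \in `]1, 2[ ->
    L2rep (mulS S u) x = S x * L2rep u x /\ L2rep (mulS S v) x = S x * L2rep v x}.
  by apply: mu_aeS2 (mulS_rep u) (mulS_rep v) => x h1 h2 xab; split; [exact: h1|exact: h2].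
have h' : {ae mu, forall x, x \in `]1, 2[ ->
    L2rep (mulS S (c *: u + v)) x = S x * (c * L2rep u x + L2rep v x)}.
  by apply: mu_aeS2 (mulS_rep (c *: u + v)) (ae_rep_lin c u v) => x h1 h2 xab; rewrite h1// h2.
have h'' := ae_rep_lin c (mulS S u) (mulS S v).
have hh : {ae mu, forall x, x \in `]1, 2[ ->
    L2rep (c *: mulS S u + mulS S v) x = S x * (c * L2rep u x + L2rep v x)}.
  apply: mu_aeS2 h h'' => x h1 h2 xab; rewrite (h2 xab); have [-> ->] := h1 xab; ring.
by apply: mu_aeS2 h' hh => x h1 h2 xab; rewrite h1// h2.
Qed.

Lemma mulS0 : mulS S (0 : L) = 0.
Proof.
have := mulS_lin (-1) 0 0; rewrite scaler0 addr0 scaleN1r addNr.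
by [].
Qed.

Lemma mulS_coercive (u : L) : nu * ipL u u <= ipL (mulS S u) u.
Proof.
have i1 : intg `[1, 2] (fun x => nu * (reL u x * reL u x + imL u x * imL u x)).
  exact: (integrableZl _ _ (ipL_intg u u)).
rewrite /ipL -(Rint_Z _ (ipL_intg u u)).
apply: (le_Rint_ae i1 (ipL_intg (mulS S u) u)).
have hnu : {ae mu, forall x, x \in `]1, 2[ -> nu <= complex.Re (S x)} by apply/leb_ae.
apply: mu_aeS2 (mulS_rep u) hnu => x h1 h2 xab.
by rewrite /reL /imL (h1 xab) Re_mul_ge// h2.
Qed.

Lemma mulS_le M (u : L) : {ae mu, forall x, x \in `]1, 2[ -> nsq (S x) <= M ^+ 2} ->
  ipL (mulS S u) (mulS S u) <= M ^+ 2 * ipL u u.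
Proof.
move=> hM.
have i1 : intg `[1, 2] (fun x => M ^+ 2 * (reL u x * reL u x + imL u x * imL u x)).
  exact: (integrableZl _ _ (ipL_intg u u)).
rewrite /ipL -(Rint_Z _ (ipL_intg u u)).
apply: (le_Rint_ae (ipL_intg (mulS S u) (mulS S u)) i1).
apply: mu_aeS2 (mulS_rep u) hM => x h1 h2 xab.
by rewrite /reL /imL (h1 xab) nsq_mul_le// h2.
Qed.

End Coefficient.

(** * The inverse of the wave-heat operator: estimates *)

Section Resolvent.
Context (R : realType) (S : R -> R[i]) (nu : R).
Hypothesis S_Linfty : S \in cLfun (leb 1 2) +oo%E.
Hypothesis nu_gt0 : 0 < nu.
Hypothesis ReS_ge : {ae leb 1 2, forall x, nu <= complex.Re (S x)}.
Local Notation mu := (@lebesgue_measure R).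
Local Notation intg D f := (mu.-integrable D (EFin \o f)).
Local Notation V := (state R).
Implicit Types (x y z u : V) (g : L2itv (1 : R) 2) (F G : R -> R[i]).

Let lt01 : (0 : R) < 1. Proof. exact: ltr01. Qed.
Let le01 : (1 : R) - 0 <= 1. Proof. by rewrite subr0. Qed.
Let lt12 : (1 : R) < 2. Proof. exact: lt12. Qed.
Let le12 : (2 : R) - 1 <= 1. Proof. exact: le12. Qed.
Let in0 : (0 : R) \in `[0, 1]. Proof. by rewrite in_itv/= lexx ler01. Qed.
Let in1 : (1 : R) \in `[0, 1]. Proof. by rewrite in_itv/= lexx ler01. Qed.
Let in1' : (1 : R) \in `[1, 2]. Proof. by rewrite in_itv/= lexx ltW. Qed.
Let in2 : (2 : R) \in `[1, 2]. Proof. by rewrite in_itv/= lexx ltW. Qed.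

(** The equation [A_S x = y] as a first order system: [g] is the derivative of the
    temperature [x.2], and [V1], [V2], [W], [P] are the continuous representatives of
    the three components of [x] and of the heat flux. *)
Record solves x y g V1 V2 W P : Prop := Solves {
  sol_v1 : acrep x.1.1 y.1.2 V1;
  sol_v2 : acrep x.1.2 y.1.1 V2;
  sol_w : acrep x.2 g W;
  sol_p : acrep (mulS S g) y.2 P;
  sol_0 : V1 0 = 0;
  sol_2 : W 2 = 0;
  sol_1 : V1 1 = W 1;
  sol_flux : V2 1 = P 1 }.

Definition graph x y := exists g V1 V2 W P, solves x y g V1 V2 W P.

Lemma graphP x y : domA S x /\ y = opA S x <-> graph x y.
Proof.
case: x y => [[v1 v2] w] y; split=> [[[[h1 h2 h3 h4] [b0 b2] b1 bf] ->]|].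
  have [V1 r1] := H1_acrep lt01 h1; have [V2 r2] := H1_acrep lt01 h2.
  have [W r3] := H1_acrep lt12 h3; have [P r4] := H1_acrep lt12 h4.
  exists (ddz w), V1, V2, W, P.
  move: b0 b2 b1 bf; rewrite (crepE lt01 r1 in0) (crepE lt01 r1 in1) (crepE lt01 r2 in1).
  by rewrite (crepE lt12 r3 in1') (crepE lt12 r3 in2) (crepE lt12 r4 in1').
move=> [g [V1 [V2 [W [P [/= r1 r2 r3 r4 b0 b2 b1 bf]]]]]].
have [d1 h1] := ddzE lt01 r1; have [d2 h2] := ddzE lt01 r2; have [d3 h3] := ddzE lt12 r3.
have [d4 h4] := ddzE lt12 r4.
rewrite /domA /opA /= d3 d1 d2 d4; split; last by case: y {r1 r2 r4 d1 d2 d4} => [[? ?] ?].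
split => //.
- by rewrite (crepE lt01 r1 in0) (crepE lt12 r3 in2).
- by rewrite (crepE lt01 r1 in1) (crepE lt12 r3 in1').
- by rewrite (crepE lt01 r2 in1) (crepE lt12 r4 in1').
Qed.

Lemma graph_lin (c : R[i]) x x' y y' : graph x y -> graph x' y' ->
  graph (c *: x + x') (c *: y + y').
Proof.
move=> [g [V1 [V2 [W [P [r1 r2 r3 r4 b0 b2 b1 bf]]]]]].
move=> [g' [V1' [V2' [W' [P' [r1' r2' r3' r4' b0' b2' b1' bf']]]]]].
exists (c *: g + g'), (fun t => c * V1 t + V1' t), (fun t => c * V2 t + V2' t),
  (fun t => c * W t + W' t), (fun t => c * P t + P' t); split.
- exact: acrep_lin.
- exact: acrep_lin.
- exact: acrep_lin.
- by rewrite (mulS_lin S_Linfty); exact: acrep_lin.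
- by rewrite b0 b0' mulr0 addr0.
- by rewrite b2 b2' mulr0 addr0.
- by rewrite b1 b1'.
- by rewrite bf bf'.
Qed.

Definition ipS : V -> V -> R := ip_pair (ip_pair (@ipL R 0 1) (@ipL R 0 1)) (@ipL R 1 2).

Lemma ipS_inner_product : inner_product ipS.
Proof. by do ?apply: pair_inner_product; exact: ipL_inner_product. Qed.

Lemma ipS_complete : icomplete ipS.
Proof.
have H01 := @ipL_inner_product R 0 1.
apply: (pair_complete (pair_inner_product H01 H01) (@ipL_inner_product R 1 2)).
  by apply: (pair_complete H01 H01); exact: ipL_complete.
exact: ipL_complete.
Qed.

Lemma ipSE x y : ipS x y = ipL x.1.1 y.1.1 + ipL x.1.2 y.1.2 + ipL x.2 y.2.
Proof. by []. Qed.

Lemma ipL_ge0 (a b : R) (v : L2itv a b) : 0 <= ipL v v.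
Proof. exact: ip_ge0 (ipL_inner_product a b) v. Qed.

Lemma rprod0l (c : R[i]) : rprod 0 c = 0.
Proof. by rewrite /rprod/= !mul0r addr0. Qed.

(** The waves exchange energy with the heat equation only through the interface,
    where the transmission conditions make the boundary terms of both integrations
    by parts cancel; what is left is dissipated by the heat flux. *)
Lemma solves_dissipative x y g V1 V2 W P : solves x y g V1 V2 W P ->
  nu * ipL g g <= - ipS y x.
Proof.
move=> [r1 r2 r3 r4 b0 b2 b1 bf].
have e1 := acrep_ibp lt01 r1 r2; have e2 := acrep_ibp lt12 r3 r4.
have co := mulS_coercive S_Linfty ReS_ge g.
have C01 := ipC (ipL_inner_product (0 : R) 1); have C12 := ipC (ipL_inner_product (1 : R) 2).
move: e1 e2; rewrite b0 b2 b1 bf !rprod0l ipSE (C01 y.1.1) (C12 y.2) (C12 g).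
by lra.
Qed.

Variable M : R.
Hypothesis S_le : {ae mu, forall t : R, t \in `]1, 2[ -> nsq (S t) <= M ^+ 2}.

(** The heat part is controlled by its dissipation alone, and through the interface
    it controls the boundary values of the waves at [1]. The flux has no boundary
    condition at [2]; its value at [1] is bounded by its mean and its derivative. *)
Lemma solves_heat x y g V1 V2 W P : solves x y g V1 V2 W P ->
  [/\ ipL x.2 x.2 <= ipL g g, nsq (V1 1) <= ipL g g &
      nsq (V2 1) <= 2 * M ^+ 2 * ipL g g + 2 * ipL y.2 y.2].
Proof.
move=> [r1 r2 r3 r4 b0 b2 b1 bf].
have hW t : t \in `[1, 2] -> nsq (W t) <= ipL g g.
  by move=> tab; have := acrep_pt le12 r3 tab in2; rewrite b2 subr0.
split.
- exact: (acrep_le lt12 le12 r3 (ipL_ge0 g)).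
- by rewrite b1 hW.
- rewrite bf; apply: le_trans (acrep_avg lt12 le12 (len12 R) r4 in1') _.
  by rewrite lerD2r -mulrA ler_wpM2l// (mulS_le S_Linfty).
Qed.

Lemma solves_bound x y g V1 V2 W P : solves x y g V1 V2 W P ->
  ipS x x <= 4 * ipS y y + (4 * M ^+ 2 + 1) * ipL g g.
Proof.
move=> sol; have [h3 h1 h2] := solves_heat sol.
have [r1 r2 _ _ b0 _ _ _] := sol.
have k1 : ipL x.1.1 x.1.1 <= ipL y.1.2 y.1.2.
  apply: (acrep_le lt01 le01 r1 (ipL_ge0 _)) => t tab.
  by have := acrep_pt le01 r1 tab in0; rewrite b0 subr0.
have k2 : ipL x.1.2 x.1.2 <= 2 * nsq (V2 1) + 2 * ipL y.1.1 y.1.1.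
  apply: (acrep_le lt01 le01 r2) => [|t tab]; last exact: acrep_pt2 r2 tab in1.
  by rewrite addr_ge0// mulr_ge0// ?nsq_ge0 ?ipL_ge0.
rewrite !ipSE; have := ipL_ge0 y.1.1; have := ipL_ge0 y.1.2; have := ipL_ge0 y.2.
by lra.
Qed.

Let N_le x y g V1 V2 W P : solves x y g V1 V2 W P -> ipL g g <= - ipS y x / nu.
Proof.
by move=> sol; rewrite ler_pdivlMr// mulrC; exact: solves_dissipative sol.
Qed.

Lemma graph_dissipative x y : graph x y -> ipS y x <= 0.
Proof.
move=> [g [V1 [V2 [W [P sol]]]]]; have := solves_dissipative sol.
by have := mulr_ge0 (ltW nu_gt0) (ipL_ge0 g); lra.
Qed.

(** With [X] and [Y] the norms of [x] and [y], [solves_bound] and the dissipation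
    estimate give [X^2 <= 4 Y^2 + k X Y], hence [X <= (k + 4) Y]. *)
Lemma graph_bounded x y : graph x y ->
  inorm ipS x <= ((4 * M ^+ 2 + 1) / nu + 4) * inorm ipS y.
Proof.
move=> [g [V1 [V2 [W [P sol]]]]].
have H := ipS_inner_product.
have k0 : 0 <= (4 * M ^+ 2 + 1) / nu by rewrite divr_ge0 ?(ltW nu_gt0)// addr_ge0// mulr_ge0// sqr_ge0.
have Y0 := inorm_ge0 ipS y; have X0 := inorm_ge0 ipS x.
have b := solves_bound sol; have n := N_le sol.
have c : - ipS y x <= inorm ipS y * inorm ipS x.
  have := ip_le H y (- x); rewrite !(ipE H) inormN//.
have {b} : inorm ipS x ^+ 2 <= 4 * inorm ipS y ^+ 2 +
    ((4 * M ^+ 2 + 1) / nu) * (inorm ipS y * inorm ipS x).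
  rewrite !(inorm_sqr H); apply: le_trans b _; rewrite lerD2l.
  apply: le_trans (_ : (4 * M ^+ 2 + 1) * (- ipS y x / nu) <= _).
    by rewrite ler_wpM2l// addr_ge0// mulr_ge0// sqr_ge0.
  by rewrite mulrCA mulrC; exact: ler_wpM2l.
set k := (4 * M ^+ 2 + 1) / nu in k0 *.
move=> h; rewrite leNgt; apply/negP => lt.
have X1 : 0 < inorm ipS x by apply: le_lt_trans lt; rewrite mulr_ge0// addr_ge0.
have p1 : (k + 4) * inorm ipS y * inorm ipS x < inorm ipS x * inorm ipS x by rewrite ltr_pM2r.
have Yle : inorm ipS y <= inorm ipS x.
  by apply: le_trans (ltW lt); rewrite ler_peMl//; lra.
have p2 := ler_wpM2l Y0 Yle.
by move: h; rewrite !expr2; lra.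
Qed.

(** The polarization of twice the weighted product of the two wave components. *)
Definition wipS x y := wip x.1.1 y.1.2 + wip y.1.1 x.1.2.

(** The multiplier identity expresses the wave energy of [u] by [- 2 wipS z u] and by
    the boundary values at the interface. These are controlled by the dissipation of
    [u] and, for the flux, by the heat component of [z], which is in turn controlled by
    the dissipation of [z]. *)
Lemma graph_observable u z y : graph u z -> graph z y ->
  ipS u u <= ((2 * M ^+ 2 + 2) / nu) * (- ipS z u - ipS y z) - 2 * wipS z u.
Proof.
move=> [g [U1 [U2 [W [P su]]]]] [g' [Z1 [Z2 [W' [P' sz]]]]].
have [u3 u1 u2] := solves_heat su; have [z3 _ _] := solves_heat sz.
have [r1 r2 _ _ b0 _ _ _] := su.
have e1 := acrep_multiplier lt01 r1; have e2 := acrep_multiplier lt01 r2.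
have n1 := N_le su; have n2 := N_le sz.
have n1' : (2 * M ^+ 2 + 2) * ipL g g <= (2 * M ^+ 2 + 2) * (- ipS z u / nu).
  by rewrite ler_wpM2l// addr_ge0// mulr_ge0// sqr_ge0.
have n2' : (2 * M ^+ 2 + 2) * ipL g' g' <= (2 * M ^+ 2 + 2) * (- ipS y z / nu).
  by rewrite ler_wpM2l// addr_ge0// mulr_ge0// sqr_ge0.
have m2 : 0 <= M ^+ 2 * ipL g' g' by rewrite mulr_ge0 ?sqr_ge0 ?ipL_ge0.
have -> : (2 * M ^+ 2 + 2) / nu * (- ipS z u - ipS y z) =
  (2 * M ^+ 2 + 2) * (- ipS z u / nu) + (2 * M ^+ 2 + 2) * (- ipS y z / nu) by ring.
rewrite [ipS u u]ipSE /wipS (wipC u.1.1).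
move: e1 e2; rewrite !mul1r !mul0r !subr0.
by lra.
Qed.

Lemma wipS_C x y : wipS x y = wipS y x.
Proof. by rewrite /wipS addrC. Qed.

Lemma wipS_lin (r : R) x y z : wipS (r%:C *: x + y) z = r * wipS x z + wipS y z.
Proof.
by rewrite /wipS !(wipC z.1.1) !(wip_lin lt01); ring.
Qed.

Lemma wipS_le x : `|wipS x x| <= ipS x x.
Proof.
have := wip_le lt01 x.1.1 x.1.2 (lexx _) (lexx _).
have -> : wipS x x = 2 * wip x.1.1 x.1.2 by rewrite /wipS; ring.
rewrite ipSE => h; apply: le_trans h _.
by rewrite lerDl ipL_ge0.
Qed.

Lemma graph_uniq x x' y : graph x y -> graph x' y -> x = x'.
Proof.
move=> g g'; have := graph_lin (-1) g' g; rewrite !scaleN1r addNr => /graph_bounded.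
have H := ipS_inner_product.
rewrite (inorm0 H) mulr0 => h; have h0 : inorm ipS (- x' + x) = 0 by apply/le_anti; rewrite h inorm_ge0.
by apply/eqP; rewrite -subr_eq0 addrC; apply/eqP/(inorm_eq0 H).
Qed.

Lemma graph_inj y : graph 0 y -> y = 0.
Proof.
move=> [g [V1 [V2 [W [P [/= r1 r2 r3 r4 _ _ _ _]]]]]].
have zero (a b : R) (h : L2itv a b) F (ab : a < b) : acrep 0 h F -> h = 0.
  move=> r; have := acrep_lin (-1) r r; rewrite !scaleN1r !addNr.
  by move=> r'; exact: (acrep_uniq ab r r').
have g0 : g = 0 by exact: zero lt12 r3.
rewrite g0 (mulS0 S_Linfty) in r4.
case: y r1 r2 r4 => [[y1 y2] y3] /= r1 r2 r4.
by rewrite (zero _ _ _ _ lt01 r1) (zero _ _ _ _ lt01 r2) (zero _ _ _ _ lt12 r4).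
Qed.

End Resolvent.

(** * Solvability and conclusion *)

Section Solvability.
Context (R : realType) (S : R -> R[i]) (nu : R).
Hypothesis S_Linfty : S \in cLfun (leb 1 2) +oo%E.
Hypothesis nu_gt0 : 0 < nu.
Hypothesis ReS_ge : {ae leb 1 2, forall x, nu <= complex.Re (S x)}.
Local Notation mu := (@lebesgue_measure R).
Local Notation L := (L2itv (1 : R) 2).
Local Notation V := (state R).

(** The inverse of [S t], as conjugate over squared modulus: in this form its
    measurability follows from that of real powers. *)
Let sinv (t : R) : R[i] :=
  (complex.Re (S t) * (nsq (S t)) `^ (-1) +i* (- (complex.Im (S t) * (nsq (S t)) `^ (-1))))%C.

Lemma mulS_onto (v : L) : exists g : L, mulS S g = v.
Proof.
have [mr mi] := S_meas S_Linfty.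
have mn : measurable_fun setT (fun t => (nsq (S t)) `^ (-1)).
  apply: (measurableT_comp (measurable_powR _)).
  by apply: measurable_funD; exact: measurable_funX.
have hnu : {ae mu, forall t : R, t \in `]1, 2[ -> nu ^+ 2 <= nsq (S t)}.
  have /leb_ae := ReS_ge; apply: mu_aeS => t h tab.
  apply: le_trans (_ : complex.Re (S t) ^+ 2 <= _); last by rewrite lerDl sqr_ge0.
  by have h' := h tab; rewrite ler_pXn2r ?nnegrE ?(ltW nu_gt0)// (le_trans (ltW nu_gt0)).
have inv_le : {ae mu, forall t : R, t \in `]1, 2[ -> nsq (sinv t) <= (nu^-1) ^+ 2}.
  apply: mu_aeS hnu => t h tab; have {tab}h := h tab.
  have n0 : 0 < nsq (S t) by apply: lt_le_trans h; rewrite exprn_gt0.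
  have -> : nsq (sinv t) = (nsq (S t))^-1.
    have e : nsq (sinv t) = nsq (S t) * (nsq (S t))^-1 ^+ 2.
      rewrite {1}/nsq /sinv /= powR_inv1 ?nsq_ge0//.
      by set k := (nsq (S t))^-1; rewrite /nsq; ring.
    by rewrite e expr2 mulrA mulfV ?gt_eqF// mul1r.
  by rewrite exprVn lef_pV2 ?posrE ?exprn_gt0.
exists (toL2 (leb 1 2) (fun t => sinv t * L2rep v t)).
apply: L2_eq.
have h1 := mulS_rep S_Linfty (toL2 (leb 1 2) (fun t => sinv t * L2rep v t)).
have nu'0 : 0 < nu^-1 by rewrite invr_gt0.
have mri : measurable_fun setT (fun t => complex.Re (sinv t)) by exact: measurable_funM.
have mii : measurable_fun setT (fun t => complex.Im (sinv t)).
  by apply: measurable_funN; exact: measurable_funM.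
have h2 := mult_rep v nu'0 mri mii inv_le.
have h3 : {ae mu, forall t : R, t \in `]1, 2[ -> S t * sinv t = 1}.
  apply: mu_aeS hnu => t h tab; have {tab}h := h tab.
  have n0 : 0 < nsq (S t) by apply: lt_le_trans h; rewrite exprn_gt0.
  have n1 : nsq (S t) * (nsq (S t))^-1 = 1 by rewrite mulfV ?gt_eqF.
  move: n1; rewrite /sinv powR_inv1 ?nsq_ge0//; set k := (nsq (S t))^-1.
  rewrite /nsq; case: (S t) => p q /= n1; apply: ReIm_eq => /=; last by ring.
  by rewrite -n1; ring.
have h4 : {ae mu, forall t : R, t \in `]1, 2[ ->
    S t * L2rep (toL2 (leb 1 2) (fun t => sinv t * L2rep v t)) t = L2rep v t}.
  by apply: mu_aeS2 h2 h3 => t h e tab; rewrite (h tab) mulrA (e tab) mul1r.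
by apply: mu_aeS2 h1 h4 => t h e tab; rewrite (h tab) (e tab).
Qed.

Let lt01 : (0 : R) < 1. Proof. exact: ltr01. Qed.
Let lt12 : (1 : R) < 2. Proof. exact: lt12. Qed.
Let in0 : (0 : R) \in `[0, 1]. Proof. by rewrite in_itv/= lexx ler01. Qed.
Let in1 : (1 : R) \in `[0, 1]. Proof. by rewrite in_itv/= lexx ler01. Qed.
Let in1' : (1 : R) \in `[1, 2]. Proof. by rewrite in_itv/= lexx ltW. Qed.

(** The stationary heat profile driven by unit flux, normalized by [E 1 = 0]. If it
    vanished at [2] as well, then [\int S |g|^2] would vanish after integration by
    parts, so [g = 0] by coercivity, against [S g = 1]. *)
Lemma unit_flux : exists (g one w : L) I E, [/\ acrep one 0 I, I 1 = 1, mulS S g = one,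
  acrep w g E & E 1 = 0] /\ E 2 != 0.
Proof.
have [one [I [rO O1]]] := prim_ex lt12 0 1 in1'.
have [g eg] := mulS_onto one.
have [w [E [rE E1]]] := prim_ex lt12 g 0 in1'.
exists g, one, w, I, E; split => //; apply/eqP => E2.
have e := acrep_ibp lt12 rE rO; move: e.
have H := ipL_inner_product (1 : R) 2.
have w0 : ipL w 0 = 0 by rewrite (ipC H) -(scale0r 0) -(rmorph0 (real_complex R)) (ipZl H) mul0r.
rewrite E1 E2 w0 addr0 !rprod0l subrr -eg (ipC H) => gg.
have := mulS_coercive S_Linfty ReS_ge g; rewrite gg pmulr_rle0// => g0.
have {}g0 : g = 0 by apply: (ip_eq0 H); apply/le_anti; rewrite g0 (ip_ge0 H).
have one0 : one = 0 by rewrite -eg g0 (mulS0 S_Linfty).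
have := acrep_lin (-1) rO rO; rewrite !scaleN1r !addNr => rZ.
rewrite one0 in rO.
have := acrep_eq lt12 rO rZ in1'; rewrite O1 => /eqP.
by rewrite mulN1r addNr oner_eq0.
Qed.

(** Integrate the equations successively. The only unknown constant is the value [c] of
    the flux at the interface; a multiple of the profile of [unit_flux] adjusts it so
    that the temperature vanishes at [2]. *)
Lemma graph_onto y : exists x, graph S x y.
Proof.
have [V1 [F1 [r1 b0]]] := prim_ex lt01 y.1.2 0 in0.
have [v [G [rG G1]]] := prim_ex lt12 y.2 0 in1'.
have [g2 eg2] := mulS_onto v.
have [w2 [E2 [rE2 E21]]] := prim_ex lt12 g2 (F1 1) in1'.
have [g1 [one [w1 [I [E1 [[rO O1 eg1 rE1 E11] E12]]]]]] := unit_flux.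
pose c := - E2 2 / E1 2.
have [V2 [F2 [r2 b1]]] := prim_ex lt01 y.1.1 c in1.
exists (V1, V2, c *: w1 + w2), (c *: g1 + g2), F1, F2, (fun t => c * E1 t + E2 t),
  (fun t => c * I t + G t); split => //.
- exact: acrep_lin.
- rewrite (mulS_lin S_Linfty) eg1 eg2.
  by have := acrep_lin c rO rG; rewrite scaler0 add0r.
- by rewrite /c mulfVK// addNr.
- by rewrite E11 E21 mulr0 add0r.
- by rewrite O1 G1 mulr1 addr0.
Qed.

Lemma graph_inverse : exists K : {linear V -> V}, forall x y, x = K y <-> graph S x y.
Proof.
have [M _ hM] := S_bounded S_Linfty.
pose K y : V := xget 0 [set x | graph S x y].
have gK y : graph S (K y) y.
  have [x gx] := graph_onto y.
  by apply: (xgetPex 0 (P := [set x | graph S x y])); exists x.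
have KP x y : x = K y <-> graph S x y.
  by split=> [->//|gx]; exact: (graph_uniq S_Linfty nu_gt0 ReS_ge hM gx (gK y)).
have K_linear : linear K by move=> c x y; apply/esym/KP/(graph_lin S_Linfty); exact/KP.
pose KL := GRing.isLinear.Build R[i] V V *:%R K K_linear.
pose KK : {linear V -> V} := HB.pack K KL.
by exists KK.
Qed.

End Solvability.

Section Norm.
Context (R : realType).
Local Notation V := (state R).

Lemma ipS_norm_le (x : V) : `|x| <= (3 * inorm (@ipS R) x)%:C.
Proof.
have base (a b : R) (u : L2itv a b) : `|u| <= (3 * inorm (@ipL R a b) u)%:C.
  by rewrite L2_normE -inorm_ipL lecR ler_peMl ?inorm_ge0//; lra.
have H (a b : R) := ipL_inner_product a b.
apply: (pair_norm_le (pair_inner_product (H _ _) (H _ _)) (H _ _)) => // [z|z]; last exact: base.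
by apply: (pair_norm_le (H _ _) (H _ _)) => // t; exact: base.
Qed.

Lemma ipS_norm_ge (x : V) : (inorm (@ipS R) x)%:C <= 3%:C * `|x|.
Proof.
have base (a b : R) (u : L2itv a b) : (inorm (@ipL R a b) u)%:C <= 1%:C * `|u|.
  by rewrite inorm_ipL L2_normE mul1r.
have H (a b : R) := ipL_inner_product a b.
have -> : (3 : R) = (1 + 1) + 1 by ring.
apply: (pair_norm_ge (pair_inner_product (H _ _) (H _ _)) (H _ _)) => // [z|z]; last exact: base.
by apply: (pair_norm_ge (H _ _) (H _ _)) => // t; exact: base.
Qed.

End Norm.

Theorem theorem4p1 (R : realType) (S : R -> R[i]) (nu : R)
    (S_Linfty : S \in cLfun (leb 1 2) +oo%E)
    (nu_gt0 : 0 < nu)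
    (ReS_ge : {ae leb 1 2, forall x, nu <= complex.Re (S x)}) :
  exists T : R -> state R -> state R,
    [/\ C0_semigroup T, is_generator (domA S) (opA S) T & strongly_stable T].
Proof.
have [M _ S_le] := S_bounded S_Linfty.
have [K KP] := graph_inverse S_Linfty nu_gt0 ReS_ge.
have gK y : graph S (K y) y by exact/KP.
have three : (0 : R) < 3 by lra.
have C0 : 0 < (4 * M ^+ 2 + 1) / nu + 4.
  by rewrite ltr_wpDl// divr_ge0 ?(ltW nu_gt0)// addr_ge0// mulr_ge0// sqr_ge0.
have dis y : ipS y (K y) <= 0 := graph_dissipative S_Linfty nu_gt0 ReS_ge (gK y).
have bnd y := graph_bounded S_Linfty nu_gt0 ReS_ge S_le (gK y).
have inj y : K y = 0 -> y = 0.
  by move=> y0; apply: (graph_inj S_Linfty); rewrite -y0.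
exists (expinv (@ipS R) K).
apply: (dissipative_inverse_stable_semigroup (ipS_inner_product R) (@ipS_complete R)
  three (@ipS_norm_le R) (@ipS_norm_ge R) C0 dis bnd inj
  (m := @wipS R) (k := (2 * M ^+ 2 + 2) / nu)).
- by move=> x y; rewrite KP; exact: graphP.
- by rewrite divr_ge0 ?(ltW nu_gt0)// addr_ge0// mulr_ge0// sqr_ge0.
- exact: wipS_C.
- by move=> x y z; have := wipS_lin 1 x y z; rewrite scale1r mul1r.
- move=> r x y; have := wipS_lin r x 0 y; have := wipS_lin 1 0 0 y.
  by rewrite scale1r mul1r !addr0 => h ->; lra.
- exact: wipS_le.
- by move=> y; exact: (graph_observable S_Linfty nu_gt0 ReS_ge S_le (gK (K y)) (gK y)).
Qed.
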